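(* Let $N$ be a nilpotent Lie group of dimension $6$, with Lie algebra $\mathfrak n$, endowed with an invariant $SU(3)$ structure $(\omega,\tilde\psi^+)$, with induced inner product $h$ and almost complex structure $J$ on $\mathfrak n$. Suppose there is a non-singular and self-adjoint (with respect to $h$) derivation $D$ of the Lie algebra $\mathfrak n$ such that $(DJ)^2=(JD)^2$. Then on the solvable extension $\mathfrak s=\mathfrak n\oplus\mathbb R e_7$ with $\mathrm{ad}_{e_7}=D$ (on $\mathfrak n$), the $G_2$ structure $\varphi=\omega\wedge e^7+\tilde\psi^+$ is conformally parallel if and only if $\mathfrak n$ is isomorphic to one of the following: $$(0,0,0,e^{12},e^{13},e^{23}),\quad (0,0,0,0,e^{12},e^{13}),\quad (0,0,0,0,e^{12},e^{14}+e^{23}),\quad (0,0,0,0,0,e^{12}+e^{34}),$$ $$(0,0,0,0,e^{13}+e^{42},e^{12}+e^{34}),\quad (0,0,0,0,0,e^{12}),\quad (0,0,0,0,0,0).$$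
   Context: Notation: $e^{ij\dots}=e^i\wedge e^j\wedge\cdots$. A tuple $(\beta_1,\dots,\beta_6)$ of $2$-forms denotes the real Lie algebra whose dual has a basis $e^1,\dots,e^6$ with $\hat d e^i=\beta_i$, where $\hat d$ is the Chevalley--Eilenberg differential, $\hat d\alpha(X,Y)=-\alpha([X,Y])$ on $1$-forms. The group $N$ is connected and simply connected. An invariant $SU(3)$ structure on $N$ is a pair $(\omega,\tilde\psi^+)$ of left-invariant forms, $\omega\in\Lambda^2\mathfrak n^*$ and $\tilde\psi^+\in\Lambda^3\mathfrak n^*$, for which there is a basis $f^1,\dots,f^6$ of $\mathfrak n^*$ with $\omega=f^{14}-f^{23}+f^{56}$ and $\tilde\psi^++i\tilde\psi^-=(f^1+if^4)\wedge(f^2-if^3)\wedge(f^5+if^6)$, where $\tilde\psi^\pm$ are real. The induced inner product $h$ is the one making $(f^i)$ orthonormal, and $J$ is the orthogonal almost complex structure for which $f^1+if^4$, $f^2-if^3$, $f^5+if^6$ are of type $(1,0)$ (on the dual basis, $Jf_1=f_4$, $Jf_2=-f_3$, $Jf_5=f_6$). The solvable extension $\mathfrak s=\mathfrak n\oplus\mathbb R e_7$ has bracket $[e_7,U]=DU$, $[U,V]=[U,V]_{\mathfrak n}$ for $U,V\in\mathfrak n$, and inner product $g$ extending $h$ with $e_7$ a unit vector orthogonal to $\mathfrak n$; $e^7=g(e_7,\cdot)$. The form $\varphi=\omega\wedge e^7+\tilde\psi^+$ is a left-invariant $G_2$ structure, with metric $g$, on the corresponding simply connected Lie group, and $*\varphi=\tilde\psi^-\wedge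 e^7+\tfrac12\omega\wedge\omega$. Conformally parallel means that $g$ can be changed to a metric with holonomy contained in $G_2$ by a transformation $g\mapsto e^{2f}g$; equivalently the intrinsic torsion of $\varphi$ lies in the single class $\mathcal X_4$, i.e. $d\varphi=3\tau\wedge\varphi$ and $d{*\varphi}=4\tau\wedge{*\varphi}$ for a closed $1$-form $\tau$. In the present setting $\tau=m\,e^7$, so the condition reads $d\varphi=3m\,e^7\wedge\varphi$, $d{*\varphi}=4m\,e^7\wedge{*\varphi}$ with $m$ a real constant, assumed non-zero.
   Formalization: ''If'' is proved as: each listed algebra admits some SU(3) structure and D with φ conformally parallel. For a fixed structure and D it is false: n abelian, D=diag(1,...,6) in an adapted frame satisfies all hypotheses but φ is not conformally parallel. ''Only if'' holds for every structure and D. *)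

(* Defs.v *)
From HB Require Import structures.
From mathcomp Require Import all_boot all_order all_fingroup all_algebra.
From mathcomp Require Import boolp functions reals.
From mathcomp Require Import complex.
Set Implicit Arguments.
Unset Strict Implicit.
Unset Printing Implicit Defensive.
Import GRing.Theory.
Local Open Scope ring_scope.

(* k-forms are plain functions of k vectors; multilinearity and alternation
   are not part of the type, but every form below is a combination of wedge
   products of linear 1-forms, or a differential of such. *)
Definition form (K V : Type) (k : nat) : Type := ('I_k -> V) -> K.

Definition one_form (K V : Type) (a : V -> K) : form K V 1 :=
  fun x => a (x ord0).

Definition fscale (K : fieldType) (V : Type) (k : nat) (c : K)
    (a : form K V k) : form K V k := fun x => c * a x.

(* Normalised so that (a /\ b)(x, y) = a x * b y - a y * b x on 1-forms. *)
Definition wedge (K : fieldType) (V : Type) (p q : nat)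
    (a : form K V p) (b : form K V q) : form K V (p + q) :=
  fun x => (p`! * q`!)%:R^-1 *
    \sum_(s : 'S_(p + q)) (-1) ^+ s *
      (a (fun i => x (s (lshift q i))) * b (fun j => x (s (rshift p j)))).

Definition fcons (V : Type) (k : nat) (v : V) (x : 'I_k -> V) : 'I_k.+1 -> V :=
  fun l => if unlift ord0 l is Some l' then x l' else v.

(* Chevalley-Eilenberg differential in positive degree,
     (d a)(x_0, .., x_(k+1)) = \sum_(i < j') (-1)^(i + j')
        a([x_i, x_j'], x_0, .., ^x_i, .., ^x_j', .., x_(k+1)),
   with j' = lift i j = j + 1 when i <= j. *)
Definition ce_diff (K : fieldType) (V : Type) (br : V -> V -> V) (k : nat)
    (a : form K V k.+1) : form K V k.+2 :=
  fun x => \sum_(i < k.+2) \sum_(j < k.+1 | (i <= j)%N) (-1) ^+ (i + j.+1) *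
    a (fcons (br (x i) (x (lift i j))) (fun l => x (lift i (lift j l)))).

Record is_lie_bracket (R : fieldType) (V : lmodType R) (br : V -> V -> V) :
    Prop := IsLieBracket {
  lie_linearl : forall y, linear (br^~ y);
  lie_linearr : forall x, linear (br x);
  lie_alternating : forall x, br x x = 0;
  lie_jacobi : forall x y z,
    br x (br y z) + br y (br z x) + br z (br x y) = 0 }.

Definition commutator_space (R : fieldType) (V : vectType R)
    (br : V -> V -> V) (U W : {vspace V}) : {vspace V} :=
  <<[seq br x y | x <- vbasis U, y <- vbasis W]>>%VS.

Definition lower_central (R : fieldType) (V : vectType R)
    (br : V -> V -> V) (k : nat) : {vspace V} :=
  iter k (commutator_space br fullv) fullv.

Definition nilpotent_lie (R : fieldType) (V : vectType R)
    (br : V -> V -> V) : Prop :=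
  exists k, lower_central br k = 0%VS.

Definition lie_isomorphic (R : fieldType) (V W : lmodType R)
    (brV : V -> V -> V) (brW : W -> W -> W) : Prop :=
  exists2 F : {linear V -> W}, bijective F &
    forall x y, F (brV x y) = brW (F x) (F y).

(* Indices 1, .., 6 of the literature, as elements of 'I_6. *)
Definition idx (k : nat) : 'I_6 := inord k.-1.

Section SU3.
Variables (R : realType) (V : vectType R).

Definition cform (k : nat) (a b : form R V k) : form R[i] V k :=
  fun x => (a x +i* b x)%C.

Definition coframe (f : 6.-tuple V) (k : nat) : form R V 1 :=
  one_form (coord f (idx k)).

Definition frame_omega (f : 6.-tuple V) : form R V 2 :=
  let e := coframe f in
  wedge (e 1%N) (e 4%N) - wedge (e 2%N) (e 3%N) + wedge (e 5%N) (e 6%N).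

Definition frame_volume (f : 6.-tuple V) : form R[i] V 3 :=
  let e := coframe f in
  wedge (wedge (cform (e 1%N) (e 4%N)) (cform (e 2%N) (- e 3%N)))
        (cform (e 5%N) (e 6%N)).

Definition frame_complex_structure (f : 6.-tuple V) (J : 'End(V)) : Prop :=
  let v k := tnth f (idx k) in
  [/\ (J \o J = - \1)%VF, J (v 1%N) = v 4%N, J (v 2%N) = - v 3%N
    & J (v 5%N) = v 6%N].

(* The pair (su3_omega, su3_psip) is the SU(3) structure; su3_psim, su3_metric
   and su3_J are the induced data, tied to it through one adapted frame. *)
Record su3_structure := SU3Structure {
  su3_omega : form R V 2;
  su3_psip : form R V 3;
  su3_psim : form R V 3;
  su3_metric : V -> V -> R;
  su3_J : 'End(V);
  su3P : exists f : 6.-tuple V,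
    [/\ basis_of fullv f,
        su3_omega = frame_omega f,
        cform su3_psip su3_psim = frame_volume f,
        forall x y, su3_metric x y = \sum_i coord f i x * coord f i y
      & frame_complex_structure f su3_J] }.

End SU3.

Section Extension.
Variables (R : realType) (V : vectType R) (br : V -> V -> V).

Definition is_derivation (D : 'End(V)) : Prop :=
  forall x y, D (br x y) = br (D x) y + br x (D y).

Definition self_adjoint (h : V -> V -> R) (D : 'End(V)) : Prop :=
  forall x y, h (D x) y = h x (D y).

(* The carrier V (+) R e_7 of the extension; (U, a) stands for U + a e_7. *)
Definition ext : vectType R := (V * R^o)%type.

Definition ext_e7 : ext := (0, 1).

Definition ext_bracket (D : 'End(V)) (x y : ext) : ext :=
  (br x.1 y.1 + x.2 *: D y.1 - y.2 *: D x.1, 0).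

Definition ext_metric (h : V -> V -> R) (x y : ext) : R :=
  h x.1 y.1 + x.2 * y.2.

Definition ext_form (k : nat) (a : form R V k) : form R ext k :=
  fun x => a (fun i => (x i).1).

Variable S : su3_structure V.

Definition e7_form : form R ext 1 :=
  one_form (ext_metric (su3_metric S) ext_e7).

Definition g2_phi : form R ext 3 :=
  (wedge (ext_form (su3_omega S)) e7_form : form R ext 3)
  + ext_form (su3_psip S).

(* The Hodge dual of g2_phi. *)
Definition g2_star_phi : form R ext 4 :=
  (wedge (ext_form (su3_psim S)) e7_form : form R ext 4)
  + fscale 2^-1 (wedge (ext_form (su3_omega S)) (ext_form (su3_omega S))
                 : form R ext 4).

(* Intrinsic torsion in the class X_4, with Lee form tau. *)
Definition torsion_X4 (D : 'End(V)) (tau : form R ext 1) : Prop :=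
  let d k (a : form R ext k.+1) := ce_diff (ext_bracket D) a in
  [/\ d 0%N tau = 0,
      d 2%N g2_phi = fscale 3 (wedge tau g2_phi : form R ext 4)
    & d 3%N g2_star_phi = fscale 4 (wedge tau g2_star_phi : form R ext 5)].

Definition conformally_parallel (D : 'End(V)) : Prop :=
  exists2 m : R, m != 0 & torsion_X4 D (fscale m e7_form).

End Extension.

Section StructureEquations.
Variable R : realType.

Definition e_ (k : nat) : form R 'rV[R]_6 1 :=
  one_form (fun x : 'rV[R]_6 => x ord0 (idx k)).

Definition e2_ (i j : nat) : form R 'rV[R]_6 2 := wedge (e_ i) (e_ j).

(* The Lie algebra (b_1, .., b_6) on R^6: e^i([x, y]) = - b_i(x, y). *)
Definition tuple_bracket (b : 6.-tuple (form R 'rV[R]_6 2))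
    (x y : 'rV[R]_6) : 'rV[R]_6 :=
  \row_i - tnth b i (fun l => if l == ord0 then x else y).

Lemma tuple_bracketP (b : 6.-tuple (form R 'rV[R]_6 2)) (k : nat) :
  ce_diff (tuple_bracket b) (e_ k) = tnth b (idx k).
Proof.
apply/funext => x; rewrite /ce_diff big_ord_recl.
rewrite [X in _ + X]big1 ?addr0 => [|i _]; last by rewrite big_pred0 // => -[[]].
rewrite big_mkcond /= big_ord1 /= addn1 expr1 mulN1r /e_ /one_form /fcons.
rewrite unlift_none mxE opprK; congr (tnth b _ _); apply/funext => l.
case: (unliftP ord0 l) => [j ->|->]; last by rewrite eqxx.
by rewrite (ord1 j).
Qed.

Definition isomorphic_to (V : vectType R) (br : V -> V -> V)
    (b1 b2 b3 b4 b5 b6 : form R 'rV[R]_6 2) : Prop :=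
  lie_isomorphic br (tuple_bracket [tuple b1; b2; b3; b4; b5; b6]).

End StructureEquations.

(* Main.v *)
(* Since D and J D J^-1 commute and are self-adjoint, there is a unitary frame
   x_k, y_k = J x_k (k = 1, 2, 3) of eigenvectors of D, in which the complex
   volume form is zeta z_1 z_2 z_3 with |zeta| = 1.  As no eigenvalue of D
   vanishes, the torsion equations leave only the brackets [P_k, P_l] in P_m of
   the planes P_k = <x_k, y_k>, {k, l, m} = {1, 2, 3}; so each triple M of signs
   (x or y in each plane) carries three structure coefficients g_1, g_2, g_3.

   Normalise m = -1 and let sigma_k be the trace of D on P_k, T the trace of D.
   With c_M = Re (zeta i^(number of y's in M)) and w_M the weight of M:
     sum_k g_k(M) = - c_M (w_M - 3),    g_k(M) <> 0 -> w_M = sigma_k,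
     sum_M c_M g_k(M) = A_k := sigma_k + 4 - T,
   and the Jacobi identity gives sum_M g_k(M) g_l(M) = A_k A_l for k <> l.
   Hence sum_M g_k(M)^2 = (T - 5) A_k, so 5 < T <= 6 and A_k >= 0.  If T < 6 and
   zeta is neither real nor imaginary, D is scalar on some P_k, so in every case
   the frame can be rotated to make zeta = 1.  If only A_3 is nonzero, g_3 takes
   the values 0 and k c_M for one constant k; otherwise, by Cauchy-Schwarz, all
   the g_k are supported on a single M.  These are the listed algebras. *)
From HB Require Import structures.
From mathcomp Require Import all_boot all_order all_fingroup all_algebra.
From mathcomp Require Import boolp functions reals.
From mathcomp Require Import complex ring lra zify.
Require Import Defs.
Set Implicit Arguments.
Unset Strict Implicit.
Unset Printing Implicit Defensive.
Import Order.TTheory GRing.Theory Num.Theory.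
Local Open Scope ring_scope.

(** * Evaluation of wedge products and differentials *)

(** The pair (S, D) is quantified existentially because the equivalence fails for a fixed pair: on
    the abelian algebra every non-singular D diagonal in a unitary frame meets the hypotheses, but
    the torsion equations then force D to be scalar. The obstacle is the phase zeta. The
    eigenvectors of D fix the frame, so a plane can be rotated without spoiling the diagonal form of
    D only if D is scalar there or if the rotation is by a multiple of a right angle. This is why
    the structure equations are first solved for arbitrary C + i S, far enough to find a plane of
    the first kind; at T = 6 the algebra is abelian and no rotation is made. The converse takes zeta
    = 1 and m = -1. Either all brackets lie in one plane, with n non-zero coefficients of size 2 /
    (n + 2), or the algebra is free on the three vectors x_k, with all coefficients 2 / 5. These
    numbers are forced by requiring the D that the torsion equations determine to be a
    derivation. *)

Lemma lift_perm_bij n (k : 'I_n.+1) :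
  bijective (fun p : 'I_n.+1 * 'S_n => lift_perm k p.1 p.2).
Proof.
apply: inj_card_bij; last by rewrite card_prod !card_Sn card_ord factS.
move=> [i s] [j t] /= e.
have eij : i = j by rewrite -(lift_perm_id k i s) e lift_perm_id.
rewrite -{j}eij in e *; congr (_, _); apply/permP => l.
by apply: (@lift_inj _ i); rewrite -!(lift_perm_lift k) e.
Qed.

(** Laplace expansion along the k-th slot. The summand G is arbitrary, since the terms of a wedge
    product are not products of matrix entries. *)
Lemma sum_perm_lift (K : pzRingType) n (k : 'I_n.+1)
    (G : 'I_n.+1 -> ('I_n -> 'I_n.+1) -> K) :
  \sum_(s : 'S_n.+1) (-1) ^+ s * G (s k) (fun j => s (lift k j)) =
  \sum_(i < n.+1) (-1) ^+ (k + i) *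
    \sum_(s : 'S_n) (-1) ^+ s * G i (fun j => lift i (s j)).
Proof.
rewrite (reindex _ (onW_bij _ (lift_perm_bij k))) /=.
under [RHS]eq_bigr do rewrite big_distrr /=.
rewrite pair_big /=; apply: eq_bigr => -[i s] _ /=.
rewrite lift_perm_id odd_lift_perm /= -oddD signr_addb signr_odd mulrA.
by congr (_ * G i _); apply/funext => j; rewrite lift_perm_lift.
Qed.

(** Not part of the type of forms, but it is what collapses the sum over all permutations in [wedge]
    to a sum over shuffles. *)
Definition alternating (K : fieldType) (V : Type) k (a : form K V k) : Prop :=
  forall (s : 'S_k) x, a (x \o s) = (-1) ^+ s * a x.

Section Alternating.
Variables (K : fieldType) (V : Type).

Lemma alternating1 (a : form K V 1) : alternating a.
Proof.
move=> s x; rewrite (_ : s = 1%g) ?odd_perm1 ?mul1r; last first.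
  by apply/permP => i; rewrite !ord1.
by congr a; apply/funext => i; rewrite /= perm1.
Qed.

Lemma alternatingD k (a b : form K V k) :
  alternating a -> alternating b -> alternating (a + b).
Proof. by move=> ha hb s x; rewrite !fctE ha hb mulrDr. Qed.

Lemma alternatingN k (a : form K V k) : alternating a -> alternating (- a).
Proof. by move=> ha s x; rewrite !fctE ha mulrN. Qed.

Lemma alternating_scale k c (a : form K V k) :
  alternating a -> alternating (fscale c a).
Proof. by move=> ha s x; rewrite /fscale ha mulrCA. Qed.

Lemma wedge_alternating p q (a : form K V p) (b : form K V q) :
  alternating (wedge a b).
Proof.
move=> t x; rewrite /wedge mulrCA; congr (_ * _).
rewrite big_distrr /= (reindex_inj (mulIg t^-1%g)) /=.
apply: eq_bigr => s _; rewrite odd_permM odd_permV signr_addb -mulrA mulrCA.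
by congr (_ * (_ * (a _ * b _))); apply/funext => i /=; rewrite permM permKV.
Qed.

End Alternating.

Section WedgeOneForm.
Variables (K : numFieldType) (V : Type).

(** The k! permutations with a given value at l contribute equally, because a alternates; this
    factor cancels the normalisation in [wedge]. *)
Lemma sum_perm_alternating k (l : 'I_k.+1) (t : V -> K) (a : form K V k)
    (x : 'I_k.+1 -> V) : alternating a ->
  \sum_(s : 'S_k.+1) (-1) ^+ s * (t (x (s l)) * a (fun j => x (s (lift l j)))) =
  k`!%:R * \sum_(i < k.+1) (-1) ^+ (l + i) * (t (x i) * a (fun j => x (lift i j))).
Proof.
move=> ha; pose G i (f : 'I_k -> 'I_k.+1) := t (x i) * a (fun j => x (f j)).
rewrite (sum_perm_lift l G) big_distrr /=; apply: eq_bigr => i _.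
rewrite mulrCA; congr (_ * _); rewrite /G.
rewrite (_ : k`!%:R * _ = \sum_(s : 'S_k) (t (x i) * a (fun j => x (lift i j)))).
  apply: eq_bigr => s _; rewrite (_ : (fun j => _) = (fun j => x (lift i j)) \o s) //.
  by rewrite ha mulrCA signrMK.
by rewrite sumr_const card_Sn mulr_natl.
Qed.

Lemma wedge_1l (t : V -> K) k (a : form K V k) x : alternating a ->
  wedge (one_form t) a x =
  \sum_(i < k.+1) (-1) ^+ i * (t (x i) * a (fun j => x (lift i j))).
Proof.
move=> ha; rewrite /wedge (_ : 1`! = 1%N) // mul1n.
rewrite -[RHS](mulKf (_ : k`!%:R != 0)) ?pnatr_eq0 -?lt0n ?fact_gt0 //.
rewrite -(sum_perm_alternating ord0 t x ha); congr (_ * _).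
apply: eq_bigr => s _; congr (_ * (t (x (s _)) * a _)); first exact: val_inj.
by apply/funext => j; congr (x (s _)); apply: val_inj.
Qed.

End WedgeOneForm.

(** * Forms evaluated at explicit lists of vectors *)

Section Arg.
Variable V : nmodType.

(** Lists make deletion and insertion of arguments computable. Positions beyond the end read as
    0. *)
Definition argv k (s : seq V) : 'I_k -> V := fun i => nth 0 s i.

Lemma fcons_argv k v s : fcons v (argv s : 'I_k -> V) = argv (v :: s).
Proof.
apply/funext => l; rewrite /fcons /argv; case: (unliftP ord0 l) => [j|] -> //=.
Qed.

Definition del i (s : seq V) := take i s ++ drop i.+1 s.

Lemma argv_lift k s (i : 'I_k.+1) :
  (fun l => argv s (lift i l)) = argv (del i s).
Proof.
apply/funext => l; rewrite /argv /del /= /bump.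
have [his|his] := ltnP i (size s); last first.
  rewrite take_oversize // drop_oversize ?leqW // cats0.
  case: (leqP i l) => // hil; rewrite add1n !nth_default ?leqW //.
    exact: leq_trans his hil.
  exact: leq_trans his hil.
rewrite nth_cat size_take his.
case: (leqP i l) => hil; rewrite ?add1n ?add0n ?nth_take //.
by rewrite nth_drop addSn subnKC.
Qed.

Lemma argvE k (x : 'I_k -> V) : x = argv [seq x i | i <- enum 'I_k].
Proof.
by apply/funext => i; rewrite /argv (nth_map i) ?size_enum_ord // nth_ord_enum.
Qed.

End Arg.

Section Curried.
Variables (K : numFieldType) (V : zmodType).
Implicit Types t : V -> K.

Lemma alternating2 (a : form K V 2) u v :
  alternating a -> a (argv [:: v; u]) = - a (argv [:: u; v]).
Proof.
move=> ha; have := ha (tperm ord0 ord_max) (argv [:: u; v]).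
rewrite odd_tperm mulN1r => <-; congr a; apply/funext => i.
rewrite /argv /=; case: tpermP => [->|->|] //=.
by case: i => [[|[|?]] ?] /eqP + /eqP.
Qed.

Lemma wedge11E a b (u v : V) :
  wedge (one_form a) (one_form b) (argv [:: u; v]) =
  a u * b v - a v * b u :> K.
Proof.
rewrite wedge_1l; last exact: alternating1.
rewrite !big_ord_recl big_ord0 /one_form /argv /=; ring.
Qed.

Lemma wedge21E (a : form K V 2) t (u v w : V) : alternating a ->
  wedge a (one_form t) (argv [:: u; v; w]) =
  a (argv [:: u; v]) * t w - a (argv [:: u; w]) * t v + a (argv [:: v; w]) * t u.
Proof.
move=> ha; rewrite /wedge.
rewrite (_ : \sum_s _ = \sum_(s : 'S_3) (-1) ^+ s *
  (t (argv [:: u; v; w] (s ord_max)) *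
   a (fun j => argv [:: u; v; w] (s (lift ord_max j))))).
  rewrite sum_perm_alternating // !big_ord_recl big_ord0 !argv_lift /del /argv /=.
  by rewrite /bump /= muln1 mulKf ?pnatr_eq0 //; ring.
apply: eq_bigr => s _; rewrite [a _ * _]mulrC.
congr (_ * (t (argv _ (s _)) * a _)); first exact: val_inj.
by apply/funext => -[[|[|?]] ?] //=; congr (argv _ (s _)); apply: val_inj.
Qed.

Lemma wedge31E (a : form K V 3) t (u v w z : V) : alternating a ->
  wedge a (one_form t) (argv [:: u; v; w; z]) =
  a (argv [:: u; v; w]) * t z - a (argv [:: u; v; z]) * t w
  + a (argv [:: u; w; z]) * t v - a (argv [:: v; w; z]) * t u.
Proof.
move=> ha; rewrite /wedge.
rewrite (_ : \sum_s _ = \sum_(s : 'S_4) (-1) ^+ s *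
  (t (argv [:: u; v; w; z] (s ord_max)) *
   a (fun j => argv [:: u; v; w; z] (s (lift ord_max j))))).
  rewrite sum_perm_alternating // !big_ord_recl big_ord0 !argv_lift /del /argv /=.
  by rewrite /bump /= muln1 mulKf ?pnatr_eq0 //; ring.
apply: eq_bigr => s _; rewrite [a _ * _]mulrC.
congr (_ * (t (argv _ (s _)) * a _)); first exact: val_inj.
by apply/funext => -[[|[|[|?]]] ?] //=; congr (argv _ (s _)); apply: val_inj.
Qed.

Lemma wedge13E (a : form K V 3) t (u v w z : V) : alternating a ->
  wedge (one_form t) a (argv [:: u; v; w; z]) =
  t u * a (argv [:: v; w; z]) - t v * a (argv [:: u; w; z])
  + t w * a (argv [:: u; v; z]) - t z * a (argv [:: u; v; w]).
Proof.
move=> ha; rewrite wedge_1l // !big_ord_recl big_ord0 !argv_lift /del /argv /=.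
by rewrite /bump /=; ring.
Qed.

Lemma wedge14E (a : form K V 4) t (u v w z y : V) : alternating a ->
  wedge (one_form t) a (argv [:: u; v; w; z; y]) =
  t u * a (argv [:: v; w; z; y]) - t v * a (argv [:: u; w; z; y])
  + t w * a (argv [:: u; v; z; y]) - t z * a (argv [:: u; v; w; y])
  + t y * a (argv [:: u; v; w; z]).
Proof.
move=> ha; rewrite wedge_1l // !big_ord_recl big_ord0 !argv_lift /del /argv /=.
by rewrite /bump /=; ring.
Qed.

(** Neither factor is a 1-form, so the Laplace expansion is applied twice, choosing the two
    arguments of a. The two permutations left for b agree by alternation, whence the factor 2;
    alternation of a then merges the 12 ordered pairs into 6. *)
Lemma wedge22E (a b : form K V 2) (u v w z : V) : alternating a -> alternating b ->
  wedge a b (argv [:: u; v; w; z]) =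
  a (argv [:: u; v]) * b (argv [:: w; z]) - a (argv [:: u; w]) * b (argv [:: v; z])
  + a (argv [:: u; z]) * b (argv [:: v; w]) + a (argv [:: v; w]) * b (argv [:: u; z])
  - a (argv [:: v; z]) * b (argv [:: u; w]) + a (argv [:: w; z]) * b (argv [:: u; v]).
Proof.
move=> ha hb; rewrite /wedge.
pose x := argv [:: u; v; w; z] : 'I_4 -> V.
pose G i (f : 'I_3 -> 'I_4) :=
  a (argv [:: x i; x (f ord0)]) * b (fun j => x (f (lift ord0 j))).
rewrite (_ : \sum_s _ = \sum_(s : 'S_4) (-1) ^+ s *
    G (s ord0) (fun j => s (lift ord0 j))); last first.
  apply: eq_bigr => s _; congr (_ * (a _ * b _)); apply/funext => -[[|[|?]] ?] //=;
    rewrite /argv /=; congr (nth _ _ (s _)); exact: val_inj.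
rewrite sum_perm_lift.
pose H i j (f : 'I_2 -> 'I_3) := a (argv [:: x i; x (lift i j)]) *
  b (fun l => x (lift i (f l))).
rewrite (_ : \sum_i _ = \sum_(i < 4) (-1) ^+ i * \sum_(s : 'S_3) (-1) ^+ s *
    H i (s ord0) (fun j => s (lift ord0 j))); last first.
  by apply: eq_bigr.
under eq_bigr do rewrite sum_perm_lift.
rewrite (_ : \sum_i _ = \sum_(i < 4) (-1) ^+ i * \sum_(j < 3) (-1) ^+ j *
    (2 * (a (argv [:: x i; x (lift i j)]) * b (argv (del j (del i [:: u; v; w; z])))))); last first.
  apply: eq_bigr => i _; congr (_ * _); apply: eq_bigr => j _; congr (_ * _).
  rewrite /H.
  rewrite (_ : 2 * _ = \sum_(s : 'S_2) (a (argv [:: x i; x (lift i j)]) *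
     b (argv (del j (del i [:: u; v; w; z]))))); last first.
    by rewrite sumr_const card_Sn mulr_natl.
  apply: eq_bigr => s _; rewrite mulrCA; congr (_ * _).
  rewrite -(signrMK s (b (argv _))); congr (_ * _); rewrite -hb; congr (b _).
  apply/funext => l /=; rewrite -(argv_lift (del i _) j).
  by rewrite -(argv_lift [:: u; v; w; z] i).
have xE i : x i = [:: u; v; w; z]`_i by [].
rewrite !big_ord_recl !big_ord0 !xE /del /= /bump /=.
rewrite ![a (argv [:: z; _])](alternating2 _ _ ha).
rewrite ![a (argv [:: _; u])](alternating2 _ _ ha).
by rewrite [a (argv [:: w; v])](alternating2 _ _ ha) !factE /=; field.
Qed.

Lemma ce_diffE br k (a : form K V k.+1) (s : seq V) :
  ce_diff br a (argv s) = \sum_(i < k.+2) \sum_(j < k.+1)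
    if (i <= j)%N then (-1) ^+ (i + j.+1) *
      a (argv (br s`_i s`_(lift i j) :: del j (del i s))) else 0.
Proof.
rewrite /ce_diff; apply: eq_bigr => i _; rewrite big_mkcond /=.
apply: eq_bigr => j _; case: ifP => // _; rewrite -fcons_argv.
congr (_ * a (fcons _ _)); apply/funext => l.
by rewrite -(argv_lift (del i s) j) -(argv_lift s i).
Qed.

Lemma ce_diff3E br (a : form K V 3) (u v w z : V) :
  ce_diff br a (argv [:: u; v; w; z]) =
  - a (argv [:: br u v; w; z]) + a (argv [:: br u w; v; z])
  - a (argv [:: br u z; v; w]) - a (argv [:: br v w; u; z])
  + a (argv [:: br v z; u; w]) - a (argv [:: br w z; u; v]).
Proof.
by rewrite ce_diffE !big_ord_recl !big_ord0 /del /= /bump /=; ring.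
Qed.

Lemma ce_diff4E br (a : form K V 4) (u v w z y : V) :
  ce_diff br a (argv [:: u; v; w; z; y]) =
  - a (argv [:: br u v; w; z; y]) + a (argv [:: br u w; v; z; y])
  - a (argv [:: br u z; v; w; y]) + a (argv [:: br u y; v; w; z])
  - a (argv [:: br v w; u; z; y]) + a (argv [:: br v z; u; w; y])
  - a (argv [:: br v y; u; w; z]) - a (argv [:: br w z; u; v; y])
  + a (argv [:: br w y; u; v; z]) - a (argv [:: br z y; u; v; w]).
Proof.
by rewrite ce_diffE !big_ord_recl !big_ord0 /del /= /bump /=; ring.
Qed.

End Curried.

(** * Algebra of the structure coefficients *)

Section System.
Variable R : realFieldType.
Implicit Types (g : bool -> bool -> bool -> R) (l : bool -> R) (C S : R).

(* In each plane [false] stands for x_k and [true] for y_k; the value is the real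
   part of (C + i S) i^(b1 + b2 + b3). *)
Definition phase_re C S (b1 b2 b3 : bool) : R :=
  match b1, b2, b3 with
  | false, false, false => C
  | true, false, false | false, true, false | false, false, true => - S
  | true, true, false | true, false, true | false, true, true => - C
  | true, true, true => S
  end.

(** Im z = Re (- i z), and - i (C + i S) = S - i C. *)
Definition phase_im C S := phase_re S (- C).

Definition sumb (F : bool -> R) : R := F false + F true.

Definition sumb3 (F : bool -> bool -> bool -> R) : R :=
  sumb (fun b1 => sumb (fun b2 => sumb (F b1 b2))).

Definition bsign (b : bool) : R := if b then 1 else - 1.

(** The Jacobi identity on x_1, y_1 and a vector of P_2 (first half) or P_3 (second half). Since
    [x_1, y_1] = 0, it says that the two iterated brackets, which pass from P_2 to P_3 and back or
    conversely, agree; the signs and negations antisymmetrise over P_1. *)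
Definition jacobi_pair g2 g3 : Prop :=
  (forall b2, sumb (fun b1 => sumb (fun b3 =>
     bsign b1 * bsign b3 * (g2 b2 b3 b1 * g3 (~~ b3) (~~ b1) b2))) = 0) /\
  (forall b3, sumb (fun b1 => sumb (fun b2 =>
     bsign b1 * bsign b2 * (g2 b2 b3 b1 * g3 b3 (~~ b1) (~~ b2)))) = 0).

(** [sumb l1 - l1 b1] is the eigenvalue on the other vector of P_1, so this is additivity of
    eigenvalues under the bracket of P_2 and P_3 into P_1, written so that the same w_M occurs for
    all three g_k. *)
Definition weighted l1 l2 l3 g1 : Prop := forall b1 b2 b3,
  g1 b1 b2 b3 * (l1 b1 + l2 b2 + l3 b3 - sumb l1) = 0.

(* The arguments of g_k start with the sign in the k-th plane and then run
   through the planes cyclically, which makes the system invariant under cyclic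
   permutations. *)
Record torsion_system C S l1 l2 l3 g1 g2 g3 : Prop := TorsionSystem {
  ts_phase : C ^+ 2 + S ^+ 2 = 1;
  ts_lam : forall b, [/\ l1 b != 0, l2 b != 0 & l3 b != 0];
  ts_omega : forall b1 b2 b3,
    g1 b1 b2 b3 + g2 b2 b3 b1 + g3 b3 b1 b2 =
    - phase_re C S b1 b2 b3 * (l1 b1 + l2 b2 + l3 b3 - 3);
  ts_psip : [/\ sumb3 (fun b1 b2 b3 => phase_im C S b1 b2 b3 * g1 b1 b2 b3) = 0,
                sumb3 (fun b1 b2 b3 => phase_im C S b1 b2 b3 * g2 b1 b2 b3) = 0
              & sumb3 (fun b1 b2 b3 => phase_im C S b1 b2 b3 * g3 b1 b2 b3) = 0];
  ts_psim : [/\ sumb3 (fun b1 b2 b3 => phase_re C S b1 b2 b3 * g1 b1 b2 b3) =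
                  4 - (sumb l2 + sumb l3),
                sumb3 (fun b1 b2 b3 => phase_re C S b1 b2 b3 * g2 b1 b2 b3) =
                  4 - (sumb l3 + sumb l1)
              & sumb3 (fun b1 b2 b3 => phase_re C S b1 b2 b3 * g3 b1 b2 b3) =
                  4 - (sumb l1 + sumb l2)];
  ts_weight : [/\ weighted l1 l2 l3 g1, weighted l2 l3 l1 g2
                & weighted l3 l1 l2 g3];
  ts_jacobi : [/\ jacobi_pair g1 g2, jacobi_pair g2 g3 & jacobi_pair g3 g1] }.

Lemma torsion_system_rot C S l1 l2 l3 g1 g2 g3 :
  torsion_system C S l1 l2 l3 g1 g2 g3 -> torsion_system C S l2 l3 l1 g2 g3 g1.
Proof.
case=> hC hl ho [p1 p2 p3] [m1 m2 m3] [w1 w2 w3] [j1 j2 j3]; split=> //.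
- by move=> b; case: (hl b).
- by move=> b1 b2 b3; have := ho b3 b1 b2; case: b1; case: b2; case: b3 => /=; lra.
Qed.

(** Together the two index triples use both vectors of P_2 and both of P_3, so adding their weight
    conditions leaves 2 * l1 b1 = 0. *)
Lemma weighted_prod0 l1 l2 l3 g2 g3 :
  (forall b, l1 b != 0) -> weighted l2 l3 l1 g2 -> weighted l3 l1 l2 g3 ->
  forall b1 b2 b3, g2 b2 b3 b1 * g3 (~~ b3) b1 (~~ b2) = 0.
Proof.
move=> l0 w2 w3 b1 b2 b3; have := w2 b2 b3 b1; have := w3 (~~ b3) b1 (~~ b2).
move=> /eqP; rewrite mulf_eq0 => /orP[/eqP->|/eqP h3]; first by rewrite mulr0.
move=> /eqP; rewrite mulf_eq0 => /orP[/eqP->|/eqP h2]; first by rewrite mul0r.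
case/eqP: (l0 b1); move: h2 h3; rewrite /sumb.
by case: (b2); case: (b3) => /=; lra.
Qed.

(* Re (zeta i^p * conj (zeta i^q)) is +-|zeta|^2 or 0 according to p - q mod 4,
   so only index triples differing in an even number of places contribute. *)
Lemma phase_prod C S g2 g3 :
  sumb3 (fun b1 b2 b3 => phase_re C S b1 b2 b3 * g2 b1 b2 b3) *
  sumb3 (fun b1 b2 b3 => phase_re C S b1 b2 b3 * g3 b1 b2 b3) +
  sumb3 (fun b1 b2 b3 => phase_im C S b1 b2 b3 * g2 b1 b2 b3) *
  sumb3 (fun b1 b2 b3 => phase_im C S b1 b2 b3 * g3 b1 b2 b3) =
  (C ^+ 2 + S ^+ 2) *
  (sumb3 (fun b1 b2 b3 => g2 b2 b3 b1 * g3 b3 b1 b2)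
   - sumb (fun b2 => sumb (fun b1 => sumb (fun b3 =>
       bsign b1 * bsign b3 * (g2 b2 b3 b1 * g3 (~~ b3) (~~ b1) b2))))
   - sumb (fun b3 => sumb (fun b1 => sumb (fun b2 =>
       bsign b1 * bsign b2 * (g2 b2 b3 b1 * g3 b3 (~~ b1) (~~ b2)))))
   - sumb3 (fun b1 b2 b3 =>
       bsign b2 * bsign b3 * (g2 b2 b3 b1 * g3 (~~ b3) b1 (~~ b2)))).
Proof. by rewrite /sumb3 /sumb /phase_im /phase_re /bsign /=; ring. Qed.

(** In [phase_prod] the imaginary sums vanish by [ts_psip]. Of the off-diagonal sums, the two that
    flip a sign in P_1 vanish by Jacobi, and the one that flips P_2 and P_3 by weights. *)
Lemma torsion_prod C S l1 l2 l3 g1 g2 g3 :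
  torsion_system C S l1 l2 l3 g1 g2 g3 ->
  sumb3 (fun b1 b2 b3 => g2 b2 b3 b1 * g3 b3 b1 b2) =
  (4 - (sumb l3 + sumb l1)) * (4 - (sumb l1 + sumb l2)).
Proof.
case=> hC hl ho [_ p2 p3] [_ m2 m3] [_ w2 w3] [_ [j1 j2] _].
have k := weighted_prod0 (fun b => let: And3 h _ _ := hl b in h) w2 w3.
have := phase_prod C S g2 g3; rewrite m2 m3 p2 p3 hC mulr0 addr0 mul1r => ->.
rewrite [X in _ = _ - X - _ - _](_ : _ = 0); last first.
  by rewrite /sumb; move: (j1 false) (j1 true); rewrite /sumb => -> ->; rewrite addr0.
rewrite [X in _ = _ - X - _](_ : _ = 0); last first.
  by rewrite /sumb; move: (j2 false) (j2 true); rewrite /sumb => -> ->; rewrite addr0.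
rewrite [X in _ = _ - X](_ : _ = 0) ?subr0 //.
by rewrite /sumb3 /sumb !k !mulr0 !addr0.
Qed.

(** Multiply [ts_omega] by g1; the weight condition replaces w_M by sigma_1. Summing over M gives
    N_1 + A_1 A_2 + A_1 A_3 = (3 - sigma_1) A_1, where N_1 is the sum of squares, A_1 is written as
    [4 - (sumb l2 + sumb l3)], and A_2 + A_3 = sigma_2 + sigma_3 + 8 - 2 T. *)
Lemma torsion_norm C S l1 l2 l3 g1 g2 g3 :
  torsion_system C S l1 l2 l3 g1 g2 g3 ->
  sumb3 (fun b1 b2 b3 => g1 b1 b2 b3 ^+ 2) =
  (sumb l1 + sumb l2 + sumb l3 - 5) * (4 - (sumb l2 + sumb l3)).
Proof.
move=> h; have h' := torsion_system_rot h; have h'' := torsion_system_rot h'.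
have := torsion_prod h'; have := torsion_prod h''.
case: h => hC hl ho _ [m1 _ _] [w1 _ _] _.
have e b1 b2 b3 :
    g1 b1 b2 b3 * (g1 b1 b2 b3 + g2 b2 b3 b1 + g3 b3 b1 b2) =
    (3 - sumb l1) * (phase_re C S b1 b2 b3 * g1 b1 b2 b3).
  apply/eqP; rewrite ho -subr_eq0 -(mulr0 (- phase_re C S b1 b2 b3)).
  by rewrite -(w1 b1 b2 b3); apply/eqP; ring.
have : sumb3 (fun b1 b2 b3 =>
    g1 b1 b2 b3 * (g1 b1 b2 b3 + g2 b2 b3 b1 + g3 b3 b1 b2)) =
    (3 - sumb l1) * (4 - (sumb l2 + sumb l3)).
  by rewrite -m1 /sumb3 /sumb !e /sumb; ring.
by rewrite /sumb3 /sumb; lra.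
Qed.

Lemma sumb3_sqr_ge0 g : 0 <= sumb3 (fun b1 b2 b3 => g b1 b2 b3 ^+ 2).
Proof. by rewrite /sumb3 /sumb !addr_ge0 ?sqr_ge0. Qed.

Lemma sumb3_sqr_eq0 g : sumb3 (fun b1 b2 b3 => g b1 b2 b3 ^+ 2) = 0 ->
  forall b1 b2 b3, g b1 b2 b3 = 0.
Proof.
move=> /eqP; rewrite /sumb3 /sumb.
rewrite !paddr_eq0 ?addr_ge0 ?sqr_ge0 // !sqrf_eq0.
move=> /andP[/andP[/andP[h0 h1] /andP[h2 h3]]].
by move=> /andP[/andP[h4 h5] /andP[h6 h7]] [] [] []; exact/eqP.
Qed.

(** The A_k add up to 12 - 2 T, and (T - 5) A_k is a sum of squares. If T < 5, all A_k <= 0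
    contradicts their positive sum; if T = 5, all coefficients vanish, hence by [ts_psim] all A_k,
    although they add up to 2; if T > 5, all A_k >= 0 and therefore T <= 6. *)
Lemma torsion_trace C S l1 l2 l3 g1 g2 g3 :
  torsion_system C S l1 l2 l3 g1 g2 g3 ->
  let T := sumb l1 + sumb l2 + sumb l3 in
  [/\ 5 < T, T <= 6, 0 <= sumb l1 + 4 - T, 0 <= sumb l2 + 4 - T
    & 0 <= sumb l3 + 4 - T].
Proof.
move=> h1; have h2 := torsion_system_rot h1; have h3 := torsion_system_rot h2.
have N1 := torsion_norm h1; have N2 := torsion_norm h2.
have N3 := torsion_norm h3; have Z1 := sumb3_sqr_eq0 (g := g1).
have Z2 := sumb3_sqr_eq0 (g := g2); have Z3 := sumb3_sqr_eq0 (g := g3).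
have := sumb3_sqr_ge0 g1; have := sumb3_sqr_ge0 g2; have := sumb3_sqr_ge0 g3.
move: N1 N2 N3 Z1 Z2 Z3.
set s1 := sumb l1; set s2 := sumb l2; set s3 := sumb l3.
move=> -> -> -> Z1 Z2 Z3 n3 n2 n1 T.
have [T5|T5|T5] := ltgtP T 5.
- move: T5 n1 n2 n3; rewrite /T => T5 n1 n2 n3.
  have : (4 - (s2 + s3)) <= 0.
    rewrite -(nmulr_rge0 _ (x := s1 + s2 + s3 - 5)) //; lra.
  have : (4 - (s3 + s1)) <= 0.
    by rewrite -(nmulr_rge0 _ (x := s2 + s3 + s1 - 5)) //; lra.
  have : (4 - (s1 + s2)) <= 0.
    by rewrite -(nmulr_rge0 _ (x := s3 + s1 + s2 - 5)) //; lra.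
  by lra.
- have : 0 <= (4 - (s2 + s3)).
    by rewrite -(pmulr_rge0 _ (x := s1 + s2 + s3 - 5)) //; rewrite /T in T5; lra.
  have : 0 <= (4 - (s3 + s1)).
    by rewrite -(pmulr_rge0 _ (x := s2 + s3 + s1 - 5)) //; rewrite /T in T5; lra.
  have : 0 <= (4 - (s1 + s2)).
    by rewrite -(pmulr_rge0 _ (x := s3 + s1 + s2 - 5)) //; rewrite /T in T5; lra.
  by move: T5; rewrite /T => *; split; lra.
- have z1 : s1 + s2 + s3 - 5 = 0 by rewrite /T in T5; lra.
  case: h1 => _ _ _ _ [m1 m2 m3] _ _.
  have z2 : s2 + s3 + s1 - 5 = 0 by move: z1; lra.
  have z3 : s3 + s1 + s2 - 5 = 0 by move: z1; lra.
  rewrite z1 mul0r in Z1; rewrite z2 mul0r in Z2; rewrite z3 mul0r in Z3.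
  exfalso; move: m1 m2 m3 z1; rewrite /T /s1 /s2 /s3 /sumb3 /sumb.
  by rewrite !(Z1 (erefl _)) !(Z2 (erefl _)) !(Z3 (erefl _)); lra.
Qed.

(** The product A_2 A_3 > 0 is a sum of products g2 g3, so both are non-zero at some M, and then w_M
    equals sigma_2 and sigma_3. *)
Lemma torsion_sum_eq C S l1 l2 l3 g1 g2 g3 :
  torsion_system C S l1 l2 l3 g1 g2 g3 ->
  let T := sumb l1 + sumb l2 + sumb l3 in
  0 < sumb l2 + 4 - T -> 0 < sumb l3 + 4 - T -> sumb l2 = sumb l3.
Proof.
move=> h T p2 p3; have := torsion_prod h.
case: h => _ _ _ _ _ [_ w2 w3] _ eP; apply/eqP; apply: contraT => ne.
have k b1 b2 b3 : g2 b2 b3 b1 * g3 b3 b1 b2 = 0.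
  have := w2 b2 b3 b1; have := w3 b3 b1 b2.
  move=> /eqP; rewrite mulf_eq0 => /orP[/eqP->|/eqP h3]; first by rewrite mulr0.
  move=> /eqP; rewrite mulf_eq0 => /orP[/eqP->|/eqP h2]; first by rewrite mul0r.
  by case/eqP: ne; move: h2 h3; lra.
have := mulr_gt0 p2 p3; move: eP; rewrite /T /sumb3 /sumb !k; lra.
Qed.

Lemma torsion_coef_gt0 C S l1 l2 l3 g1 g2 g3 b1 b2 b3 :
  torsion_system C S l1 l2 l3 g1 g2 g3 -> g1 b1 b2 b3 != 0 ->
  0 < sumb l1 + 4 - (sumb l1 + sumb l2 + sumb l3).
Proof.
move=> h; apply: contraNT; rewrite -leNgt => le0.
have [_ _ ge0 _ _] := torsion_trace h; apply/eqP/sumb3_sqr_eq0.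
rewrite (torsion_norm h) (_ : 4 - _ = 0) ?mulr0 //; lra.
Qed.

(** If some g_k(M) is non-zero then w_M = sigma_k and A_k > 0, hence sigma_k = sigma_1 by
    [torsion_sum_eq]. If all three vanish, [ts_omega] forces w_M = 3. *)
Lemma torsion_weights C S l1 l2 l3 g1 g2 g3 b1 b2 b3 :
  torsion_system C S l1 l2 l3 g1 g2 g3 -> phase_re C S b1 b2 b3 != 0 ->
  0 < sumb l1 + 4 - (sumb l1 + sumb l2 + sumb l3) ->
  l1 b1 + l2 b2 + l3 b3 = 3 \/ l1 b1 + l2 b2 + l3 b3 = sumb l1.
Proof.
move=> h1 ph0 A1; have h2 := torsion_system_rot h1.
have h3 := torsion_system_rot h2.
have := ts_omega h1 b1 b2 b3; have [w1 w2 w3] := ts_weight h1.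
have [z1|nz1] := eqVneq (g1 b1 b2 b3) 0; last first.
  by move=> _; right; have := w1 b1 b2 b3 => /eqP;
    rewrite mulf_eq0 (negbTE nz1) subr_eq0 => /eqP.
have [z2|nz2] := eqVneq (g2 b2 b3 b1) 0; last first.
  move=> _; right; have := w2 b2 b3 b1 => /eqP.
  rewrite mulf_eq0 (negbTE nz2) /= subr_eq0 => /eqP e.
  have A2 := torsion_coef_gt0 h2 nz2.
  by have := torsion_sum_eq h3; move: e A1 A2 => /=; lra.
have [z3|nz3] := eqVneq (g3 b3 b1 b2) 0; last first.
  move=> _; right; have := w3 b3 b1 b2 => /eqP.
  rewrite mulf_eq0 (negbTE nz3) /= subr_eq0 => /eqP e.
  have A3 := torsion_coef_gt0 h3 nz3.
  by have := torsion_sum_eq h2; move: e A1 A3 => /=; lra.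
rewrite z1 z2 z3 !addr0 => /esym/eqP.
by rewrite mulf_eq0 oppr_eq0 (negbTE ph0) subr_eq0 => /eqP ->; left.
Qed.

(** For C S != 0 no phase coefficient vanishes, so every w_M takes one of two values. With the third
    sign fixed, two distinct eigenvalues on P_1 and two on P_2 would produce at least three
    different sums. *)
Lemma torsion_phase_aux C S l1 l2 l3 g1 g2 g3 :
  torsion_system C S l1 l2 l3 g1 g2 g3 -> C * S != 0 ->
  0 < sumb l1 + 4 - (sumb l1 + sumb l2 + sumb l3) ->
  l1 false = l1 true \/ l2 false = l2 true.
Proof.
move=> h /[!mulf_eq0] /norP[C0 S0] A1.
have ph b1 b2 b3 : phase_re C S b1 b2 b3 != 0.
  by case: b1; case: b2; case: b3; rewrite /= ?oppr_eq0.
have w b1 b2 := torsion_weights h (ph b1 b2 false) A1.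
have := (w false false, w true false, w false true, w true true).
case=> [[[]]]; case: (eqVneq (l1 false) (l1 true)) => [->|/eqP n1]; first by left.
case: (eqVneq (l2 false) (l2 true)) => [->|/eqP n2]; first by right.
case=> e1; case=> e2; case=> e3; case=> e4; exfalso;
  first [by apply: n1; move: e1 e2 e3 e4; lra | by apply: n2; move: e1 e2 e3 e4; lra].
Qed.

(** For T < 6 the sum 12 - 2 T of the A_k is positive, so one of them is. *)
Lemma torsion_phase C S l1 l2 l3 g1 g2 g3 :
  torsion_system C S l1 l2 l3 g1 g2 g3 -> C * S != 0 ->
  sumb l1 + sumb l2 + sumb l3 < 6 ->
  [\/ l1 false = l1 true, l2 false = l2 true | l3 false = l3 true].
Proof.
move=> h1 CS lt6; have h2 := torsion_system_rot h1.
have h3 := torsion_system_rot h2.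
have [A1|A1] := ltrP 0 (sumb l1 + 4 - (sumb l1 + sumb l2 + sumb l3)).
  by case: (torsion_phase_aux h1 CS A1) => ->; [apply: Or31|apply: Or32].
have [A2|A2] := ltrP 0 (sumb l2 + 4 - (sumb l2 + sumb l3 + sumb l1)).
  by case: (torsion_phase_aux h2 CS A2) => ->; [apply: Or32|apply: Or33].
have [A3|A3] := ltrP 0 (sumb l3 + 4 - (sumb l3 + sumb l1 + sumb l2)).
  by case: (torsion_phase_aux h3 CS A3) => ->; [apply: Or33|apply: Or31].
by exfalso; move: A1 A2 A3 lt6; lra.
Qed.

(** At T = 6 the A_k are non-negative with sum zero, so the norms vanish for every phase. *)
Lemma torsion_trivial C S l1 l2 l3 g1 g2 g3 :
  torsion_system C S l1 l2 l3 g1 g2 g3 ->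
  ~~ (sumb l1 + sumb l2 + sumb l3 < 6) -> forall b1 b2 b3, g1 b1 b2 b3 = 0.
Proof.
move=> h; rewrite -leNgt => ge6; apply: sumb3_sqr_eq0; rewrite (torsion_norm h).
have [_ le6 A1 A2 A3] := torsion_trace h.
by rewrite (_ : 4 - _ = 0) ?mulr0 //; move: ge6 A1 A2 A3; lra.
Qed.

Lemma sumb3_sqr_ge2 g (M M' : bool * bool * bool) : M != M' ->
  g M.1.1 M.1.2 M.2 ^+ 2 + g M'.1.1 M'.1.2 M'.2 ^+ 2 <=
  sumb3 (fun b1 b2 b3 => g b1 b2 b3 ^+ 2).
Proof.
have p b1 b2 b3 := sqr_ge0 (g b1 b2 b3).
move: (p false false false) (p false false true) (p false true false)
  (p false true true) (p true false false) (p true false true)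
  (p true true false) (p true true true); rewrite /sumb3 /sumb.
by case: M => [[[] []] []]; case: M' => [[[] []] []] //=; lra.
Qed.

(** The sum of squares is k times the number of non-zero entries, and the bounds leave only the
    number 1. *)
Lemma single_support g (k : R) :
  (forall b1 b2 b3, g b1 b2 b3 = 0 \/ g b1 b2 b3 ^+ 2 = k) ->
  0 < sumb3 (fun b1 b2 b3 => g b1 b2 b3 ^+ 2) < 2 * k ->
  exists M : bool * bool * bool, sumb3 (fun b1 b2 b3 => g b1 b2 b3 ^+ 2) = k /\
    forall b1 b2 b3, (g b1 b2 b3 == 0) = (M != (b1, b2, b3)).
Proof.
move=> hg /andP[q0 qk].
have [M gM] : exists M : bool * bool * bool, g M.1.1 M.1.2 M.2 != 0.
  apply/existsP; apply: contraTT q0; rewrite negb_exists => /forallP z.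
  have {}z b1 b2 b3 : g b1 b2 b3 = 0.
    by have := z (b1, b2, b3); rewrite negbK => /eqP.
  by rewrite /sumb3 /sumb !z expr0n !addr0 ltxx.
have kM : g M.1.1 M.1.2 M.2 ^+ 2 = k by case: (hg M.1.1 M.1.2 M.2) gM => // ->; rewrite eqxx.
have z b1 b2 b3 : (g b1 b2 b3 == 0) = (M != (b1, b2, b3)).
  have [e|ne] := eqVneq M (b1, b2, b3); first by rewrite e in gM; apply: negbTE.
  case: (hg b1 b2 b3) => [->|e]; first by rewrite eqxx.
  by have /= := sumb3_sqr_ge2 g ne; rewrite kM e; lra.
exists M; split=> //.
have sq b1 b2 b3 : g b1 b2 b3 ^+ 2 = if M == (b1, b2, b3) then k else 0.
  have := z b1 b2 b3; case: (M =P _) => [e _|_ /eqP ->]; last by rewrite expr0n.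
  by rewrite -kM e.
by rewrite /sumb3 /sumb !sq; case: (M) => [[[] []] []] /=; rewrite ?addr0 ?add0r.
Qed.

Definition support_at (M : bool * bool * bool) (gamma : R) g : Prop :=
  forall b1 b2 b3, g b1 b2 b3 = if M == (b1, b2, b3) then gamma else 0.

Lemma support_scale M (c : R) g f :
  c != 0 -> (forall b1 b2 b3, f b1 b2 b3 = c * g b1 b2 b3) ->
  (forall b1 b2 b3, (f b1 b2 b3 == 0) = (M != (b1, b2, b3))) ->
  g M.1.1 M.1.2 M.2 != 0 /\ support_at M (g M.1.1 M.1.2 M.2) g.
Proof.
move=> c0 fg z; split=> [|b1 b2 b3].
  have := z M.1.1 M.1.2 M.2; rewrite fg mulf_eq0 (negbTE c0) /= => ->.
  by rewrite -!surjective_pairing eqxx.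
have := z b1 b2 b3; rewrite fg mulf_eq0 (negbTE c0) /=.
by case: (M =P (b1, b2, b3)) => [-> _|_ /eqP].
Qed.

End System.

(** * Solutions of the system for phase 1 *)

Section Classification.
Variable R : realFieldType.
Implicit Types (g : bool -> bool -> bool -> R) (l : bool -> R) (C S : R).

(** The function f = g1 + g2 + g3 has entries 0 or +-(3 - sigma), while its sum of squares follows
    from the norms and products and stays below twice (3 - sigma)^2. So f lives on a single M.
    Equating the two values of the sum fixes the traces so that the distances between the non-zero
    g_k vanish. *)
Lemma torsion_classify_many l1 l2 l3 g1 g2 g3 :
  torsion_system 1 0 l1 l2 l3 g1 g2 g3 ->
  let T := sumb l1 + sumb l2 + sumb l3 in
  T < 6 -> 0 < sumb l1 + 4 - T -> 0 < sumb l2 + 4 - T ->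
  exists (b1 b2 b3 : bool) (c1 c2 c3 : R),
   [/\ c1 != 0, c2 != 0 & [/\ support_at (b1, b2, b3) c1 g1,
       support_at (b2, b3, b1) c2 g2 & support_at (b3, b1, b2) c3 g3]].
Proof.
move=> h1 T lt6 A1 A2; have h2 := torsion_system_rot h1.
have n0 k : k.+1%:R != 0 :> R by rewrite pnatr_eq0.
have h3 := torsion_system_rot h2.
have [T5 _ _ _ A3] := torsion_trace h1.
have s12 : sumb l1 = sumb l2.
  by apply: (torsion_sum_eq h3 _ _); move: A1 A2; rewrite /T; lra.
have f0 b1 b2 b3 : let f := g1 b1 b2 b3 + g2 b2 b3 b1 + g3 b3 b1 b2 in
    f = 0 \/ f ^+ 2 = (3 - sumb l2) ^+ 2.
  rewrite /= (ts_omega h1).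
  have [->|nz] := eqVneq (phase_re (1 : R) 0 b1 b2 b3) 0; first by left; rewrite oppr0 mul0r.
  have := torsion_weights h1 nz A1 => -[->|->]; first by left; rewrite subrr mulr0.
  right; rewrite s12 exprMn [(- _) ^+ 2](_ : _ = 1) ?mul1r; last first.
    by move: nz; case: b1; case: b2; case: b3; rewrite /= ?oppr0 ?eqxx // => _; ring.
  by ring.
pose f b1 b2 b3 := g1 b1 b2 b3 + g2 b2 b3 b1 + g3 b3 b1 b2.
have n1 := torsion_norm h1; have n2 := torsion_norm h2; have n3 := torsion_norm h3.
have p23 := torsion_prod h1; have p31 := torsion_prod h2; have p12 := torsion_prod h3.
have ef : sumb3 (fun b1 b2 b3 => f b1 b2 b3 ^+ 2) =
   sumb3 (fun b1 b2 b3 => g1 b1 b2 b3 ^+ 2) +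
   sumb3 (fun b1 b2 b3 => g2 b1 b2 b3 ^+ 2) +
   sumb3 (fun b1 b2 b3 => g3 b1 b2 b3 ^+ 2) +
   2 * (sumb3 (fun b1 b2 b3 => g1 b2 b3 b1 * g2 b3 b1 b2) +
        sumb3 (fun b1 b2 b3 => g2 b2 b3 b1 * g3 b3 b1 b2) +
        sumb3 (fun b1 b2 b3 => g3 b2 b3 b1 * g1 b3 b1 b2)).
  by rewrite /f /sumb3 /sumb; ring.
have e12 : sumb3 (fun b1 b2 b3 => (g1 b1 b2 b3 - g2 b2 b3 b1) ^+ 2) =
   sumb3 (fun b1 b2 b3 => g1 b1 b2 b3 ^+ 2) +
   sumb3 (fun b1 b2 b3 => g2 b1 b2 b3 ^+ 2) -
   2 * sumb3 (fun b1 b2 b3 => g1 b2 b3 b1 * g2 b3 b1 b2).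
  by rewrite /sumb3 /sumb; ring.
have e13 : sumb3 (fun b1 b2 b3 => (g1 b1 b2 b3 - g3 b3 b1 b2) ^+ 2) =
   sumb3 (fun b1 b2 b3 => g1 b1 b2 b3 ^+ 2) +
   sumb3 (fun b1 b2 b3 => g3 b1 b2 b3 ^+ 2) -
   2 * sumb3 (fun b1 b2 b3 => g3 b2 b3 b1 * g1 b3 b1 b2).
  by rewrite /sumb3 /sumb; ring.
rewrite n1 n2 n3 p12 p23 p31 s12 in ef; rewrite n1 n2 p12 s12 in e12.
rewrite n1 n3 p31 s12 in e13.
have := sumb3_sqr_ge0 (fun b1 b2 b3 => g1 b1 b2 b3 - g2 b2 b3 b1).
rewrite e12; move: A1 A2 A3 lt6 T5; rewrite /T s12.
have [A3|A3] := leP (sumb l3 + 4 - (sumb l2 + sumb l2 + sumb l3)) 0.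
  move=> A1 _ A3' lt6 T5 d0.
  (* A_3 = 0 reads 4 - 2 sigma_2 = 0. With A = A_1 = A_2 the sum of f^2 is 2 A, where 0 < A < 1, so
     it must be 1; then the squared distance 2 A (1 - 2 A) of g1 and g2 is zero. *)
  have s2 : sumb l2 = 2 by lra.
  rewrite s2 in f0 ef e12 e13 d0.
  have [M [kM zM]] : exists M : bool * bool * bool,
      sumb3 (fun b1 b2 b3 => f b1 b2 b3 ^+ 2) = 1 /\
      forall b1 b2 b3, (f b1 b2 b3 == 0) = (M != (b1, b2, b3)).
    apply: single_support; last by rewrite ef; nra.
    by move=> b1 b2 b3; case: (f0 b1 b2 b3) => e; [left|right] => //; rewrite /f e; ring.
  have g30 b1 b2 b3 : g3 b1 b2 b3 = 0.
    apply: sumb3_sqr_eq0; rewrite n3 s12 s2.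
    by rewrite (_ : 4 - _ = 0) ?mulr0 //; lra.
  have {}e12 b1 b2 b3 : g1 b1 b2 b3 = g2 b2 b3 b1.
    apply/eqP; rewrite -subr_eq0; apply/eqP; move: b1 b2 b3.
    by apply: sumb3_sqr_eq0; rewrite e12; move: ef kM d0; nra.
  have f2 b1 b2 b3 : f b1 b2 b3 = 2 * g1 b1 b2 b3.
    by rewrite /f g30 addr0 -e12; ring.
  case: M zM kM => [[b1 b2] b3] zM _.
  have [g1M sg1] := support_scale (n0 1%N) f2 zM.
  exists b1, b2, b3, (g1 b1 b2 b3), (g1 b1 b2 b3), 0; split=> //; split=> //.
    by move=> c2 c3 c1; rewrite -e12 sg1 !xpair_eqE; case: eqP; case: eqP; case: eqP.
  by move=> *; rewrite g30 if_same.
move=> A1 _ A3' lt6 T5 d0.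
have s23 : sumb l2 = sumb l3.
  by apply: (torsion_sum_eq h1 _ _); rewrite s12; lra.
rewrite -s23 in ef e12 e13 d0 lt6.
have [M [kM zM]] : exists M : bool * bool * bool,
      sumb3 (fun b1 b2 b3 => f b1 b2 b3 ^+ 2) = (3 - sumb l2) ^+ 2 /\
      forall b1 b2 b3, (f b1 b2 b3 == 0) = (M != (b1, b2, b3)).
  by apply: single_support; [exact: f0|rewrite ef; nra].
(* Here A = 4 - 2 sigma and the sum of f^2 is 3 A (3 - sigma); equating it with (3 - sigma)^2 gives
   sigma = 9 / 5, the value at which the squared distances, multiples of A (5 sigma - 9), vanish. *)
have s95 : 5 * sumb l2 = 9 by move: kM; rewrite ef; nra.
have {}e12 b1 b2 b3 : g1 b1 b2 b3 = g2 b2 b3 b1.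
  apply/eqP; rewrite -subr_eq0; apply/eqP; move: b1 b2 b3.
  by apply: sumb3_sqr_eq0; rewrite e12; nra.
have {}e13 b1 b2 b3 : g1 b1 b2 b3 = g3 b3 b1 b2.
  apply/eqP; rewrite -subr_eq0; apply/eqP; move: b1 b2 b3.
  by apply: sumb3_sqr_eq0; rewrite e13; nra.
have f3 b1 b2 b3 : f b1 b2 b3 = 3 * g1 b1 b2 b3.
  by rewrite /f -e12 -e13; ring.
case: M zM kM => [[b1 b2] b3] zM _.
have [g1M sg1] := support_scale (n0 2%N) f3 zM.
exists b1, b2, b3, (g1 b1 b2 b3), (g1 b1 b2 b3), (g1 b1 b2 b3).
split=> //; split=> //.
  by move=> c2 c3 c1; rewrite -e12 sg1 !xpair_eqE; case: eqP; case: eqP; case: eqP.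
by move=> c3 c1 c2; rewrite -e13 sg1 !xpair_eqE; case: eqP; case: eqP; case: eqP.
Qed.

Lemma torsion_classify_one l1 l2 l3 g1 g2 g3 :
  torsion_system 1 0 l1 l2 l3 g1 g2 g3 ->
  let T := sumb l1 + sumb l2 + sumb l3 in
  T < 6 -> sumb l1 + 4 - T <= 0 -> sumb l2 + 4 - T <= 0 ->
  (forall b1 b2 b3, g1 b1 b2 b3 = 0 /\ g2 b1 b2 b3 = 0) /\
  exists2 k : R, k != 0 & forall b1 b2 b3,
    g3 b3 b1 b2 = 0 \/ g3 b3 b1 b2 = phase_re 1 0 b1 b2 b3 * k.
Proof.
move=> h1 T lt6 A1 A2; have [T5 _ A1' A2' A3] := torsion_trace h1.
have h2 := torsion_system_rot h1; have h3 := torsion_system_rot h2.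
move: A1 A2 A1' A2' A3 T5 lt6; rewrite /T => A1 A2 A1' A2' A3 T5 lt6.
have z1 : forall b1 b2 b3, g1 b1 b2 b3 = 0.
  apply: sumb3_sqr_eq0; rewrite (torsion_norm h1).
  by rewrite (_ : 4 - _ = 0) ?mulr0 //; lra.
have z2 : forall b1 b2 b3, g2 b1 b2 b3 = 0.
  apply: sumb3_sqr_eq0; rewrite (torsion_norm h2).
  by rewrite (_ : 4 - _ = 0) ?mulr0 //; lra.
(* A_1 = A_2 = 0 gives T = 8 - sigma_3, so T > 5 makes this constant positive. *)
split=> //; exists (3 - sumb l3); first by apply/eqP; lra.
move=> b1 b2 b3; have := ts_omega h1 b1 b2 b3; rewrite z1 z2 !add0r => e.
have [_ _ w3] := ts_weight h1; have /eqP := w3 b3 b1 b2.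
rewrite mulf_eq0 subr_eq0 => /orP[/eqP->|/eqP w]; first by left.
by right; rewrite e (_ : l1 b1 + _ + _ = sumb l3) ?opprB -?w; ring.
Qed.

End Classification.

(** * Eigenvectors of self-adjoint maps *)

Section SymmetricEigenvector.
Variables (R : rcfType) (n : nat) (A : 'M[R]_n.+1) (W : 'rV[R]_n.+1 -> Prop).
Hypothesis A_sym : A^T = A.
Hypothesis W_lin : forall a u v, W u -> W v -> W (a *: u + v).
Hypothesis W_stable : forall u, W u -> W (u *m A).

Let AC : 'M[R[i]]_n.+1 := map_mx (real_complex R) A.
Let re (w : 'rV[R[i]]_n.+1) : 'rV[R]_n.+1 := map_mx (@complex.Re R) w.
Let im (w : 'rV[R[i]]_n.+1) : 'rV[R]_n.+1 := map_mx (@complex.Im R) w.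
Let WC w := W (re w) /\ W (im w).

Let re_mul w : re (w *m AC) = re w *m A.
Proof.
apply/rowP => i; rewrite !mxE raddf_sum; apply: eq_bigr => j _; rewrite !mxE /=.
by case: (w 0 j) => a b /=; rewrite mulr0 subr0.
Qed.

Let im_mul w : im (w *m AC) = im w *m A.
Proof.
apply/rowP => i; rewrite !mxE raddf_sum; apply: eq_bigr => j _; rewrite !mxE /=.
by case: (w 0 j) => a b /=; rewrite mulr0 add0r.
Qed.

Let re_sub z w : re (w *m (AC - z%:M)) =
  re w *m A - (complex.Re z *: re w - complex.Im z *: im w).
Proof.
rewrite mulmxBr -re_mul mul_mx_scalar; apply/rowP => i; rewrite !mxE.
by case: (w 0 i) => a b; case: (z) => c d; rewrite raddfB.
Qed.

Let im_sub z w : im (w *m (AC - z%:M)) =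
  im w *m A - (complex.Re z *: im w + complex.Im z *: re w).
Proof.
rewrite mulmxBr -im_mul mul_mx_scalar; apply/rowP => i; rewrite !mxE.
by case: (w 0 i) => a b; case: (z) => c d; rewrite raddfB.
Qed.

Let WC_stable z w : WC w -> WC (w *m (AC - z%:M)).
Proof.
case=> wr wi; split; rewrite ?re_sub ?im_sub.
  rewrite (_ : _ - _ =
    - complex.Re z *: re w + (complex.Im z *: im w + re w *m A)).
    by do 2!apply: W_lin => //; apply: W_stable.
  by move: (_ *m A) => X; apply/rowP => i; rewrite !mxE; ring.
rewrite (_ : _ - _ =
    - complex.Re z *: im w + (- complex.Im z *: re w + im w *m A)).
  by do 2!apply: W_lin => //; apply: W_stable.
by move: (_ *m A) => X; apply/rowP => i; rewrite !mxE; ring.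
Qed.

(** The factors are applied one at a time; the last non-zero partial product is an eigenvector and
    has not left the complexification of W. *)
Let WC_eigen rs w : WC w -> w != 0 -> w *m \prod_(z <- rs) (AC - z%:M) = 0 ->
  exists z w', [/\ WC w', w' != 0 & w' *m (AC - z%:M) = 0].
Proof.
elim: rs w => [|z rs IH] w Ww w0; first by rewrite big_nil mulmx1 => /eqP; rewrite (negbTE w0).
rewrite big_cons mulmxA => e.
have [w1|w1] := eqVneq (w *m (AC - z%:M)) 0; first by exists z, w.
by apply: IH e => //; apply: WC_stable.
Qed.

(** Over R[i] the characteristic polynomial splits, and Cayley-Hamilton supplies a product of
    factors A - z that kills v. Symmetry makes the resulting eigenvalue real, so the real or the
    imaginary part of the eigenvector serves. As W is only a predicate, restriction to an invariant
    subspace needs no basis of it. *)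
Lemma symmetric_eigenvector v : W v -> v != 0 ->
  exists a w, [/\ W w, w != 0 & w *m A = a *: w].
Proof.
move=> Wv v0; have [rs chi] := closed_field_poly_normal (char_poly AC).
have W0 : W 0 by have := W_lin (-1) Wv Wv; rewrite scaleN1r addNr.
pose vC : 'rV[R[i]]_n.+1 := map_mx (real_complex R) v.
have rev : re vC = v by apply/rowP => i; rewrite !mxE.
have imv : im vC = 0 by apply/rowP => i; rewrite !mxE.
have vC0 : vC != 0 by apply: contraNneq v0 => e; rewrite -rev e; apply/eqP/rowP => i; rewrite !mxE.
have : vC *m \prod_(z <- rs) (AC - z%:M) = 0.
  rewrite (monicP (char_poly_monic _)) scale1r in chi.
  have := Cayley_Hamilton AC; rewrite chi rmorph_prod /=.
  under eq_bigr do rewrite rmorphB /= horner_mx_X horner_mx_C.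
  by move=> ->; rewrite mulmx0.
case/WC_eigen => //; first by rewrite /WC rev imv.
move=> z [w [[Wr Wi] w0 ew]].
have er : re w *m A = complex.Re z *: re w - complex.Im z *: im w.
  by apply/eqP; rewrite -subr_eq0 -re_sub ew; apply/eqP/rowP => i; rewrite !mxE.
have ei : im w *m A = complex.Re z *: im w + complex.Im z *: re w.
  by apply/eqP; rewrite -subr_eq0 -im_sub ew; apply/eqP/rowP => i; rewrite !mxE.
have sq (u : 'rV[R]_n.+1) : (u *m u^T) 0 0 = \sum_i u 0 i ^+ 2.
  by rewrite mxE; apply: eq_bigr => i _; rewrite mxE.
have sq0 (u : 'rV[R]_n.+1) : (u *m u^T) 0 0 = 0 -> u = 0.
  rewrite sq => /eqP; rewrite psumr_eq0 => [|i _]; last exact: sqr_ge0.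
  move=> /allP h; apply/rowP => i; rewrite mxE; apply/eqP.
  by rewrite -sqrf_eq0; apply: h; rewrite mem_index_enum.
have sqp (u : 'rV[R]_n.+1) : 0 <= (u *m u^T) 0 0.
  by rewrite sq sumr_ge0 // => i _; apply: sqr_ge0.
have tr (M : 'M[R]_1) : M 0 0 = M^T 0 0 by rewrite mxE.
(* Symmetry of A equates its pairing of re w with im w to that of im w with re w, which leaves Im z
   times the squared length of w. *)
have /eqP : complex.Im z * ((re w *m (re w)^T) 0 0 + (im w *m (im w)^T) 0 0) = 0.
  have : (re w *m A *m (im w)^T) 0 0 = (im w *m A *m (re w)^T) 0 0.
    by rewrite tr !trmx_mul trmxK A_sym mulmxA.
  rewrite er ei mulmxBl mulmxDl -!scalemxAl.
  have mE (a b : R) (M N : 'M[R]_1) : (a *: M + b *: N) 0 0 = a * M 0 0 + b * N 0 0.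
    by rewrite !mxE.
  rewrite -[- (_ *: _)]scaleNr !mE.
  have -> : (re w *m (im w)^T) 0 0 = (im w *m (re w)^T) 0 0.
    by rewrite tr trmx_mul trmxK.
  lra.
rewrite mulf_eq0 => /orP[/eqP z0|]; last first.
  rewrite paddr_eq0 // => /andP[/eqP/sq0 r0 /eqP/sq0 i0].
  case/eqP: w0; apply/rowP => i; move/rowP/(_ i): r0; move/rowP/(_ i): i0.
  by rewrite !mxE; case: (w 0 i) => a b /= -> ->.
rewrite z0 !scale0r subr0 addr0 in er ei.
have [r0|] := eqVneq (re w) 0; last by exists (complex.Re z), (re w).
exists (complex.Re z), (im w); split=> //; apply: contraNneq w0 => i0.
apply/eqP/rowP => i; move/rowP/(_ i): r0; move/rowP/(_ i): i0.
by rewrite !mxE; case: (w 0 i) => a b /= -> ->.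
Qed.

End SymmetricEigenvector.

(** * Torsion equations in a frame *)

Section CurriedTorsion.
Variables (R : comPzRingType) (V : Type).
Implicit Types (co : bool -> V -> R) (br : V -> V -> V) (D : V -> V).

(* On a product of linear forms this is their wedge product. *)
Definition alt3 (F : V -> V -> V -> R) u v w :=
  F u v w - F u w v - F v u w + F v w u + F w u v - F w v u.

Definition omega2 co1 co2 co3 (u v : V) : R :=
  (co1 false u * co1 true v - co1 true u * co1 false v) +
  (co2 false u * co2 true v - co2 true u * co2 false v) +
  (co3 false u * co3 true v - co3 true u * co3 false v).

Definition vol_re co1 co2 co3 : V -> V -> V -> R := alt3 (fun u v w =>
  co1 false u * (co2 false v * co3 false w - co2 true v * co3 true w) -
  co1 true u * (co2 false v * co3 true w + co2 true v * co3 false w)).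

Definition vol_im co1 co2 co3 : V -> V -> V -> R := alt3 (fun u v w =>
  co1 true u * (co2 false v * co3 false w - co2 true v * co3 true w) +
  co1 false u * (co2 false v * co3 true w + co2 true v * co3 false w)).

(** Half of om /\ om, the normalisation that occurs in the Hodge dual. *)
Definition wedge_sq (om : V -> V -> R) u v w z :=
  om u v * om w z - om u w * om v z + om u z * om v w.

Definition diff3 br (a : V -> V -> V -> R) u v w z :=
  - a (br u v) w z + a (br u w) v z - a (br u z) v w
  - a (br v w) u z + a (br v z) u w - a (br w z) u v.

(* The components of the torsion equations on the extension without e_7
   ([te_psip], [te_coclosed]) and with e_7 ([te_omega], [te_psim]). *)
Record torsion_eqs br D om pp pm (m : R) : Prop := TorsionEqs {
  te_psip : forall u v w z, diff3 br pp u v w z = 0;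
  te_omega : forall u v w,
    om (br u v) w - om (br u w) v + om (br v w) u
    - pp (D u) v w + pp (D v) u w - pp (D w) u v = 3 * m * pp u v w;
  te_coclosed : forall u v w z y, let s := wedge_sq om in
    - s (br u v) w z y + s (br u w) v z y - s (br u z) v w y + s (br u y) v w z
    - s (br v w) u z y + s (br v z) u w y - s (br v y) u w z
    - s (br w z) u v y + s (br w y) u v z - s (br z y) u v w = 0;
  te_psim : forall u v w z, let s := wedge_sq om in
    diff3 br pm u v w z - s (D u) v w z + s (D v) u w z - s (D w) u v z
    + s (D z) u v w = 4 * m * s u v w z }.

End CurriedTorsion.

Section Frame.
Variables (R : realType) (V : vectType R).
Implicit Types (f : 6.-tuple V).

Definition frame_co1 f (b : bool) (v : V) : R :=
  coord f (idx (if b then 4 else 1)) v.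

(* The second complex covector of a frame is f^2 - i f^3. *)
Definition frame_co2 f (b : bool) (v : V) : R :=
  if b then - coord f (idx 3) v else coord f (idx 2) v.

Definition frame_co3 f (b : bool) (v : V) : R :=
  coord f (idx (if b then 6 else 5)) v.

Lemma frame_omegaE f u v : frame_omega f (argv [:: u; v]) =
  omega2 (frame_co1 f) (frame_co2 f) (frame_co3 f) u v.
Proof.
rewrite /frame_omega /coframe !fctE !wedge11E /omega2 /frame_co1 /frame_co2 /frame_co3.
ring.
Qed.

Lemma frame_volumeE f u v w : frame_volume f (argv [:: u; v; w]) =
  (vol_re (frame_co1 f) (frame_co2 f) (frame_co3 f) u v w +i*
   vol_im (frame_co1 f) (frame_co2 f) (frame_co3 f) u v w)%C.
Proof.
rewrite /frame_volume.
pose z1 v : R[i] := (frame_co1 f false v +i* frame_co1 f true v)%C.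
pose z2 v : R[i] := (frame_co2 f false v +i* frame_co2 f true v)%C.
pose z3 v : R[i] := (frame_co3 f false v +i* frame_co3 f true v)%C.
rewrite -[cform (coframe f 1) _]/(one_form z1).
rewrite -[cform (coframe f 5) _]/(one_form z3).
rewrite -[cform (coframe f 2) _]/(one_form z2).
rewrite (wedge21E (K := R[i])); last exact: (wedge_alternating (one_form z1) (one_form z2)).
rewrite !(wedge11E (K := R[i])) /z1 /z2 /z3 /vol_re /vol_im /alt3.
by apply/eqP; rewrite eq_complex; apply/andP; split; apply/eqP => /=; ring.
Qed.

End Frame.

Section TorsionEqs.
Variables (R : realType) (V : vectType R) (br : V -> V -> V).
Variables (S : su3_structure V) (D : 'End(V)) (f : 6.-tuple V).
Hypothesis Somega : su3_omega S = frame_omega f.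
Hypothesis Spsi : cform (su3_psip S) (su3_psim S) = frame_volume f.
Hypothesis Smetric :
  forall x y, su3_metric S x y = \sum_i coord f i x * coord f i y.

Let om := omega2 (frame_co1 f) (frame_co2 f) (frame_co3 f).
Let pp := vol_re (frame_co1 f) (frame_co2 f) (frame_co3 f).
Let pm := vol_im (frame_co1 f) (frame_co2 f) (frame_co3 f).

Lemma su3_omegaE u v : su3_omega S (argv [:: u; v]) = om u v.
Proof. by rewrite Somega frame_omegaE. Qed.

Lemma su3_psiE u v w : su3_psip S (argv [:: u; v; w]) = pp u v w /\
  su3_psim S (argv [:: u; v; w]) = pm u v w.
Proof.
have := frame_volumeE f u v w; rewrite -Spsi /cform => /eqP.
by rewrite eq_complex /= => /andP[/eqP -> /eqP ->].
Qed.

(** The fields [su3_psip] and [su3_psim] are known only through the complex volume form, so their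
    alternation is read off its real and imaginary parts. *)
Lemma su3_alternating :
  [/\ alternating (su3_omega S), alternating (su3_psip S)
    & alternating (su3_psim S)].
Proof.
split.
- have ha i j := wedge_alternating (coframe f i) (coframe f j).
  rewrite Somega; apply: alternatingD; last exact: (ha 5 6).
  by apply: alternatingD; [exact: (ha 1 4)|apply: alternatingN; exact: (ha 2 3)].
all: move=> s x; have : frame_volume f (x \o s) = (-1) ^+ s * frame_volume f x
  by pose e := coframe f; exact: (wedge_alternating (wedge (cform (e 1) (e 4))
      (cform (e 2) (- e 3))) (cform (e 5) (e 6))).
all: rewrite -Spsi /cform; case: (odd_perm s).
all: rewrite ?expr0 ?expr1 ?mul1r ?mulN1r => /eqP; rewrite eq_complex /=.
all: by case/andP => /eqP ? /eqP ?.
Qed.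

Lemma e7_formE : e7_form S = one_form snd.
Proof.
apply/funext => x; rewrite /e7_form /one_form /ext_metric /= Smetric mul1r.
by rewrite big1 ?add0r // => i _; rewrite linear0 mul0r.
Qed.

Lemma ext_alternating k (a : form R V k) :
  alternating a -> alternating (ext_form a).
Proof. by move=> ha s x; rewrite /ext_form -ha. Qed.

Lemma ext_formE k (a : form R V k) s :
  ext_form a (argv s) = a (argv [seq x.1 | x <- s]).
Proof.
rewrite /ext_form; congr a; apply/funext => i; rewrite /argv.
have [h|h] := ltnP i (size s); first by rewrite (nth_map 0).
by rewrite !nth_default ?size_map.
Qed.

Lemma g2_phiE (u v w : V) (a b c : R) :
  g2_phi S (argv [:: (u, a); (v, b); (w, c)] : 'I_3 -> ext V) =
  om u v * c - om u w * b + om v w * a + pp u v w.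
Proof.
have [ho _ _] := su3_alternating.
rewrite /g2_phi !fctE e7_formE wedge21E; last exact: ext_alternating.
by rewrite !ext_formE /= !su3_omegaE (su3_psiE _ _ _).1.
Qed.

Lemma g2_star_phiE (u v w z : V) (a b c d : R) :
  g2_star_phi S (argv [:: (u, a); (v, b); (w, c); (z, d)] : 'I_4 -> ext V) =
  pm u v w * d - pm u v z * c + pm u w z * b - pm v w z * a
  + wedge_sq om u v w z.
Proof.
have [ho _ hm] := su3_alternating.
rewrite /g2_star_phi !fctE /fscale e7_formE wedge31E; last exact: ext_alternating.
rewrite wedge22E; try exact: ext_alternating.
by rewrite !ext_formE /= !su3_omegaE !(su3_psiE _ _ _).2 /wedge_sq; field.
Qed.

Lemma g2_alternating : alternating (g2_phi S) /\ alternating (g2_star_phi S).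
Proof.
have [ho hp hm] := su3_alternating.
have ha p (a : form R (ext V) p) := wedge_alternating a (e7_form S).
split; apply: alternatingD; try exact: ext_alternating.
- exact: (ha 2 (ext_form (su3_omega S))).
- exact: (ha 3 (ext_form (su3_psim S))).
apply: alternating_scale.
exact: (wedge_alternating (ext_form (su3_omega S)) (ext_form (su3_omega S))).
Qed.

Let co1_lin c a b u v w : frame_co1 f c (u + a *: v - b *: w) =
  frame_co1 f c u + a * frame_co1 f c v - b * frame_co1 f c w.
Proof. by rewrite /frame_co1 linearB linearD !linearZ. Qed.

Let co2_lin c a b u v w : frame_co2 f c (u + a *: v - b *: w) =
  frame_co2 f c u + a * frame_co2 f c v - b * frame_co2 f c w.
Proof. by case: c; rewrite /frame_co2 linearB linearD !linearZ /=; ring. Qed.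

Let co3_lin c a b u v w : frame_co3 f c (u + a *: v - b *: w) =
  frame_co3 f c u + a * frame_co3 f c v - b * frame_co3 f c w.
Proof. by rewrite /frame_co3 linearB linearD !linearZ. Qed.

Let omega_lin a b u v w z :
  om (u + a *: v - b *: w) z = om u z + a * om v z - b * om w z.
Proof. by rewrite /om /omega2 !co1_lin !co2_lin !co3_lin; ring. Qed.

Let vol_re_lin a b u v w y z :
  pp (u + a *: v - b *: w) y z = pp u y z + a * pp v y z - b * pp w y z.
Proof. by rewrite /pp /vol_re /alt3 !co1_lin !co2_lin !co3_lin; ring. Qed.

Let vol_im_lin a b u v w y z :
  pm (u + a *: v - b *: w) y z = pm u y z + a * pm v y z - b * pm w y z.
Proof. by rewrite /pm /vol_im /alt3 !co1_lin !co2_lin !co3_lin; ring. Qed.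

Let extb := ext_bracket br D.

(** The defect of the torsion equation is affine in the e_7-components of its arguments: the
    constant term is the differential of psi^+ on n, and E is the contraction with e_7. *)
Lemma g2_phi_torsionE m (u v w z : V) (a b c d : R) :
  let x := argv [:: (u, a); (v, b); (w, c); (z, d)] : 'I_4 -> ext V in
  let E u v w := om (br u v) w - om (br u w) v + om (br v w) u
    - pp (D u) v w + pp (D v) u w - pp (D w) u v - 3 * m * pp u v w in
  ce_diff extb (g2_phi S) x
    - fscale 3 (wedge (fscale m (e7_form S)) (g2_phi S) : form R (ext V) 4) x =
  diff3 br pp u v w z + a * E v w z - b * E u w z + c * E u v z - d * E u v w.
Proof.
move=> x E; rewrite /x ce_diff3E /fscale e7_formE.
rewrite (wedge13E (fun y : ext V => m * y.2)); last by case: g2_alternating.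
rewrite !g2_phiE /= !omega_lin !vol_re_lin /diff3 /E.
ring.
Qed.

Lemma g2_star_phi_torsionE m (u v w z y : V) (a b c d e : R) :
  let x := argv [:: (u, a); (v, b); (w, c); (z, d); (y, e)] : 'I_5 -> ext V in
  let s := wedge_sq om in
  let E u v w z := diff3 br pm u v w z - s (D u) v w z + s (D v) u w z - s (D w) u v z
    + s (D z) u v w - 4 * m * s u v w z in
  ce_diff extb (g2_star_phi S) x
    - fscale 4 (wedge (fscale m (e7_form S)) (g2_star_phi S) : form R (ext V) 5) x =
  - s (br u v) w z y + s (br u w) v z y - s (br u z) v w y + s (br u y) v w z
    - s (br v w) u z y + s (br v z) u w y - s (br v y) u w z
    - s (br w z) u v y + s (br w y) u v z - s (br z y) u v w
  + a * E v w z y - b * E u w z y + c * E u v z y - d * E u v w y + e * E u v w z.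
Proof.
move=> x s E; rewrite /x ce_diff4E /fscale e7_formE.
rewrite (wedge14E (fun y : ext V => m * y.2)); last by case: g2_alternating.
rewrite !g2_star_phiE /= /s /wedge_sq !omega_lin !vol_im_lin /E /s /diff3 /wedge_sq.
ring.
Qed.

Lemma torsion_eqsP m :
  torsion_X4 br S D (fscale m (e7_form S)) <-> torsion_eqs br D om pp pm m.
Proof.
split=> [[_ h3 h4]|[t1 t2 t3 t4]].
  have e3 := g2_phi_torsionE m; have e4 := g2_star_phi_torsionE m.
  rewrite /= h3 in e3; rewrite /= h4 in e4.
  have t1 u v w z : diff3 br pp u v w z = 0.
    by have := e3 u v w z 0 0 0 0; rewrite subrr !mul0r !(addr0, subr0).
  have t3 u v w z y := e4 u v w z y 0 0 0 0 0.
  split=> // [u v w|u v w z y|u v w z].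
  (* The first argument is e_7 itself, with zero component in V. *)
  - have := e3 0 u v w 1 0 0 0; rewrite t1 subrr; lra.
  - by rewrite /=; have := t3 u v w z y; rewrite subrr !mul0r !(addr0, subr0).
  - have := t3 0 u v w z; have := e4 0 u v w z 1 0 0 0 0; rewrite subrr /=; lra.
split.
(* Brackets of the extension have no e_7-component, so the Lee form is closed. *)
- apply/funext => x; rewrite /ce_diff big1 // => i _; rewrite big1 // => j _.
  by rewrite /fscale e7_formE /one_form /fcons unlift_none /= !mulr0.
- apply/funext => x; apply/eqP; rewrite -subr_eq0; apply/eqP.
  rewrite (argvE x) !enum_ordSl enum_ord0 /=.
  case: (x _) => u a; case: (x _) => v b; case: (x _) => w c; case: (x _) => z d.
  apply: etrans (g2_phi_torsionE m u v w z a b c d) _.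
  by rewrite /= t1 (t2 u v w) (t2 u v z) (t2 u w z) (t2 v w z) !subrr !mulr0 !(addr0, subr0).
- apply/funext => x; apply/eqP; rewrite -subr_eq0; apply/eqP.
  rewrite (argvE x) !enum_ordSl enum_ord0 /=.
  case: (x _) => u a; case: (x _) => v b; case: (x _) => w c; case: (x _) => z d.
  case: (x _) => y e.
  apply: etrans (g2_star_phi_torsionE m u v w z y a b c d e) _.
  by rewrite t3 !t4 !subrr !mulr0 !(addr0, subr0).
Qed.

End TorsionEqs.

(** * Unitary frames *)

Section DualFrame.
Variables (R : fieldType) (V : vectType R).

Lemma scalarE (c : V -> R) : scalar c ->
  [/\ {morph c : u v / u + v >-> u + v}, forall a u, c (a *: u) = a * c u,
      {morph c : u / - u >-> - u} & c 0 = 0].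
Proof.
move=> hc; have c0 : c 0 = 0.
  by have := hc (-1) 0 0; rewrite scaler0 addr0 mulN1r addNr.
have cZ a u : c (a *: u) = a * c u by rewrite -[_ *: u]addr0 hc c0 addr0.
split=> // [u v|u]; first by rewrite -[u]scale1r hc mul1r scale1r.
by rewrite -scaleN1r cZ mulN1r.
Qed.

(** The basis is kept as three planes with their covectors, so that the cyclic symmetry of the
    problem becomes a rotation of arguments. *)
Record dual_frame (e1 e2 e3 : bool -> V) (co1 co2 co3 : bool -> V -> R) : Prop :=
  DualFrame {
  df_lin : forall b, [/\ scalar (co1 b), scalar (co2 b) & scalar (co3 b)];
  df_dual1 : forall b b',
    [/\ co1 b (e1 b') = (b == b')%:R, co1 b (e2 b') = 0 & co1 b (e3 b') = 0];
  df_dual2 : forall b b',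
    [/\ co2 b (e1 b') = 0, co2 b (e2 b') = (b == b')%:R & co2 b (e3 b') = 0];
  df_dual3 : forall b b',
    [/\ co3 b (e1 b') = 0, co3 b (e2 b') = 0 & co3 b (e3 b') = (b == b')%:R];
  df_expand : forall u, u =
    (co1 false u *: e1 false + co1 true u *: e1 true) +
    (co2 false u *: e2 false + co2 true u *: e2 true) +
    (co3 false u *: e3 false + co3 true u *: e3 true) }.

Lemma dual_frame_rot e1 e2 e3 co1 co2 co3 :
  dual_frame e1 e2 e3 co1 co2 co3 -> dual_frame e2 e3 e1 co2 co3 co1.
Proof.
case=> hl h1 h2 h3 he; split.
- by move=> b; case: (hl b).
- by move=> b b'; case: (h2 b b').
- by move=> b b'; case: (h3 b b').
- by move=> b b'; case: (h1 b b').
- by move=> u; rewrite {1}(he u) -addrA addrC.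
Qed.

Definition complex_frame (J : V -> V) (e1 e2 e3 : bool -> V) : Prop :=
  forall b, [/\ J (e1 b) = if b then - e1 false else e1 true,
                J (e2 b) = if b then - e2 false else e2 true
              & J (e3 b) = if b then - e3 false else e3 true].

Lemma complex_frame_co (J : 'End(V)) e1 e2 e3 co1 co2 co3 u :
  dual_frame e1 e2 e3 co1 co2 co3 -> complex_frame J e1 e2 e3 ->
  co1 true (J u) = co1 false u /\ co1 false (J u) = - co1 true u.
Proof.
move=> [hl h1 h2 h3 he] hJ; rewrite [in J u](he u) !linearD !linearZ /=.
case: (hJ false) (hJ true) => -> -> -> [-> -> ->].
have cD b : {morph co1 b : u v / u + v >-> u + v}.
  by case: (hl b) => /scalarE[].
have cZ b a v : co1 b (a *: v) = a * co1 b v by case: (hl b) => /scalarE[].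
have cN b : {morph co1 b : u / - u >-> - u} by case: (hl b) => /scalarE[].
rewrite !cD !cZ !cN.
have d1 b b' : co1 b (e1 b') = (b == b')%:R by case: (h1 b b').
have d2 b b' : co1 b (e2 b') = 0 by case: (h1 b b').
have d3 b b' : co1 b (e3 b') = 0 by case: (h1 b b').
by rewrite !d1 !d2 !d3 /=; split; ring.
Qed.

End DualFrame.

Section ComplexVolume.
Variables (R : rcfType) (V : vectType R).
Implicit Types (co : bool -> V -> R).

Definition zco co (u : V) : R[i] := (co false u +i* co true u)%C.

Lemma volE co1 co2 co3 u v w :
  (vol_re co1 co2 co3 u v w +i* vol_im co1 co2 co3 u v w)%C =
  alt3 (fun u v w => zco co1 u * zco co2 v * zco co3 w) u v w.
Proof.
rewrite /vol_re /vol_im /alt3 /zco.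
by apply/eqP; rewrite eq_complex; apply/andP; split; apply/eqP => /=; ring.
Qed.

End ComplexVolume.

(** Both factors are 3 x 3 determinants, and g is the matrix of the product. *)
Lemma alt3_gram (K : comPzRingType) (T : Type) (a1 a2 a3 b1 b2 b3 : T -> K) u v w :
  let g x y := a1 x * b1 y + a2 x * b2 y + a3 x * b3 y in
  alt3 (fun u v w => a1 u * a2 v * a3 w) u v w *
  alt3 (fun u v w => b1 u * b2 v * b3 w) u v w =
  g u u * (g v v * g w w - g v w * g w v)
  - g u v * (g v u * g w w - g v w * g w u)
  + g u w * (g v u * g w v - g v v * g w u).
Proof. by rewrite /alt3 /=; ring. Qed.

(** Multiplicativity of determinants again, for the change from the a-coordinates to the
    b-coordinates with respect to x, y, z. *)
Lemma alt3_change (K : comPzRingType) (T : Type) (a1 a2 a3 b1 b2 b3 : T -> K) x y z u v w :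
  (forall t, t \in [:: 0; 1; 2]%N -> let r := nth u [:: u; v; w] t in
   [/\ a1 r = b1 r * a1 x + b2 r * a1 y + b3 r * a1 z,
       a2 r = b1 r * a2 x + b2 r * a2 y + b3 r * a2 z
     & a3 r = b1 r * a3 x + b2 r * a3 y + b3 r * a3 z]) ->
  alt3 (fun u v w => a1 u * a2 v * a3 w) u v w =
  alt3 (fun u v w => a1 u * a2 v * a3 w) x y z *
  alt3 (fun u v w => b1 u * b2 v * b3 w) u v w.
Proof.
move=> h; rewrite /alt3; have [/= -> -> ->] := h 0%N isT.
by have [/= -> -> ->] := h 1%N isT; have [/= -> -> ->] := h 2%N isT; ring.
Qed.

Section HermitianFrames.
Variables (R : rcfType) (V : vectType R) (h : V -> V -> R) (J : 'End(V)).
Implicit Types (co : bool -> V -> R).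

Definition hermitian_frame e1 e2 e3 co1 co2 co3 : Prop :=
  [/\ dual_frame e1 e2 e3 co1 co2 co3, complex_frame J e1 e2 e3
    & forall u v, h u v =
       (co1 false u * co1 false v + co1 true u * co1 true v) +
       (co2 false u * co2 false v + co2 true u * co2 true v) +
       (co3 false u * co3 false v + co3 true u * co3 true v)].

Lemma hermitian_frame_rot e1 e2 e3 co1 co2 co3 :
  hermitian_frame e1 e2 e3 co1 co2 co3 -> hermitian_frame e2 e3 e1 co2 co3 co1.
Proof.
case=> hd hJ hh; split; first exact: dual_frame_rot.
  by move=> b; case: (hJ b).
by move=> u v; rewrite hh; ring.
Qed.

(** Since h (J u) v does not mention the frame, all Hermitian frames define the same omega; only the
    volume form detects a phase. *)
Lemma hermitian_omega e1 e2 e3 co1 co2 co3 u v :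
  hermitian_frame e1 e2 e3 co1 co2 co3 -> omega2 co1 co2 co3 u v = h (J u) v.
Proof.
move=> h1; have h2 := hermitian_frame_rot h1; have h3 := hermitian_frame_rot h2.
case: h2 h3 => d2 J2 _ [d3 J3 _]; case: h1 => d1 J1 ->; rewrite /omega2.
have [-> ->] := complex_frame_co u d1 J1; have [-> ->] := complex_frame_co u d2 J2.
have [-> ->] := complex_frame_co u d3 J3; ring.
Qed.

(** The covector z_1 is complex linear for J, so its values on the vectors x_k of the other frame
    determine it. *)
Lemma zco_expand e1 e2 e3 co1 co2 co3 e1' e2' e3' co1' co2' co3' u :
  hermitian_frame e1 e2 e3 co1 co2 co3 ->
  hermitian_frame e1' e2' e3' co1' co2' co3' ->
  zco co1 u = zco co1' u * zco co1 (e1' false) + zco co2' u * zco co1 (e2' false)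
    + zco co3' u * zco co1 (e3' false).
Proof.
move=> [d1 J1 _] [d1' J1' _].
have cD b : {morph co1 b : u v / u + v >-> u + v}.
  by case: (df_lin d1 b) => /scalarE[].
have cZ b a v : co1 b (a *: v) = a * co1 b v.
  by case: (df_lin d1 b) => /scalarE[].
have cJ v := complex_frame_co v d1 J1.
rewrite {1}(df_expand d1' u).
have [<- <- <-] := J1' false.
by apply/eqP; rewrite eq_complex /zco /= !cD !cZ !(cJ _).1 !(cJ _).2;
  apply/andP; split; apply/eqP; ring.
Qed.

Lemma zco_gram e1 e2 e3 co1 co2 co3 u v :
  hermitian_frame e1 e2 e3 co1 co2 co3 ->
  zco co1 u * (zco co1 v)^*%C + zco co2 u * (zco co2 v)^*%C
    + zco co3 u * (zco co3 v)^*%C = (h u v -i* h (J u) v)%C.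
Proof.
move=> h1; rewrite -(hermitian_omega u v h1); case: h1 => _ _ ->.
rewrite /zco /omega2; apply/eqP; rewrite eq_complex /=.
by apply/andP; split; apply/eqP; ring.
Qed.

(** The factor zeta is the first volume form on the x-vectors of the second frame. By [alt3_gram]
    its squared modulus is the determinant of their Hermitian Gram matrix, which is the identity. *)
Lemma vol_change e1 e2 e3 co1 co2 co3 e1' e2' e3' co1' co2' co3' :
  hermitian_frame e1 e2 e3 co1 co2 co3 ->
  hermitian_frame e1' e2' e3' co1' co2' co3' ->
  exists C S : R, C ^+ 2 + S ^+ 2 = 1 /\ forall u v w,
    vol_re co1 co2 co3 u v w =
      C * vol_re co1' co2' co3' u v w - S * vol_im co1' co2' co3' u v w /\
    vol_im co1 co2 co3 u v w =
      S * vol_re co1' co2' co3' u v w + C * vol_im co1' co2' co3' u v w.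
Proof.
move=> h1 h1'; have h2 := hermitian_frame_rot h1; have h3 := hermitian_frame_rot h2.
have G u v := zco_gram u v h1.
pose zeta := alt3 (fun u v w => zco co1 u * zco co2 v * zco co3 w)
  (e1' false) (e2' false) (e3' false).
have E : zeta * zeta^*%C = 1.
  have -> : zeta^*%C = alt3 (fun u v w =>
      (zco co1 u)^*%C * (zco co2 v)^*%C * (zco co3 w)^*%C)
      (e1' false) (e2' false) (e3' false).
    by rewrite /zeta /alt3 !(rmorphB, rmorphD, rmorphM).
  rewrite alt3_gram !G; case: h1' => d1 J1 hh.
  have [-> -> ->] := J1 false; rewrite !hh.
  have [d11 d12 d13] := df_dual1 d1 false true.
  have [f11 f12 f13] := df_dual1 d1 false false.
  have [g11 g12 g13] := df_dual1 d1 true true.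
  have [k11 k12 k13] := df_dual1 d1 true false.
  have [d21 d22 d23] := df_dual2 d1 false true.
  have [f21 f22 f23] := df_dual2 d1 false false.
  have [g21 g22 g23] := df_dual2 d1 true true.
  have [k21 k22 k23] := df_dual2 d1 true false.
  have [d31 d32 d33] := df_dual3 d1 false true.
  have [f31 f32 f33] := df_dual3 d1 false false.
  have [g31 g32 g33] := df_dual3 d1 true true.
  have [k31 k32 k33] := df_dual3 d1 true false.
  rewrite !(d11, d12, d13, f11, f12, f13, g11, g12, g13, k11, k12, k13).
  rewrite !(d21, d22, d23, f21, f22, f23, g21, g22, g23, k21, k22, k23).
  rewrite !(d31, d32, d33, f31, f32, f33, g31, g32, g33, k31, k32, k33) /=.
  by apply/eqP; rewrite eq_complex /=; apply/andP; split; apply/eqP; ring.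
exists (complex.Re zeta), (complex.Im zeta); split.
  move/eqP: E; rewrite eq_complex => /andP[/eqP + _].
  by case: (zeta) => a b /= <-; ring.
move=> u v w; have := volE co1 co2 co3 u v w.
rewrite (_ : alt3 _ u v w = zeta *
  alt3 (fun u v w => zco co1' u * zco co2' v * zco co3' w) u v w); last first.
  apply: alt3_change => t _ r; rewrite {1}(zco_expand r h1 h1').
  by rewrite {1}(zco_expand r h2 h1') {1}(zco_expand r h3 h1').
rewrite -volE => /eqP; rewrite eq_complex => /andP[/eqP + /eqP].
by case: (zeta) => a b /= -> ->; split; ring.
Qed.

End HermitianFrames.

(** * Simultaneous diagonalisation of D and J D J^-1 *)

Section UnitaryDiagonalization.
Variables (R : rcfType) (V : vectType R) (f : 6.-tuple V) (h : V -> V -> R).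
Variables (J D : 'End(V)).
Hypothesis f_basis : basis_of fullv f.
Hypothesis hE : forall x y, h x y = \sum_i coord f i x * coord f i y.
Hypothesis JJ : forall u, J (J u) = - u.
Hypothesis hJ : forall u v, h (J u) v = - h u (J v).
Hypothesis D_self : forall x y, h (D x) y = h x (D y).
Hypothesis D_comm : forall u, D (J (D (J u))) = J (D (J (D u))).

Let hC u v : h u v = h v u.
Proof. by rewrite !hE; apply: eq_bigr => i _; rewrite mulrC. Qed.

Let hl a u v w : h (a *: u + v) w = a * h u w + h v w.
Proof.
rewrite !hE mulr_sumr -big_split; apply: eq_bigr => i _ /=.
by rewrite linearP /= mulrDl mulrA.
Qed.

Let h0 w : h 0 w = 0.
Proof. by rewrite hE big1 // => i _; rewrite linear0 mul0r. Qed.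

Let hZ a u w : h (a *: u) w = a * h u w.
Proof. by rewrite -[_ *: u]addr0 hl h0 addr0. Qed.

Let h_ge0 u : 0 <= h u u.
Proof. by rewrite hE sumr_ge0 // => i _; rewrite -expr2 sqr_ge0. Qed.

Let h_eq0 u : h u u = 0 -> u = 0.
Proof.
rewrite hE => /eqP; rewrite psumr_eq0 => [|i _]; last by rewrite -expr2 sqr_ge0.
move=> /allP e; rewrite (coord_basis f_basis (memvf u)) big1 // => i _.
by have := e i (mem_index_enum _); rewrite /= mulf_eq0 orbb => /eqP ->; rewrite scale0r.
Qed.

Lemma selfadjoint_eigenvector (B : 'End(V)) (W : V -> Prop) v :
  (forall x y, h (B x) y = h x (B y)) ->
  (forall a u v, W u -> W v -> W (a *: u + v)) -> (forall u, W u -> W (B u)) ->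
  W v -> v != 0 -> exists a w, [/\ W w, w != 0 & B w = a *: w].
Proof.
move=> B_self W_lin W_stable Wv v0.
pose row u : 'rV[R]_6 := \row_i coord f i u.
pose unrow (r : 'rV[R]_6) : V := \sum_i r 0 i *: f`_i.
have rowK u : unrow (row u) = u.
  rewrite {2}(coord_basis f_basis (memvf u)); apply: eq_bigr => i _.
  by rewrite mxE.
have unrowK r : row (unrow r) = r.
  apply/rowP => i; rewrite mxE coord_sum_free //; exact: basis_free f_basis.
have hf u (i : 'I_6) : h u f`_i = coord f i u.
  rewrite hE (bigD1 i) //= coord_free ?eqxx ?mulr1; last exact: basis_free f_basis.
  rewrite big1 ?addr0 // => j ji; rewrite coord_free; last exact: basis_free f_basis.
  by rewrite eq_sym (negbTE ji) mulr0.
pose A : 'M[R]_6 := \matrix_(i, j) coord f j (B f`_i).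
have A_sym : A^T = A.
  by apply/matrixP => i j; rewrite !mxE -!hf B_self hC.
have rowB u : row (B u) = row u *m A.
  apply/rowP => j; rewrite !mxE {1}(coord_basis f_basis (memvf u)).
  by rewrite !linear_sum; apply: eq_bigr => i _; rewrite !linearZ !mxE.
have unrow_lin a r s : unrow (a *: r + s) = a *: unrow r + unrow s.
  rewrite /unrow scaler_sumr -big_split; apply: eq_bigr => i _ /=.
  by rewrite !mxE scalerDl scalerA.
have [||||a [r [Wr r0 er]]] :=
    @symmetric_eigenvector R 5 A (fun r => W (unrow r)) A_sym _ _ (row v).
- by move=> a r s Wr Ws; rewrite unrow_lin; apply: W_lin.
- move=> r Wr; rewrite -[r]unrowK -rowB rowK; exact: W_stable.
- by rewrite rowK.
- by apply: contraNneq v0 => e; rewrite -(rowK v) e /unrow big1 // => i _; rewrite mxE scale0r.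
exists a, (unrow r); split=> //.
  by apply: contraNneq r0 => e; rewrite -(unrowK r) e; apply/eqP/rowP => i; rewrite !mxE linear0.
rewrite -[LHS]rowK rowB unrowK er /unrow scaler_sumr; apply: eq_bigr => i _.
by rewrite mxE scalerA.
Qed.

Lemma orthogonal_exists (s : seq V) : (size s < 6)%N ->
  exists2 u, u != 0 & forall x, x \in s -> h u x = 0.
Proof.
move=> s6; pose g u : 'rV[R]_(size s) := \row_j h u s`_j.
have g_lin : linear g by move=> a u v; apply/rowP => j; rewrite !mxE hl.
pose gl : {linear V -> 'rV[R]_(size s)} := HB.pack g (GRing.isLinear.Build _ _ _ _ g g_lin).
have [G GE] : exists G : 'Hom(V, 'rV[R]_(size s)), forall u, G u = g u.
  by exists (linfun gl) => u; rewrite lfunE.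
have := limg_ker_dim G fullv; rewrite capfv (size_basis f_basis) => e.
have k0 : lker G != 0%VS.
  rewrite -dimv_eq0 -lt0n; move: e.
  have := dimvS (subvf (limg G)); rewrite dimvf /dim /= mul1n; lia.
exists (vpick (lker G)); first by rewrite vpick0.
move=> x /(nthP 0) [i ils <-].
have : vpick (lker G) \in lker G by apply: memv_pick.
rewrite memv_ker GE => /eqP/rowP/(_ (Ordinal ils)).
by rewrite !mxE.
Qed.

(** The complement W of s is stable under D and J, where s only has to be J-closed up to sign
    because J (J v) = - v. An eigenspace of D in W is stable under B = - J D J, since (D J)^2 = (J
    D)^2 says that B commutes with D. An eigenvector w of the self-adjoint B in it is one of D, and
    B w = b w means D (J w) = b (J w). *)
Lemma common_eigenvector (s : seq V) : (size s < 6)%N ->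
  (forall x, x \in s -> exists l, D x = l *: x) ->
  (forall x, x \in s -> J x \in s \/ - J x \in s) ->
  exists v a b, [/\ h v v = 1, forall x, x \in s -> h v x = 0, D v = a *: v
    & D (J v) = b *: J v].
Proof.
move=> s6 sD sJ; have [u u0 us] := orthogonal_exists s6.
pose W v := forall x, x \in s -> h v x = 0.
have W_lin a v w : W v -> W w -> W (a *: v + w).
  by move=> Wv Ww x xs; rewrite hl Wv // Ww // mulr0 addr0.
have WD v : W v -> W (D v).
  move=> Wv x xs; rewrite D_self; have [l ->] := sD _ xs.
  by rewrite hC hZ hC Wv // mulr0.
have WJ v : W v -> W (J v).
  move=> Wv x xs; rewrite hJ; case: (sJ _ xs) => /Wv; first by move=> ->; rewrite oppr0.
  by rewrite hC -scaleN1r hZ mulN1r hC.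
pose B := (- (J \o (D \o J)))%VF.
have BE v : B v = - J (D (J v)) by rewrite !lfunE /= !lfunE /= !lfunE.
have WN v : W v -> W (- v).
  move=> Wv; rewrite -scaleN1r -[_ *: v]addr0.
  by apply: (W_lin _ _ _ Wv) => x _; exact: h0.
have [a [p [Wp p0 Dp]]] := selfadjoint_eigenvector D_self W_lin WD us u0.
pose W2 v := W v /\ D v = a *: v.
have hN v w : h (- v) w = - h v w by rewrite -scaleN1r hZ mulN1r.
have hNr v w : h v (- w) = - h v w by rewrite hC hN hC.
have [|||b [w [[Ww Dw] w0 Bw]]] := @selfadjoint_eigenvector B W2 p _ _ _ (conj Wp Dp) p0.
- by move=> x y; rewrite !BE hN hNr hJ opprK D_self hJ.
- move=> c x y [Wx Dx] [Wy Dy]; split; first exact: W_lin.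
  by rewrite linearP /= Dx Dy scalerDr !scalerA mulrC.
- move=> x [Wx Dx]; split; first by rewrite BE; apply/WN/WJ/WD/WJ.
  by rewrite BE linearN /= D_comm Dx !linearZ /= scalerN.
have hw : 0 < h w w.
  by rewrite lt_neqAle h_ge0 andbT eq_sym; apply: contraNneq w0 => /h_eq0 ->.
pose c := (Num.sqrt (h w w))^-1.
exists (c *: w), a, b; split.
- rewrite hZ hC hZ mulrA -expr2 exprVn sqr_sqrtr ?ltW // mulVf //.
  by rewrite gt_eqF.
- by move=> x xs; rewrite hZ Ww // mulr0.
- by rewrite linearZ /= Dw !scalerA mulrC.
- have : J (B w) = b *: J w by rewrite Bw linearZ.
  rewrite BE linearN /= JJ opprK => e.
  by rewrite !linearZ /= e !scalerA mulrC.
Qed.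

Lemma unitary_diagonalization : exists e1 e2 e3 co1 co2 co3,
  hermitian_frame h J e1 e2 e3 co1 co2 co3 /\ exists l1 l2 l3 : bool -> R,
  forall b, [/\ D (e1 b) = l1 b *: e1 b, D (e2 b) = l2 b *: e2 b
    & D (e3 b) = l3 b *: e3 b].
Proof.
have JJN v : - J (J v) = v by rewrite JJ opprK.
have [v1 [a1 [b1 [n1 _ Da1 Db1]]]] : exists v a b,
    [/\ h v v = 1, forall x, x \in [::] -> h v x = 0, D v = a *: v
    & D (J v) = b *: J v].
  by apply: common_eigenvector.
have [v2 [a2 [b2 [n2 o2 Da2 Db2]]]] : exists v a b,
    [/\ h v v = 1, forall x, x \in [:: v1; J v1] -> h v x = 0, D v = a *: v
    & D (J v) = b *: J v].
  apply: common_eigenvector => // x; rewrite !inE => /orP[] /eqP ->.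
  - by exists a1. - by exists b1.
  - by left; rewrite eqxx orbT. - by right; rewrite JJN eqxx.
have [v3 [a3 [b3 [n3 o3 Da3 Db3]]]] : exists v a b,
    [/\ h v v = 1, forall x, x \in [:: v1; J v1; v2; J v2] -> h v x = 0, D v = a *: v
    & D (J v) = b *: J v].
  apply: common_eigenvector => // x; rewrite !inE => /or4P[] /eqP ->.
  - by exists a1. - by exists b1. - by exists a2. - by exists b2.
  - by left; rewrite eqxx orbT. - by right; rewrite JJN eqxx.
  - by left; rewrite eqxx !orbT. - by right; rewrite JJN eqxx !orbT.
have s1 (v : V) : v \in [:: v] by rewrite inE.
have hN u w : h (- u) w = - h u w by rewrite -scaleN1r hZ mulN1r.
have hNr u w : h u (- w) = - h u w by rewrite hC hN hC.
have o21 : h v2 v1 = 0 by rewrite o2 // !inE eqxx.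
have o21' : h v2 (J v1) = 0 by rewrite o2 // !inE eqxx orbT.
have o31 : h v3 v1 = 0 by rewrite o3 // !inE eqxx.
have o31' : h v3 (J v1) = 0 by rewrite o3 // !inE eqxx orbT.
have o32 : h v3 v2 = 0 by rewrite o3 // !inE eqxx !orbT.
have o32' : h v3 (J v2) = 0 by rewrite o3 // !inE eqxx !orbT.
have sk v : h v (J v) = 0 by have := hJ v v; rewrite hC; lra.
have sk' v : h (J v) v = 0 by rewrite hC sk.
have hJJ u v : h (J u) (J v) = h u v by rewrite hJ JJ hNr opprK.
have [e [ef et]] : exists e : V -> bool -> V,
    (forall v, e v false = v) /\ forall v, e v true = J v.
  by exists (fun v b => if b then J v else v).
have eN v w : h v w = 0 -> h v (J w) = 0 ->
    forall b b', ((h (e v b) (e w b') = 0) * (h (e w b') (e v b) = 0))%type.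
  move=> vw vJw b b'; suff E : h (e v b) (e w b') = 0 by split=> //; rewrite hC.
  by case: b; case: b'; rewrite ?ef ?et ?hJJ ?vw ?vJw // hJ vJw oppr0.
have e1 v : h v v = 1 -> forall b b', h (e v b) (e v b') = (b == b')%:R.
  by move=> n [] []; rewrite ?ef ?et ?hJJ ?n ?sk ?sk'.
have E21 := eN _ _ o21 o21'; have E31 := eN _ _ o31 o31'.
have E32 := eN _ _ o32 o32'.
pose X := [tuple e v1 false; e v1 true; e v2 false; e v2 true; e v3 false; e v3 true].
have hX (i j : 'I_6) : h X`_i X`_j = (i == j)%:R.
  by case: i => -[|[|[|[|[|[|?]]]]]] ? //; case: j => -[|[|[|[|[|[|?]]]]]] ? //;
    rewrite /= ?E21 ?E31 ?E32 ?e1.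
have hD x y w : h (x + y) w = h x w + h y w.
  by rewrite -[x]scale1r hl mul1r scale1r.
have hsum I (r : seq I) (F : I -> V) w : h (\sum_(i <- r) F i) w = \sum_(i <- r) h (F i) w.
  elim: r => [|i r IH]; first by rewrite !big_nil h0.
  by rewrite !big_cons hD IH.
have Xfree : free X.
  apply/freeP => k k0 j; have := congr1 (fun u => h u X`_j) k0.
  rewrite hsum h0 (bigD1 j) //= big1 => [|i ij]; last first.
    by rewrite hZ hX (negbTE ij) mulr0.
  by rewrite hZ hX eqxx mulr1 addr0.
have Xbasis : basis_of fullv X.
  by rewrite basisEfree Xfree subvf (size_basis f_basis) size_tuple.
have expand u : u = \sum_(i < 6) h u X`_i *: X`_i.
  rewrite {1}(coord_basis Xbasis (memvf u)); apply: eq_bigr => j _; congr (_ *: _).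
  rewrite {2}(coord_basis Xbasis (memvf u)) hsum (bigD1 j) //= big1 => [|i ij].
    by rewrite hZ hX eqxx mulr1 addr0.
  by rewrite hZ hX (negbTE ij) mulr0.
have expand6 u : u = (h u (e v1 false) *: e v1 false + h u (e v1 true) *: e v1 true) +
    (h u (e v2 false) *: e v2 false + h u (e v2 true) *: e v2 true) +
    (h u (e v3 false) *: e v3 false + h u (e v3 true) *: e v3 true).
  by rewrite {1}(expand u) !big_ord_recl big_ord0 addr0 /= !addrA.
exists (e v1), (e v2), (e v3), (fun b u => h u (e v1 b)), (fun b u => h u (e v2 b)),
  (fun b u => h u (e v3 b)); split; [split; [split| |]|].
- by move=> b; split=> a u v; rewrite hl.
- by move=> b b'; rewrite e1 // E21 E31 eq_sym.
- by move=> b b'; rewrite e1 // E21 E32 eq_sym.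
- by move=> b b'; rewrite e1 // E31 E32 eq_sym.
- exact: expand6.
- by case; split; rewrite ?ef ?et ?JJ.
- move=> u v; rewrite {1}(expand6 u).
  by rewrite !hD !hZ; rewrite ![h (e _ _) v]hC.
exists (fun b => if b then b1 else a1), (fun b => if b then b2 else a2),
  (fun b => if b then b3 else a3).
by case; split; rewrite ?ef ?et.
Qed.

End UnitaryDiagonalization.

(** * Structure coefficients of an adapted frame *)

Section Adapted.
Variables (R : realFieldType) (V : vectType R).

(* The complex volume form of the SU(3) structure is (C + i S) times that of the
   frame. *)
Record adapted (br : V -> V -> V) (D : V -> V) (C S m : R)
    (e1 e2 e3 : bool -> V) (co1 co2 co3 : bool -> V -> R) (l1 l2 l3 : bool -> R) :
    Prop := Adapted {
  ad_dual : dual_frame e1 e2 e3 co1 co2 co3;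
  ad_lie : is_lie_bracket br;
  ad_der : forall x y, D (br x y) = br (D x) y + br x (D y);
  ad_lin : linear D;
  ad_eig : forall b, [/\ D (e1 b) = l1 b *: e1 b, D (e2 b) = l2 b *: e2 b
                       & D (e3 b) = l3 b *: e3 b];
  ad_lam : forall b, [/\ l1 b != 0, l2 b != 0 & l3 b != 0];
  ad_phase : C ^+ 2 + S ^+ 2 = 1;
  ad_torsion : torsion_eqs br D (omega2 co1 co2 co3)
    (fun u v w => C * vol_re co1 co2 co3 u v w - S * vol_im co1 co2 co3 u v w)
    (fun u v w => S * vol_re co1 co2 co3 u v w + C * vol_im co1 co2 co3 u v w) m }.

Lemma vol_rot (co1 co2 co3 : bool -> V -> R) :
  [/\ omega2 co2 co3 co1 = omega2 co1 co2 co3,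
      vol_re co2 co3 co1 = vol_re co1 co2 co3
    & vol_im co2 co3 co1 = vol_im co1 co2 co3].
Proof.
split; apply/funext => u; apply/funext => v; try apply/funext => w;
  rewrite /omega2 /vol_re /vol_im /alt3; ring.
Qed.

Lemma adapted_rot br D C S m e1 e2 e3 co1 co2 co3 l1 l2 l3 :
  adapted br D C S m e1 e2 e3 co1 co2 co3 l1 l2 l3 ->
  adapted br D C S m e2 e3 e1 co2 co3 co1 l2 l3 l1.
Proof.
case=> hd hlie hder hlin he hl hp ht; split=> //; first exact: dual_frame_rot.
- by move=> b; case: (he b).
- by move=> b; case: (hl b).
- by have [-> -> ->] := vol_rot co1 co2 co3.
Qed.

Section BracketWeights.
Variables (br : V -> V -> V) (D : V -> V) (C S m : R).
Variables (e1 e2 e3 : bool -> V) (co1 co2 co3 : bool -> V -> R).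
Variables (l1 l2 l3 : bool -> R).
Hypothesis ad : adapted br D C S m e1 e2 e3 co1 co2 co3 l1 l2 l3.

Lemma co1E b : [/\ {morph co1 b : u v / u + v >-> u + v},
  forall a u, co1 b (a *: u) = a * co1 b u, {morph co1 b : u / - u >-> - u}
  & co1 b 0 = 0].
Proof. by apply: scalarE; case: (df_lin (ad_dual ad) b). Qed.

Lemma br0l u : br 0 u = 0.
Proof.
have := lie_linearl (ad_lie ad) u (-1) 0 0.
by rewrite scaler0 addr0 scaleN1r addNr.
Qed.

Lemma brZl a u v : br (a *: u) v = a *: br u v.
Proof.
by have := lie_linearl (ad_lie ad) v a u 0; rewrite /= addr0 br0l addr0.
Qed.

Lemma brDl u v w : br (u + v) w = br u w + br v w.
Proof. by have := lie_linearl (ad_lie ad) w 1 u v; rewrite /= !scale1r. Qed.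

Lemma br0r u : br u 0 = 0.
Proof.
have := lie_linearr (ad_lie ad) u (-1) 0 0.
by rewrite scaler0 addr0 scaleN1r addNr.
Qed.

Lemma brZr a u v : br u (a *: v) = a *: br u v.
Proof.
by have := lie_linearr (ad_lie ad) u a v 0; rewrite /= addr0 br0r addr0.
Qed.

Lemma brDr u v w : br u (v + w) = br u v + br u w.
Proof. by have := lie_linearr (ad_lie ad) u 1 v w; rewrite /= !scale1r. Qed.

Lemma brC u v : br v u = - br u v.
Proof.
have := lie_alternating (ad_lie ad) (u + v).
rewrite brDl !brDr !(lie_alternating (ad_lie ad)) add0r addr0 => /eqP.
by rewrite addrC addr_eq0 => /eqP.
Qed.

Lemma co1_D b u : co1 b (D u) = l1 b * co1 b u.
Proof.
have [cD cZ _ _] := co1E b.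
have DD u' v' : D (u' + v') = D u' + D v'.
  by have := ad_lin ad 1 u' v'; rewrite !scale1r.
have D0 : D 0 = 0.
  by have := ad_lin ad (-1) 0 0; rewrite scaler0 addr0 scaleN1r addNr.
have DZ a u' : D (a *: u') = a *: D u'.
  by have := ad_lin ad a u' 0; rewrite D0 !addr0.
have E := ad_eig ad; have d b' := df_dual1 (ad_dual ad) b b'.
rewrite {1}(df_expand (ad_dual ad) u) !DD !DZ.
case: (E false) (E true) => -> -> -> [-> -> ->].
rewrite !cD !cZ; case: (d false) (d true) => -> -> -> [-> -> ->].
by case: (b) => /=; ring.
Qed.

Lemma co1_weight b x y ax ay : D x = ax *: x -> D y = ay *: y ->
  co1 b (br x y) * (l1 b - ax - ay) = 0.
Proof.
move=> Dx Dy; have := co1_D b (br x y); have [cD cZ _ _] := co1E b.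
by rewrite (ad_der ad) Dx Dy brZl brZr cD !cZ; lra.
Qed.

Lemma co1_weight_neq b x y ax ay : D x = ax *: x -> D y = ay *: y ->
  l1 b != ax + ay -> co1 b (br x y) = 0.
Proof.
move=> Dx Dy ne; have /eqP := co1_weight b Dx Dy; rewrite mulf_eq0 => /orP[/eqP //|].
by rewrite -addrA -opprD subr_eq0 (negbTE ne).
Qed.

(** A non-zero component would need l1 b = l1 b + ay. *)
Lemma co1_br_self b y ay : D y = ay *: y -> ay != 0 -> co1 b (br (e1 b) y) = 0.
Proof.
move=> Dy a0; have [De _ _] := ad_eig ad b; apply: (co1_weight_neq De Dy).
by rewrite -subr_eq0 opprD addrA subrr add0r oppr_eq0.
Qed.

Lemma co1_br11 b : co1 b (br (e1 false) (e1 true)) = 0.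
Proof.
have [_ _ cN _] := co1E b.
have [Ef _ _] := ad_eig ad false; have [Et _ _] := ad_eig ad true.
have [lf _ _] := ad_lam ad false; have [lt _ _] := ad_lam ad true.
case: b cN => cN; last exact: co1_br_self _ Et lt.
by rewrite brC cN (co1_br_self _ Ef lf) oppr0.
Qed.

End BracketWeights.

Section MixedBrackets.
Variables (br : V -> V -> V) (D : V -> V) (C S m : R).
Variables (e1 e2 e3 : bool -> V) (co1 co2 co3 : bool -> V -> R).
Variables (l1 l2 l3 : bool -> R).
Hypothesis ad : adapted br D C S m e1 e2 e3 co1 co2 co3 l1 l2 l3.

Let ad2 := adapted_rot ad.
Let ad3 := adapted_rot ad2.
Let hd := ad_dual ad.

Let d11 b b' : co1 b (e1 b') = (b == b')%:R. Proof. by case: (df_dual1 hd b b'). Qed.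
Let d12 b b' : co1 b (e2 b') = 0. Proof. by case: (df_dual1 hd b b'). Qed.
Let d13 b b' : co1 b (e3 b') = 0. Proof. by case: (df_dual1 hd b b'). Qed.
Let d21 b b' : co2 b (e1 b') = 0. Proof. by case: (df_dual2 hd b b'). Qed.
Let d22 b b' : co2 b (e2 b') = (b == b')%:R. Proof. by case: (df_dual2 hd b b'). Qed.
Let d23 b b' : co2 b (e3 b') = 0. Proof. by case: (df_dual2 hd b b'). Qed.
Let d31 b b' : co3 b (e1 b') = 0. Proof. by case: (df_dual3 hd b b'). Qed.
Let d32 b b' : co3 b (e2 b') = 0. Proof. by case: (df_dual3 hd b b'). Qed.
Let d33 b b' : co3 b (e3 b') = (b == b')%:R. Proof. by case: (df_dual3 hd b b'). Qed.
Let dE := (d11, d12, d13, d21, d22, d23, d31, d32, d33).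

Let cZ1 b a u : co1 b (a *: u) = a * co1 b u. Proof. by case: (co1E ad b). Qed.
Let cZ2 b a u : co2 b (a *: u) = a * co2 b u. Proof. by case: (co1E ad2 b). Qed.
Let cZ3 b a u : co3 b (a *: u) = a * co3 b u. Proof. by case: (co1E ad3 b). Qed.
Let cZE := (cZ1, cZ2, cZ3).

Let E1 b : D (e1 b) = l1 b *: e1 b. Proof. by case: (ad_eig ad b). Qed.
Let E2 b : D (e2 b) = l2 b *: e2 b. Proof. by case: (ad_eig ad b). Qed.
Let E3 b : D (e3 b) = l3 b *: e3 b. Proof. by case: (ad_eig ad b). Qed.
Let EE := (E1, E2, E3).

Let n1 b : l1 b != 0. Proof. by case: (ad_lam ad b). Qed.
Let n2 b : l2 b != 0. Proof. by case: (ad_lam ad b). Qed.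
Let n3 b : l3 b != 0. Proof. by case: (ad_lam ad b). Qed.

(** In [te_omega] on x_1, y_1 and a vector of P_2 the volume terms vanish, two arguments lying in
    one plane, and each bracket of P_1 with P_2 enters only through its component along its own P_1
    argument, which [co1_br_self] kills. *)
Lemma co2_br11 b : co2 b (br (e1 false) (e1 true)) = 0.
Proof.
have := te_omega (ad_torsion ad) (e1 false) (e1 true) (e2 (~~ b)).
rewrite !EE /omega2 /vol_re /vol_im /alt3 !cZE !dE.
rewrite !(co1_br_self ad _ (E2 _) (n2 _)) /=.
by case: b => /=; lra.
Qed.

Lemma co3_br11 b : co3 b (br (e1 false) (e1 true)) = 0.
Proof.
have := te_omega (ad_torsion ad) (e1 false) (e1 true) (e3 (~~ b)).
rewrite !EE /omega2 /vol_re /vol_im /alt3 !cZE !dE.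
rewrite !(co1_br_self ad _ (E3 _) (n3 _)) /=.
by case: b => /=; lra.
Qed.

(** Undoes the rotation by C + i S, using that psi^+ is closed. *)
Lemma diff3_phase u v w z k :
  diff3 br (fun u v w => S * vol_re co1 co2 co3 u v w
    + C * vol_im co1 co2 co3 u v w) u v w z = k ->
  diff3 br (vol_re co1 co2 co3) u v w z = S * k /\
  diff3 br (vol_im co1 co2 co3) u v w z = C * k.
Proof.
have := te_psip (ad_torsion ad) u v w z.
have lin a b (F G : V -> V -> V -> R) : diff3 br (fun u v w => a * F u v w + b * G u v w) u v w z =
    a * diff3 br F u v w z + b * diff3 br G u v w z by rewrite /diff3; ring.
have -> : diff3 br (fun u v w => C * vol_re co1 co2 co3 u v w
    - S * vol_im co1 co2 co3 u v w) u v w z =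
  C * diff3 br (vol_re co1 co2 co3) u v w z - S * diff3 br (vol_im co1 co2 co3) u v w z.
  by rewrite /diff3; ring.
rewrite lin; move: (diff3 _ _ _ _ _ _) (diff3 _ _ _ _ _ _) => X Y h1 h2.
have p := ad_phase ad; split; rewrite -[LHS]mulr1 -p -h2.
  by rewrite -[RHS]addr0 -[0 in RHS](mulr0 C) -h1; ring.
by rewrite -[RHS]subr0 -[0 in RHS](mulr0 S) -h1; ring.
Qed.

(** The right side vanishes because omega pairs each plane with itself only, while the last two
    arguments lie in different planes. *)
Lemma diff3_vol123 b2 b3 :
  diff3 br (vol_re co1 co2 co3) (e1 false) (e1 true) (e2 b2) (e3 b3) = 0 /\
  diff3 br (vol_im co1 co2 co3) (e1 false) (e1 true) (e2 b2) (e3 b3) = 0.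
Proof.
rewrite -[in X in X /\ _](mulr0 S) -[in X in _ /\ X](mulr0 C); apply: diff3_phase.
have := te_psim (ad_torsion ad) (e1 false) (e1 true) (e2 b2) (e3 b3).
rewrite /= !EE /wedge_sq /omega2 !cZE !dE /=.
by lra.
Qed.

(** With [pim], the real and imaginary parts of i^(b + b') z(p): the volume form with two slots
    filled by frame vectors. *)
Let pre (c : bool -> V -> R) (b b' : bool) p :=
  if b (+) b' then - c true p else if b then - c false p else c false p.
Let pim (c : bool -> V -> R) (b b' : bool) p :=
  if b (+) b' then c false p else if b then - c true p else c true p.

Let vre23 p b b' : vol_re co1 co2 co3 p (e2 b) (e3 b') = pre co1 b b' p.
Proof. by rewrite /vol_re /alt3 !dE /pre; case: b; case: b' => /=; ring. Qed.
Let vre12 p b b' : vol_re co1 co2 co3 p (e1 b) (e2 b') = pre co3 b b' p.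
Proof. by rewrite /vol_re /alt3 !dE /pre; case: b; case: b' => /=; ring. Qed.
Let vre13 p b b' : vol_re co1 co2 co3 p (e1 b) (e3 b') = - pre co2 b b' p.
Proof. by rewrite /vol_re /alt3 !dE /pre; case: b; case: b' => /=; ring. Qed.
Let vre11 p b b' : vol_re co1 co2 co3 p (e1 b) (e1 b') = 0.
Proof. by rewrite /vol_re /alt3 !dE; ring. Qed.
Let vre22 p b b' : vol_re co1 co2 co3 p (e2 b) (e2 b') = 0.
Proof. by rewrite /vol_re /alt3 !dE; ring. Qed.
Let vim23 p b b' : vol_im co1 co2 co3 p (e2 b) (e3 b') = pim co1 b b' p.
Proof. by rewrite /vol_im /alt3 !dE /pim; case: b; case: b' => /=; ring. Qed.
Let vim12 p b b' : vol_im co1 co2 co3 p (e1 b) (e2 b') = pim co3 b b' p.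
Proof. by rewrite /vol_im /alt3 !dE /pim; case: b; case: b' => /=; ring. Qed.
Let vim13 p b b' : vol_im co1 co2 co3 p (e1 b) (e3 b') = - pim co2 b b' p.
Proof. by rewrite /vol_im /alt3 !dE /pim; case: b; case: b' => /=; ring. Qed.
Let vim11 p b b' : vol_im co1 co2 co3 p (e1 b) (e1 b') = 0.
Proof. by rewrite /vol_im /alt3 !dE; ring. Qed.
Let vim22 p b b' : vol_im co1 co2 co3 p (e2 b) (e2 b') = 0.
Proof. by rewrite /vol_im /alt3 !dE; ring. Qed.
Let vE := (vre23, vre12, vre13, vre11, vre22, vim23, vim12, vim13, vim11, vim22).

Let z2 b1 b : co2 b (br (e1 b1) (e2 b)) = 0.
Proof.
have [_ _ cN _] := co1E ad2 b.
by rewrite (brC ad) cN (co1_br_self ad2 _ (E1 _) (n1 _)) oppr0.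
Qed.
Let z3 b1 b : co3 b (br (e1 b1) (e3 b)) = 0.
Proof.
have [_ _ cN _] := co1E ad3 b.
by rewrite (brC ad) cN (co1_br_self ad3 _ (E1 _) (n1 _)) oppr0.
Qed.

(* For a fixed vector of the first plane the components co2 true [e1 b, e2 false]
   and co2 false [e1 b, e2 true] agree up to sign, but have incompatible weights. *)
Lemma br12_type_B b :
  [/\ co2 true (br (e1 b) (e2 false)) = 0, co2 false (br (e1 b) (e2 true)) = 0,
      co3 true (br (e1 b) (e3 false)) = 0 & co3 false (br (e1 b) (e3 true)) = 0].
Proof.
have ne : co2 true (br (e1 b) (e2 false)) * co2 false (br (e1 b) (e2 true)) = 0.
  have := co1_weight ad2 true (E1 b) (E2 false).
  have := co1_weight ad2 false (E1 b) (E2 true).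
  move=> /eqP; rewrite mulf_eq0 => /orP[/eqP -> _|/eqP h3]; first by rewrite mulr0.
  move=> /eqP; rewrite mulf_eq0 => /orP[/eqP ->|/eqP h2]; first by rewrite mul0r.
  by case/eqP: (n1 b); move: h2 h3; lra.
have [] := diff3_vol123 false false; have [] := diff3_vol123 false true.
have [] := diff3_vol123 true false; have [] := diff3_vol123 true true.
rewrite /diff3 !vE /pre /pim /= !(co1_br11 ad).
rewrite !z2 !z3 !(oppr0, opprK, addr0, add0r, subr0, sub0r).
move=> h1 h2 h3 h4 h5 h6 h7 h8.
have q0 : co2 false (br (e1 b) (e2 true)) = 0.
  apply/eqP; rewrite -sqrf_eq0 expr2; apply/eqP.
  have [e|e] : co2 false (br (e1 b) (e2 true)) = co2 true (br (e1 b) (e2 false)) \/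
    co2 false (br (e1 b) (e2 true)) = - co2 true (br (e1 b) (e2 false)).
    by case: (b); first [left; lra | right; lra].
  - by rewrite {1}e ne.
  - by rewrite {1}e mulNr ne oppr0.
by move: q0 h1 h2 h3 h4 h5 h6 h7 h8; case: (b); split; lra.
Qed.

End MixedBrackets.
End Adapted.

Section StructureCoefficients.
Variables (R : realFieldType) (V : vectType R).

(** Components along the arguments themselves vanish by weights, those along their partners by
    [br12_type_B], read in the rotated frame for P_1. *)
Lemma br_planes br D C S m e1 e2 e3 co1 co2 co3 (l1 l2 l3 : bool -> R) b b1 b2 :
  adapted (V := V) br D C S m e1 e2 e3 co1 co2 co3 l1 l2 l3 ->
  co1 b (br (e1 b1) (e2 b2)) = 0 /\ co2 b (br (e1 b1) (e2 b2)) = 0.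
Proof.
move=> ad; have ad2 := adapted_rot ad.
have [_ _ cN1 _] := co1E ad b; have [_ _ cN2 _] := co1E ad2 b.
have [E11 _ _] := ad_eig ad b1; have [_ E22 _] := ad_eig ad b2.
have [n11 _ _] := ad_lam ad b1; have [_ n22 _] := ad_lam ad b2.
have [B1 B2 _ _] := br12_type_B ad b1; have [_ _ B3 B4] := br12_type_B ad2 b2.
split.
  have [bb|] := eqVneq b b1; first by rewrite bb (co1_br_self ad _ E22).
  by rewrite (brC ad) cN1 => ne; apply/eqP; rewrite oppr_eq0; apply/eqP;
    move: ne; case: b b1 {E11 n11 B1 B2 cN1 cN2} => [] [].
have [bb|] := eqVneq b b2.
  by rewrite (brC ad) cN2 bb (co1_br_self ad2 _ E11) ?oppr0.
by case: b b2 {E22 n22 B3 B4 cN1 cN2} => [] [].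
Qed.

(* The coefficient of z_2 z_3 in the differential of the covector conjugate to
   z_1, up to the sign which it has in the differential of omega. *)
Definition struct_coef (br : V -> V -> V) (co1 : bool -> V -> R) (e2 e3 : bool -> V)
    (b1 b2 b3 : bool) : R :=
  - bsign R b1 * co1 (~~ b1) (br (e2 b2) (e3 b3)).

Section StructureEquationsInFrame.
Variables (br : V -> V -> V) (D : V -> V) (C S m : R).
Variables (e1 e2 e3 : bool -> V) (co1 co2 co3 : bool -> V -> R).
Variables (l1 l2 l3 : bool -> R).
Hypothesis ad : adapted br D C S m e1 e2 e3 co1 co2 co3 l1 l2 l3.

Let ad2 := adapted_rot ad.
Let ad3 := adapted_rot ad2.
Let hd := ad_dual ad.

Let d11 b b' : co1 b (e1 b') = (b == b')%:R. Proof. by case: (df_dual1 hd b b'). Qed.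
Let d12 b b' : co1 b (e2 b') = 0. Proof. by case: (df_dual1 hd b b'). Qed.
Let d13 b b' : co1 b (e3 b') = 0. Proof. by case: (df_dual1 hd b b'). Qed.
Let d21 b b' : co2 b (e1 b') = 0. Proof. by case: (df_dual2 hd b b'). Qed.
Let d22 b b' : co2 b (e2 b') = (b == b')%:R. Proof. by case: (df_dual2 hd b b'). Qed.
Let d23 b b' : co2 b (e3 b') = 0. Proof. by case: (df_dual2 hd b b'). Qed.
Let d31 b b' : co3 b (e1 b') = 0. Proof. by case: (df_dual3 hd b b'). Qed.
Let d32 b b' : co3 b (e2 b') = 0. Proof. by case: (df_dual3 hd b b'). Qed.
Let d33 b b' : co3 b (e3 b') = (b == b')%:R. Proof. by case: (df_dual3 hd b b'). Qed.
Let dE := (d11, d12, d13, d21, d22, d23, d31, d32, d33).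

Let cZ1 b a u : co1 b (a *: u) = a * co1 b u. Proof. by case: (co1E ad b). Qed.
Let cZ2 b a u : co2 b (a *: u) = a * co2 b u. Proof. by case: (co1E ad2 b). Qed.
Let cZ3 b a u : co3 b (a *: u) = a * co3 b u. Proof. by case: (co1E ad3 b). Qed.
Let cZE := (cZ1, cZ2, cZ3).

Let E1 b : D (e1 b) = l1 b *: e1 b. Proof. by case: (ad_eig ad b). Qed.
Let E2 b : D (e2 b) = l2 b *: e2 b. Proof. by case: (ad_eig ad b). Qed.
Let E3 b : D (e3 b) = l3 b *: e3 b. Proof. by case: (ad_eig ad b). Qed.
Let EE := (E1, E2, E3).

Let n1 b : l1 b != 0. Proof. by case: (ad_lam ad b). Qed.
Let n2 b : l2 b != 0. Proof. by case: (ad_lam ad b). Qed.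
Let n3 b : l3 b != 0. Proof. by case: (ad_lam ad b). Qed.

Let pre (c : bool -> V -> R) (b b' : bool) p :=
  if b (+) b' then - c true p else if b then - c false p else c false p.
Let pim (c : bool -> V -> R) (b b' : bool) p :=
  if b (+) b' then c false p else if b then - c true p else c true p.

Let vre23 p b b' : vol_re co1 co2 co3 p (e2 b) (e3 b') = pre co1 b b' p.
Proof. by rewrite /vol_re /alt3 !dE /pre; case: b; case: b' => /=; ring. Qed.
Let vre12 p b b' : vol_re co1 co2 co3 p (e1 b) (e2 b') = pre co3 b b' p.
Proof. by rewrite /vol_re /alt3 !dE /pre; case: b; case: b' => /=; ring. Qed.
Let vre13 p b b' : vol_re co1 co2 co3 p (e1 b) (e3 b') = - pre co2 b b' p.
Proof. by rewrite /vol_re /alt3 !dE /pre; case: b; case: b' => /=; ring. Qed.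
Let vre11 p b b' : vol_re co1 co2 co3 p (e1 b) (e1 b') = 0.
Proof. by rewrite /vol_re /alt3 !dE; ring. Qed.
Let vre22 p b b' : vol_re co1 co2 co3 p (e2 b) (e2 b') = 0.
Proof. by rewrite /vol_re /alt3 !dE; ring. Qed.
Let vim23 p b b' : vol_im co1 co2 co3 p (e2 b) (e3 b') = pim co1 b b' p.
Proof. by rewrite /vol_im /alt3 !dE /pim; case: b; case: b' => /=; ring. Qed.
Let vim12 p b b' : vol_im co1 co2 co3 p (e1 b) (e2 b') = pim co3 b b' p.
Proof. by rewrite /vol_im /alt3 !dE /pim; case: b; case: b' => /=; ring. Qed.
Let vim13 p b b' : vol_im co1 co2 co3 p (e1 b) (e3 b') = - pim co2 b b' p.
Proof. by rewrite /vol_im /alt3 !dE /pim; case: b; case: b' => /=; ring. Qed.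
Let vim11 p b b' : vol_im co1 co2 co3 p (e1 b) (e1 b') = 0.
Proof. by rewrite /vol_im /alt3 !dE; ring. Qed.
Let vim22 p b b' : vol_im co1 co2 co3 p (e2 b) (e2 b') = 0.
Proof. by rewrite /vol_im /alt3 !dE; ring. Qed.
Let vE := (vre23, vre12, vre13, vre11, vre22, vim23, vim12, vim13, vim11, vim22).

Lemma struct_omega b1 b2 b3 :
  struct_coef br co1 e2 e3 b1 b2 b3 + struct_coef br co2 e3 e1 b2 b3 b1 +
  struct_coef br co3 e1 e2 b3 b1 b2 =
  - phase_re C S b1 b2 b3 * (l1 b1 + l2 b2 + l3 b3 + 3 * m).
Proof.
have := te_omega (ad_torsion ad) (e1 b1) (e2 b2) (e3 b3).
rewrite !EE !vE /pre /pim /omega2 !cZE !dE /struct_coef (brC ad (e1 b1) (e3 b3)).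
have [_ _ cN _] := co1E ad2 (~~ b2); rewrite cN.
by case: b1 {cN}; case: b2; case: b3 => /=; rewrite /bsign; lra.
Qed.

(** This is [te_psim] on x_1, y_1, x_2, y_2, where half of omega /\ omega is 1 and D contributes its
    trace on the two planes. *)
Lemma struct_psi :
  sumb3 (fun b1 b2 b3 => phase_im C S b1 b2 b3 * struct_coef br co3 e1 e2 b1 b2 b3) = 0
  /\ sumb3 (fun b1 b2 b3 => phase_re C S b1 b2 b3 * struct_coef br co3 e1 e2 b1 b2 b3) =
  - (sumb l1 + sumb l2 + 4 * m).
Proof.
have [] : diff3 br (vol_re co1 co2 co3) (e1 false) (e1 true) (e2 false) (e2 true) =
    S * (sumb l1 + sumb l2 + 4 * m) /\
  diff3 br (vol_im co1 co2 co3) (e1 false) (e1 true) (e2 false) (e2 true) =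
    C * (sumb l1 + sumb l2 + 4 * m).
  apply: (diff3_phase ad).
  have := te_psim (ad_torsion ad) (e1 false) (e1 true) (e2 false) (e2 true).
  by rewrite /= !EE /wedge_sq /omega2 !cZE !dE /sumb /=; lra.
rewrite /diff3 !vE /pre /pim /= !(oppr0, add0r, addr0, subr0).
move=> X Y; have p := ad_phase ad.
rewrite /sumb3 /sumb /struct_coef /bsign /phase_re /phase_im /=.
(* The goals follow linearly from these multiples, which supply the relation C^2 + S^2 = 1. *)
have X1 := congr1 ( *%R C) X; have X2 := congr1 ( *%R S) X.
have Y1 := congr1 ( *%R C) Y; have Y2 := congr1 ( *%R S) Y.
have p1 := congr1 (fun x => x * (sumb l1 + sumb l2 + 4 * m)) p.
move: X1 X2 Y1 Y2 p1; rewrite /sumb => *; split; lra.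
Qed.

Lemma br11_eq0 : br (e1 false) (e1 true) = 0.
Proof.
rewrite (df_expand hd (br _ _)) !(co1_br11 ad) !(co2_br11 ad) !(co3_br11 ad).
by rewrite !scale0r !addr0.
Qed.

Lemma br12_expand b1 b2 : let p := br (e1 b1) (e2 b2) in
  p = co3 false p *: e3 false + co3 true p *: e3 true.
Proof.
move=> p; have [h1 h2] := br_planes false b1 b2 ad.
have [h3 h4] := br_planes true b1 b2 ad.
by rewrite {1}(df_expand hd p) /p h1 h2 h3 h4 !scale0r !addr0 add0r.
Qed.

End StructureEquationsInFrame.

(** Brackets with x_1 and with y_1 commute; each half applies this to a frame vector and reads the
    component along its partner in the same plane. *)
Lemma struct_jacobi br D C S m e1 e2 e3 co1 co2 co3 (l1 l2 l3 : bool -> R) :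
  adapted (V := V) br D C S m e1 e2 e3 co1 co2 co3 l1 l2 l3 ->
  jacobi_pair (struct_coef br co2 e3 e1) (struct_coef br co3 e1 e2).
Proof.
move=> ad; have ad2 := adapted_rot ad; have ad3 := adapted_rot ad2.
have b11 := br11_eq0 ad.
have jac z : br (e1 false) (br (e1 true) z) = br (e1 true) (br (e1 false) z).
  have := lie_jacobi (ad_lie ad) (e1 false) (e1 true) z.
  rewrite b11 (br0r ad) addr0 (brC ad (e1 false) z).
  by rewrite -scaleN1r (brZr ad) scaleN1r => /eqP; rewrite subr_eq0 => /eqP.
have cD2 b u v : co2 b (u + v) = co2 b u + co2 b v by case: (co1E ad2 b).
have cZ2 b a u : co2 b (a *: u) = a * co2 b u by case: (co1E ad2 b).
have cN2 b u : co2 b (- u) = - co2 b u by case: (co1E ad2 b).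
have cD3 b u v : co3 b (u + v) = co3 b u + co3 b v by case: (co1E ad3 b).
have cZ3 b a u : co3 b (a *: u) = a * co3 b u by case: (co1E ad3 b).
have cN3 b u : co3 b (- u) = - co3 b u by case: (co1E ad3 b).
split=> b; rewrite /sumb /struct_coef /bsign.
  have j := congr1 (co2 (~~ b)) (jac (e2 b)).
  rewrite (br12_expand ad false b) (br12_expand ad true b) in j.
  rewrite !(brDr ad) !(brZr ad) !(brC ad (e3 _) (e1 _)) !cD2 !cZ2 !cN2 in j.
  by move: j; case: (b) => /=; lra.
have j := congr1 (co3 (~~ b)) (jac (e3 b)).
rewrite !(brC ad (e3 b) (e1 _)) (br12_expand ad3 b false) (br12_expand ad3 b true) in j.
rewrite -!scaleN1r !(brZr ad) !(brDr ad) !(brZr ad) !(cZ3, cD3) in j.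
by move: j; case: (b) => /=; lra.
Qed.

(** Dividing D and the bracket by - m reduces to m = -1. *)
Lemma adapted_system br D C S m e1 e2 e3 co1 co2 co3 (l1 l2 l3 : bool -> R) :
  adapted (V := V) br D C S m e1 e2 e3 co1 co2 co3 l1 l2 l3 -> m != 0 ->
  let c := - m^-1 in
  torsion_system C S (fun b => c * l1 b) (fun b => c * l2 b) (fun b => c * l3 b)
    (fun b1 b2 b3 => c * struct_coef br co1 e2 e3 b1 b2 b3)
    (fun b1 b2 b3 => c * struct_coef br co2 e3 e1 b1 b2 b3)
    (fun b1 b2 b3 => c * struct_coef br co3 e1 e2 b1 b2 b3).
Proof.
move=> ad m0 c; have ad2 := adapted_rot ad; have ad3 := adapted_rot ad2.
have c0 : c != 0 by rewrite oppr_eq0 invr_eq0.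
have cm : c * m = -1 by rewrite mulNr mulVf.
have sc (F : bool -> bool -> bool -> R) G : sumb3 (fun b1 b2 b3 => G b1 b2 b3 * (c * F b1 b2 b3))
    = c * sumb3 (fun b1 b2 b3 => G b1 b2 b3 * F b1 b2 b3).
  by rewrite /sumb3 /sumb; ring.
have sl (l : bool -> R) : sumb (fun b => c * l b) = c * sumb l by rewrite /sumb; ring.
have [i3 r3] := struct_psi ad; have [i1 r1] := struct_psi ad2.
have [i2 r2] := struct_psi ad3.
split.
- exact: ad_phase ad.
- by move=> b; have [h1 h2 h3] := ad_lam ad b; rewrite !mulf_neq0.
- move=> b1 b2 b3; rewrite -!mulrDr (struct_omega ad).
  apply/eqP; rewrite -subr_eq0; apply/eqP.
  transitivity (- phase_re C S b1 b2 b3 * 3 * (c * m + 1)); first by ring.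
  by rewrite cm addNr mulr0.
- by rewrite !sc i1 i2 i3 mulr0.
- rewrite !sc r1 r2 r3 !sl; split.
  (* The constant 4 becomes - 4 c m, which makes both sides multiples of c. *)
  + rewrite -[X in X - _]mulr1 -[X in X - _](opprK) -mulrN -cm; ring.
  + rewrite -[X in X - _]mulr1 -[X in X - _](opprK) -mulrN -cm; ring.
  + rewrite -[X in X - _]mulr1 -[X in X - _](opprK) -mulrN -cm; ring.
- have W br' D' C' S' m' f1 f2 f3 k1 k2 k3 (a1 a2 a3 : bool -> R) :
      adapted (V := V) br' D' C' S' m' f1 f2 f3 k1 k2 k3 a1 a2 a3 ->
      weighted (fun b => c * a1 b) (fun b => c * a2 b) (fun b => c * a3 b)
        (fun b1 b2 b3 => c * struct_coef br' k1 f2 f3 b1 b2 b3).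
    move=> a b1 b2 b3; have [_ Ef _] := ad_eig a b2; have [_ _ Eg] := ad_eig a b3.
    have := co1_weight a (~~ b1) Ef Eg; rewrite /struct_coef sl /sumb => h.
    rewrite -(mulr0 (c ^+ 2 * bsign R b1)) -h.
    by case: (b1) => /=; ring.
  by split; [exact: W ad|exact: W ad2|exact: W ad3].
- have J (g g' : bool -> bool -> bool -> R) : jacobi_pair g g' ->
      jacobi_pair (fun b1 b2 b3 => c * g b1 b2 b3) (fun b1 b2 b3 => c * g' b1 b2 b3).
    case=> j1 j2; split=> b.
      by rewrite -(mulr0 (c ^+ 2)) -(j1 b) /sumb; ring.
    by rewrite -(mulr0 (c ^+ 2)) -(j2 b) /sumb; ring.
  by split; apply: J; [exact: struct_jacobi ad3|exact: struct_jacobi ad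
    |exact: struct_jacobi ad2].
Qed.

End StructureCoefficients.

(** * Removing the phase *)

Section Rotation.
Variables (R : realFieldType) (V : vectType R).

(** Replacing z_1 by zeta z_1 absorbs the phase. The rotated vectors are still eigenvectors of D:
    for S = 0 they change by a sign, for C = 0 they are exchanged up to sign, and otherwise D is
    scalar on P_1. *)
Lemma adapted_normalize br D C S m e1 e2 e3 co1 co2 co3 (l1 l2 l3 : bool -> R) :
  adapted (V := V) br D C S m e1 e2 e3 co1 co2 co3 l1 l2 l3 ->
  C * S = 0 \/ l1 false = l1 true ->
  exists e1' co1' l1', adapted (V := V) br D 1 0 m e1' e2 e3 co1' co2 co3 l1' l2 l3.
Proof.
move=> ad hl.
pose e1' (b : bool) := if b then S *: e1 false + C *: e1 true
                       else C *: e1 false - S *: e1 true.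
pose co1' (b : bool) u := if b then S * co1 false u + C * co1 true u
                       else C * co1 false u - S * co1 true u.
pose l1' b := if S == 0 then l1 b else l1 (~~ b).
have p := ad_phase ad.
have cD b u v : co1 b (u + v) = co1 b u + co1 b v by case: (co1E ad b).
have cZ b a u : co1 b (a *: u) = a * co1 b u by case: (co1E ad b).
have cN b u : co1 b (- u) = - co1 b u by case: (co1E ad b).
have dE1 b b' : co1 b (e1 b') = (b == b')%:R by case: (df_dual1 (ad_dual ad) b b').
exists e1', co1', l1'; case: ad => hd hlie hder hlin he hlam _ ht.
have omE : omega2 co1' co2 co3 = omega2 co1 co2 co3.
  apply/funext => u; apply/funext => v; rewrite /omega2 /co1'; congr (_ + _ + _).
  by rewrite -[RHS]mul1r -p; ring.
have reE : (fun u v w => 1 * vol_re co1' co2 co3 u v w - 0 * vol_im co1' co2 co3 u v w) =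
   (fun u v w => C * vol_re co1 co2 co3 u v w - S * vol_im co1 co2 co3 u v w).
  apply/funext => u; apply/funext => v; apply/funext => w.
  by rewrite /vol_re /vol_im /alt3 /co1'; ring.
have imE : (fun u v w => 0 * vol_re co1' co2 co3 u v w + 1 * vol_im co1' co2 co3 u v w) =
   (fun u v w => S * vol_re co1 co2 co3 u v w + C * vol_im co1 co2 co3 u v w).
  apply/funext => u; apply/funext => v; apply/funext => w.
  by rewrite /vol_re /vol_im /alt3 /co1'; ring.
split=> //.
- case: hd => dl d1 d2 d3 dx; split.
  + move=> b; have [h1 h2 h3] := dl b; split=> // a u v.
    by rewrite /co1' !cD !cZ; case: (b); ring.
  + move=> b b'; have [_ h2 h3] := d1 false b'; have [_ h2' h3'] := d1 true b'.
    split; rewrite /co1' ?h2 ?h3 ?h2' ?h3'; try by case: (b); ring.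
    by case: b; case: b' {h2 h3 h2' h3'} => /=; rewrite !(cD, cN, cZ, dE1) /=; move: p; lra.
  + move=> b b'; have [h1 h2 h3] := d2 b false; have [h1' _ _] := d2 b true.
    have [_ h2' h3'] := d2 b b'; split=> //.
    have [c2D c2Z c2N _] := scalarE (let: And3 _ h _ := dl b in h).
    by rewrite /e1'; case: (b'); rewrite !(c2D, c2N, c2Z) h1 h1'; ring.
  + move=> b b'; have [h1 h2 h3] := d3 b false; have [h1' _ _] := d3 b true.
    have [_ h2' h3'] := d3 b b'; split=> //.
    have [c3D c3Z c3N _] := scalarE (let: And3 _ _ h := dl b in h).
    by rewrite /e1'; case: (b'); rewrite !(c3D, c3N, c3Z) h1 h1'; ring.
  + move=> u; rewrite {1}(dx u); congr (_ + _ + _); rewrite /co1' /e1'.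
    rewrite scalerBr scalerDr !scalerA -scaleNr addrACA -!scalerDl.
    by congr (_ *: _ + _ *: _); rewrite -[LHS]mul1r -p; ring.
- have DD u v : D (u + v) = D u + D v by have := hlin 1 u v; rewrite !scale1r.
  have D0 : D 0 = 0 by have := hlin (-1) 0 0; rewrite scaler0 addr0 scaleN1r addNr.
  have DZ a u : D (a *: u) = a *: D u by have := hlin a u 0; rewrite D0 !addr0.
  have [Ef _ _] := he false; have [Et _ _] := he true.
  move=> b; have [_ h2 h3] := he b; split=> //; rewrite /e1' /l1'.
  have [S0|S0] := eqVneq S 0.
    by rewrite S0 !scale0r subr0 add0r; case: (b); rewrite DZ ?Ef ?Et !scalerA mulrC.
  have [C0|le] : C = 0 \/ l1 false = l1 true.
    by case: hl => [/eqP|]; [rewrite mulf_eq0 (negbTE S0) orbF => /eqP|]; [left|right].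
    by rewrite C0 !scale0r sub0r addr0 -scaleNr; case: (b); rewrite DZ ?Ef ?Et !scalerA mulrC.
  rewrite -scaleNr; case: (b); rewrite DD !DZ Ef Et /= scalerDr !scalerA -?le;
    by congr (_ *: _ + _ *: _); rewrite mulrC.
- by move=> b; have [? ? ?] := hlam b; split=> //; rewrite /l1'; case: ifP => _; case: (hlam (~~ b)).
- by rewrite expr1n expr0n addr0.
- by rewrite omE reE imE.
Qed.

End Rotation.

Section Isomorphism.
Variables (R : realType) (V : vectType R).

Lemma e2_E i j (x y : 'rV[R]_6) :
  e2_ i j (fun l => if l == ord0 then x else y) =
  x 0 (idx i) * y 0 (idx j) - y 0 (idx i) * x 0 (idx j).
Proof.
rewrite (_ : (fun l => _) = argv [:: x; y]); first by rewrite /e2_ /e_ wedge11E.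
by apply/funext => -[[|[|?]] ?].
Qed.

(** The y's are the coordinates of the isomorphism and the x's only witness that they are
    independent, so duality up to non-zero factors suffices and covectors can be rescaled freely. *)
Lemma isomorphic_intro (br : V -> V -> V) (b : 6.-tuple (form R 'rV[R]_6 2))
    (x : 'I_6 -> V) (y : 'I_6 -> V -> R) :
  \dim {:V} = 6%N -> (forall i, scalar (y i)) ->
  (forall i j, (y i (x j) == 0) = (i != j)) ->
  (forall u v i, y i (br u v) = - tnth b i (fun l =>
     if l == ord0 then \row_k y k u else \row_k y k v)) ->
  lie_isomorphic br (tuple_bracket b).
Proof.
move=> V6 ys yx ybr.
have F_lin : linear (fun u => \row_k y k u : 'rV[R]_6).
  by move=> a u v; apply/rowP => k; rewrite !mxE ys.
pose F : {linear V -> 'rV[R]_6} := HB.pack (fun u => \row_k y k u : 'rV[R]_6)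
  (GRing.isLinear.Build _ _ _ _ _ F_lin).
have FE u k : F u 0 k = y k u by rewrite mxE.
pose G (r : 'rV[R]_6) := \sum_j (r 0 j / y j (x j)) *: x j.
have yxn j : y j (x j) != 0 by rewrite yx eqxx.
have ysum (r : 'I_6 -> R) i : y i (\sum_j r j *: x j) = r i * y i (x i).
  have [yD yZ _ y0] := scalarE (ys i).
  rewrite (big_morph _ yD y0) (bigD1 i) //= big1 ?addr0 ?yZ // => j ji.
  by rewrite yZ; have := yx i j; rewrite [i == j]eq_sym ji => /eqP ->; rewrite mulr0.
have FG : cancel G F.
  by move=> r; apply/rowP => k; rewrite FE ysum divfK.
have F_inj : injective F.
  pose X := [tuple x i | i < 6].
  have Xi (i : 'I_6) : X`_i = x i by rewrite -tnth_nth tnth_mktuple.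
  have Xf : free X.
    apply/freeP => k; under eq_bigr do rewrite Xi.
    move=> k0 i; have := congr1 (y i) k0; have [_ _ _ ->] := scalarE (ys i).
    by rewrite ysum => /eqP; rewrite mulf_eq0 (negbTE (yxn i)) orbF => /eqP.
  have Xb : basis_of fullv X by rewrite basisEfree Xf subvf V6 size_tuple.
  have eu u : u = \sum_i coord X i u *: x i.
    by rewrite {1}(coord_basis Xb (memvf u)); apply: eq_bigr => i _; rewrite Xi.
  move=> u v; rewrite (eu u) (eu v).
  move=> e; apply: eq_bigr => i _; congr (_ *: _).
  have := congr1 (fun r : 'rV_6 => r 0 i) e; rewrite /= !FE.
  by move=> e'; apply: (mulIf (yxn i)); move: e'; rewrite !ysum.
exists F; first by exists G => //; apply: (inj_can_sym FG).
by move=> u v; apply/rowP => i; rewrite FE ybr mxE.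
Qed.

End Isomorphism.

(** * Identification of the Lie algebras *)

Lemma idxK k : (k.-1 < 6)%N -> nat_of_ord (idx k) = k.-1.
Proof. by move=> k6; rewrite inordK. Qed.

Section PlanarIso.
Variables (R : realType) (V : vectType R) (br : V -> V -> V).
Variables (e1 e2 e3 : bool -> V) (co1 co2 co3 : bool -> V -> R).
Hypothesis V6 : \dim {:V} = 6%N.
Hypothesis hd : dual_frame e1 e2 e3 co1 co2 co3.

Let d11 b b' : co1 b (e1 b') = (b == b')%:R. Proof. by case: (df_dual1 hd b b'). Qed.
Let d12 b b' : co1 b (e2 b') = 0. Proof. by case: (df_dual1 hd b b'). Qed.
Let d13 b b' : co1 b (e3 b') = 0. Proof. by case: (df_dual1 hd b b'). Qed.
Let d21 b b' : co2 b (e1 b') = 0. Proof. by case: (df_dual2 hd b b'). Qed.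
Let d22 b b' : co2 b (e2 b') = (b == b')%:R. Proof. by case: (df_dual2 hd b b'). Qed.
Let d23 b b' : co2 b (e3 b') = 0. Proof. by case: (df_dual2 hd b b'). Qed.
Let d31 b b' : co3 b (e1 b') = 0. Proof. by case: (df_dual3 hd b b'). Qed.
Let d32 b b' : co3 b (e2 b') = 0. Proof. by case: (df_dual3 hd b b'). Qed.
Let d33 b b' : co3 b (e3 b') = (b == b')%:R. Proof. by case: (df_dual3 hd b b'). Qed.
Let dE := (d11, d12, d13, d21, d22, d23, d31, d32, d33).

Let l1 b : scalar (co1 b). Proof. by case: (df_lin hd b). Qed.
Let l2 b : scalar (co2 b). Proof. by case: (df_lin hd b). Qed.
Let l3 b : scalar (co3 b). Proof. by case: (df_lin hd b). Qed.

Lemma scalar_scale (s : R) (c : V -> R) : scalar c -> scalar (fun u => s * c u).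
Proof. by move=> hc a u v; rewrite hc mulrDr mulrCA. Qed.

(* Both families are listed in the order of the basis e^1, .., e^6. *)
Lemma isomorphic_list (x : seq V) (y : seq (V -> R)) b1 b2 b3 b4 b5 b6 :
  (forall i : 'I_6, scalar (nth (fun _ => 0) y i)) ->
  (forall i j : 'I_6, (nth (fun _ => 0) y i x`_j == 0) = (i != j)) ->
  (forall u v (i : 'I_6), nth (fun _ => 0) y i (br u v) = - nth 0 [:: b1; b2; b3; b4; b5; b6] i (fun l =>
     if l == ord0 then \row_(k < 6) nth (fun _ => 0) y k u else \row_(k < 6) nth (fun _ => 0) y k v)) ->
  isomorphic_to br b1 b2 b3 b4 b5 b6.
Proof.
move=> ys yx ybr; apply: (isomorphic_intro V6 ys (x := fun j => x`_j)) => //.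
by move=> u v i; rewrite ybr (tnth_nth 0).
Qed.

Let w (b1 b2 : bool) u v := co1 b1 u * co2 b2 v - co1 b1 v * co2 b2 u.

Ltac iso_scalar :=
  by case=> -[|[|[|[|[|[|?]]]]]] ? //=; first [exact: scalar_scale|apply: scalar_scale].
Ltac iso_dual b1 b2 b3 nz :=
  case=> -[|[|[|[|[|[|?]]]]]] ? //; case=> -[|[|[|[|[|[|?]]]]]] ? //=;
  rewrite !dE; try by [rewrite ?(mulr0, eqxx)];
  case: b1; case: b2; case: b3;
  rewrite /= ?(mulr0, mulr1, mulf_eq0, oppr_eq0, invr_eq0) ?nz ?eqxx ?oner_eq0 //.
Ltac iso_br brs zs := move=> u v; case=> -[|[|[|[|[|[|?]]]]]] ? //=;
  rewrite ?fctE ?e2_E ?mxE ?idxK //= ?brs /w ?zs ?mul0r ?mulr0 ?oppr0 //;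
  try field.

(** * Algebras with all brackets in one plane *)

Section One.
Variables (b1 b2 b3 : bool) (al be ga de : R).
Hypothesis br1 : forall b u v, co1 b (br u v) = 0.
Hypothesis br2 : forall b u v, co2 b (br u v) = 0.
Hypothesis br3N : forall u v, co3 (~~ b3) (br u v) =
  al * w b1 b2 u v + be * w (~~ b1) (~~ b2) u v.
Hypothesis br3 : forall u v, co3 b3 (br u v) =
  ga * w b1 (~~ b2) u v + de * w (~~ b1) b2 u v.

Lemma iso_h3 : al != 0 -> be = 0 -> ga = 0 -> de = 0 ->
  isomorphic_to br 0 0 0 0 0 (e2_ 1 2).
Proof.
move=> a0 b0 g0 d0.
apply: (@isomorphic_list
 [:: e1 b1; e2 b2; e1 (~~ b1); e2 (~~ b2); e3 b3; e3 (~~ b3)]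
 [:: co1 b1; co2 b2; co1 (~~ b1); co2 (~~ b2); co3 b3; fun u => - al^-1 * co3 (~~ b3) u]).
- by iso_scalar.
- by iso_dual (b1) (b2) (b3) (negbTE a0).
- by iso_br (br1, br2, br3N, br3) (b0, g0, d0).
Qed.

Lemma iso_h5 : al != 0 -> be != 0 -> ga = 0 -> de = 0 ->
  isomorphic_to br 0 0 0 0 0 (e2_ 1 2 + e2_ 3 4).
Proof.
move=> a0 b0 g0 d0.
apply: (@isomorphic_list
 [:: e1 b1; e2 b2; e1 (~~ b1); e2 (~~ b2); e3 b3; e3 (~~ b3)]
 [:: co1 b1; co2 b2; co1 (~~ b1); (fun u => be / al * co2 (~~ b2) u); co3 b3;
     fun u => - al^-1 * co3 (~~ b3) u]).
- by iso_scalar.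
- by iso_dual (b1) (b2) (b3) (negbTE a0, negbTE b0).
- by iso_br (br1, br2, br3N, br3) (g0, d0).
Qed.

Lemma iso_n12_13l : al != 0 -> be = 0 -> ga != 0 -> de = 0 ->
  isomorphic_to br 0 0 0 0 (e2_ 1 2) (e2_ 1 3).
Proof.
move=> a0 b0 g0 d0.
apply: (@isomorphic_list
 [:: e1 b1; e2 b2; e2 (~~ b2); e1 (~~ b1); e3 (~~ b3); e3 b3]
 [:: co1 b1; co2 b2; co2 (~~ b2); co1 (~~ b1); (fun u => - al^-1 * co3 (~~ b3) u);
     fun u => - ga^-1 * co3 b3 u]).
- by iso_scalar.
- by iso_dual (b1) (b2) (b3) (negbTE a0, negbTE g0).
- by iso_br (br1, br2, br3N, br3) (b0, d0).
Qed.

(** The two bracket terms share [e2 b2] here, not [e1 b1], so it takes the place of e_1. *)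
Lemma iso_n12_13r : al != 0 -> be = 0 -> ga = 0 -> de != 0 ->
  isomorphic_to br 0 0 0 0 (e2_ 1 2) (e2_ 1 3).
Proof.
move=> a0 b0 g0 d0.
apply: (@isomorphic_list
 [:: e2 b2; e1 b1; e1 (~~ b1); e2 (~~ b2); e3 (~~ b3); e3 b3]
 [:: co2 b2; co1 b1; co1 (~~ b1); co2 (~~ b2); (fun u => al^-1 * co3 (~~ b3) u);
     fun u => de^-1 * co3 b3 u]).
- by iso_scalar.
- by iso_dual (b1) (b2) (b3) (negbTE a0, negbTE d0).
- by iso_br (br1, br2, br3N, br3) (b0, g0).
Qed.

Lemma iso_n12_14_23 : al != 0 -> be = 0 -> ga != 0 -> de != 0 ->
  isomorphic_to br 0 0 0 0 (e2_ 1 2) (e2_ 1 4 + e2_ 2 3).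
Proof.
move=> a0 b0 g0 d0.
apply: (@isomorphic_list
 [:: e1 b1; e2 b2; e1 (~~ b1); e2 (~~ b2); e3 (~~ b3); e3 b3]
 (* The factor on the third covector absorbs the ratio of the two coefficients and the order of the
    factors in e^23. *)
 [:: co1 b1; co2 b2; (fun u => - (de / ga) * co1 (~~ b1) u); co2 (~~ b2);
     (fun u => - al^-1 * co3 (~~ b3) u); fun u => - ga^-1 * co3 b3 u]).
- by iso_scalar.
- by iso_dual (b1) (b2) (b3) (negbTE a0, negbTE g0, negbTE d0).
- by iso_br (br1, br2, br3N, br3) b0.
Qed.

Lemma iso_complex_heisenberg : al != 0 -> be = - al -> ga = al -> de = al ->
  isomorphic_to br 0 0 0 0 (e2_ 1 3 + e2_ 4 2) (e2_ 1 2 + e2_ 3 4).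
Proof.
move=> a0 b0 g0 d0.
apply: (@isomorphic_list
 [:: e1 b1; e2 b2; e2 (~~ b2); e1 (~~ b1); e3 b3; e3 (~~ b3)]
 [:: co1 b1; co2 b2; co2 (~~ b2); co1 (~~ b1);
     (fun u => - al^-1 * co3 b3 u); fun u => - al^-1 * co3 (~~ b3) u]).
- by iso_scalar.
- by iso_dual (b1) (b2) (b3) (negbTE a0).
- by iso_br (br1, br2, br3N, br3) (b0, g0, d0).
Qed.

Lemma iso_abelian : al = 0 -> be = 0 -> ga = 0 -> de = 0 ->
  isomorphic_to br 0 0 0 0 0 0.
Proof.
move=> a0 b0 g0 d0.
apply: (@isomorphic_list
 [:: e1 b1; e2 b2; e2 (~~ b2); e1 (~~ b1); e3 b3; e3 (~~ b3)]
 [:: co1 b1; co2 b2; co2 (~~ b2); co1 (~~ b1); co3 b3; co3 (~~ b3)]).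
- by iso_scalar.
- by iso_dual (b1) (b2) (b3) (@eqxx R).
- by iso_br (br1, br2, br3N, br3) (a0, b0, g0, d0).
Qed.

End One.

(** * Algebras supported on one sign triple *)

Section Single.
Variables (b1 b2 b3 : bool) (c1 c2 c3 : R).
Hypothesis brs1 : forall u v, co1 b1 (br u v) = 0 /\ co1 (~~ b1) (br u v) = c1 * (co2 b2 u * co3 b3 v - co2 b2 v * co3 b3 u).
Hypothesis brs2 : forall u v, co2 b2 (br u v) = 0 /\ co2 (~~ b2) (br u v) = c2 * (co3 b3 u * co1 b1 v - co3 b3 v * co1 b1 u).
Hypothesis brs3 : forall u v, co3 b3 (br u v) = 0 /\ co3 (~~ b3) (br u v) = c3 * w b1 b2 u v.

Let s1 u v : co1 b1 (br u v) = 0. Proof. by case: (brs1 u v). Qed.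
Let s1' u v : co1 (~~ b1) (br u v) = c1 * (co2 b2 u * co3 b3 v - co2 b2 v * co3 b3 u). Proof. by case: (brs1 u v). Qed.
Let s2 u v : co2 b2 (br u v) = 0. Proof. by case: (brs2 u v). Qed.
Let s2' u v : co2 (~~ b2) (br u v) = c2 * (co3 b3 u * co1 b1 v - co3 b3 v * co1 b1 u). Proof. by case: (brs2 u v). Qed.
Let s3 u v : co3 b3 (br u v) = 0. Proof. by case: (brs3 u v). Qed.
Let s3' u v : co3 (~~ b3) (br u v) = c3 * w b1 b2 u v. Proof. by case: (brs3 u v). Qed.
Let sE := (s1, s1', s2, s2', s3, s3').

Lemma iso_free : c1 != 0 -> c2 != 0 -> c3 != 0 ->
  isomorphic_to br 0 0 0 (e2_ 1 2) (e2_ 1 3) (e2_ 2 3).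
Proof.
move=> n1 n2 n3.
apply: (@isomorphic_list
 [:: e1 b1; e2 b2; e3 b3; e3 (~~ b3); e2 (~~ b2); e1 (~~ b1)]
 [:: co1 b1; co2 b2; co3 b3; (fun u => - c3^-1 * co3 (~~ b3) u);
     (fun u => c2^-1 * co2 (~~ b2) u); fun u => - c1^-1 * co1 (~~ b1) u]).
- by iso_scalar.
- by iso_dual (b1) (b2) (b3) (negbTE n1, negbTE n2, negbTE n3).
- by iso_br sE (@eqxx R).
Qed.

Lemma iso_two : c1 != 0 -> c2 != 0 -> c3 = 0 ->
  isomorphic_to br 0 0 0 0 (e2_ 1 2) (e2_ 1 3).
Proof.
move=> n1 n2 n3.
apply: (@isomorphic_list
 [:: e3 b3; e2 b2; e1 b1; e3 (~~ b3); e1 (~~ b1); e2 (~~ b2)]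
 [:: co3 b3; co2 b2; co1 b1; co3 (~~ b3); (fun u => c1^-1 * co1 (~~ b1) u);
     fun u => - c2^-1 * co2 (~~ b2) u]).
- by iso_scalar.
- by iso_dual (b1) (b2) (b3) (negbTE n1, negbTE n2).
- by iso_br sE n3.
Qed.

End Single.
End PlanarIso.

(** * From the structure coefficients to the list *)

Section Forward.
Variables (R : realType) (V : vectType R).
Hypothesis V6 : \dim {:V} = 6%N.

Definition listed (br : V -> V -> V) : Prop :=
  isomorphic_to br 0 0 0 (e2_ 1 2) (e2_ 1 3) (e2_ 2 3)
   \/ isomorphic_to br 0 0 0 0 (e2_ 1 2) (e2_ 1 3)
   \/ isomorphic_to br 0 0 0 0 (e2_ 1 2) (e2_ 1 4 + e2_ 2 3)
   \/ isomorphic_to br 0 0 0 0 0 (e2_ 1 2 + e2_ 3 4)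
   \/ isomorphic_to br 0 0 0 0 (e2_ 1 3 + e2_ 4 2) (e2_ 1 2 + e2_ 3 4)
   \/ isomorphic_to br 0 0 0 0 0 (e2_ 1 2)
   \/ isomorphic_to br 0 0 0 0 0 0.

(** The positions of the non-zero coefficients decide: none gives the abelian algebra, one gives
    e^12, two give e^12 + e^34 when they have the same target and otherwise (e^12, e^13), three give
    (e^12, e^14 + e^23), four the complex Heisenberg algebra. Flipping the signs in P_1 and P_2 or
    exchanging the vectors of P_3 reduces the 16 patterns to these models. *)
Lemma planar_listed br e1 e2 e3 co1 co2 co3 (k a b c d : R) :
  dual_frame e1 e2 e3 co1 co2 co3 ->
  let w b1 b2 u v := co1 b1 u * co2 b2 v - co1 b1 v * co2 b2 u in
  (forall b u v, co1 b (br u v) = 0) -> (forall b u v, co2 b (br u v) = 0) ->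
  (forall u v, co3 true (br u v) = a * w false false u v + d * w true true u v) ->
  (forall u v, co3 false (br u v) = b * w false true u v + c * w true false u v) ->
  k != 0 -> a = 0 \/ a = k -> b = 0 \/ b = k -> c = 0 \/ c = k -> d = 0 \/ d = - k ->
  listed br.
Proof.
move=> hd w br1 br2 br3t br3f k0 ha hb hc hd'.
have br3t' u v : co3 true (br u v) = d * w true true u v + a * w false false u v.
  by rewrite br3t addrC.
have br3f' u v : co3 false (br u v) = c * w true false u v + b * w false true u v.
  by rewrite br3f addrC.
have h3 x1 x2 x3 al be ga de := @iso_h3 R V br e1 e2 e3 co1 co2 co3 V6 hd x1 x2 x3 al be ga de br1 br2.
have h5 x1 x2 x3 al be ga de := @iso_h5 R V br e1 e2 e3 co1 co2 co3 V6 hd x1 x2 x3 al be ga de br1 br2.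
have n2l x1 x2 x3 al be ga de := @iso_n12_13l R V br e1 e2 e3 co1 co2 co3 V6 hd x1 x2 x3 al be ga de br1 br2.
have n2r x1 x2 x3 al be ga de := @iso_n12_13r R V br e1 e2 e3 co1 co2 co3 V6 hd x1 x2 x3 al be ga de br1 br2.
have n23 x1 x2 x3 al be ga de := @iso_n12_14_23 R V br e1 e2 e3 co1 co2 co3 V6 hd x1 x2 x3 al be ga de br1 br2.
have cH x1 x2 x3 al be ga de := @iso_complex_heisenberg R V br e1 e2 e3 co1 co2 co3 V6 hd x1 x2 x3 al be ga de br1 br2.
have ab x1 x2 x3 al be ga de := @iso_abelian R V br e1 e2 e3 co1 co2 co3 V6 hd x1 x2 x3 al be ga de br1 br2.
have z : forall x : R, x = k -> x != 0 by move=> x ->.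
have z' : forall x : R, x = - k -> x != 0 by move=> x ->; rewrite oppr_eq0.
case: ha hb hc hd' => a0 [] b0 [] c0 [] d0.
all: first
 [ by do 6 right; apply: (ab false false false _ _ _ _ br3t br3f)
 | by do 5 right; left; first
   [ by apply: (h3 false false false _ _ _ _ br3t br3f); auto
   | by apply: (h3 true true false _ _ _ _ br3t' br3f'); auto
   | by apply: (h3 false true true _ _ _ _ br3f br3t); auto
   | by apply: (h3 true false true _ _ _ _ br3f' br3t'); auto ]
 | by do 3 right; left; first
   [ by apply: (h5 false false false _ _ _ _ br3t br3f); auto
   | by apply: (h5 false true true _ _ _ _ br3f br3t); auto ]
 | by right; left; first
   [ by apply: (n2l false false false _ _ _ _ br3t br3f); auto
   | by apply: (n2r false false false _ _ _ _ br3t br3f); auto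
   | by apply: (n2l true true false _ _ _ _ br3t' br3f'); auto
   | by apply: (n2r true true false _ _ _ _ br3t' br3f'); auto ]
 | by do 2 right; left; first
   [ by apply: (n23 false false false _ _ _ _ br3t br3f); auto
   | by apply: (n23 true true false _ _ _ _ br3t' br3f'); auto
   | by apply: (n23 false true true _ _ _ _ br3f br3t); auto
   | by apply: (n23 true false true _ _ _ _ br3f' br3t'); auto ]
 | by do 4 right; left; apply: (cH false false false _ _ _ _ br3t br3f);
   rewrite ?a0 ?b0 ?c0 ?d0 ].
Qed.

Lemma br_same_plane br D C S m e1 e2 e3 co1 co2 co3 (l1 l2 l3 : bool -> R) b b' :
  adapted (V := V) br D C S m e1 e2 e3 co1 co2 co3 l1 l2 l3 -> br (e1 b) (e1 b') = 0.
Proof.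
move=> ad; have h := br11_eq0 ad; case: b; case: b'; rewrite ?(lie_alternating (ad_lie ad)) //.
by rewrite (brC ad) h oppr0.
Qed.

Section Planes.
Variables (br : V -> V -> V) (D : V -> V) (C S m : R).
Variables (e1 e2 e3 : bool -> V) (co1 co2 co3 : bool -> V -> R).
Variables (l1 l2 l3 : bool -> R).
Hypothesis ad : adapted br D C S m e1 e2 e3 co1 co2 co3 l1 l2 l3.

Lemma br_co3 b u v : co3 b (br u v) = sumb (fun b1 => sumb (fun b2 =>
  co3 b (br (e1 b1) (e2 b2)) * (co1 b1 u * co2 b2 v - co1 b1 v * co2 b2 u))).
Proof.
have ad2 := adapted_rot ad; have ad3 := adapted_rot ad2.
have cD x y : co3 b (x + y) = co3 b x + co3 b y by case: (co1E ad3 b).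
have cZ a x : co3 b (a *: x) = a * co3 b x by case: (co1E ad3 b).
have cN x : co3 b (- x) = - co3 b x by case: (co1E ad3 b).
have c0 : co3 b 0 = 0 by case: (co1E ad3 b).
have p23 b1 b2 : co3 b (br (e2 b1) (e3 b2)) = 0 by case: (br_planes b b1 b2 ad2).
have p31 b1 b2 : co3 b (br (e3 b1) (e1 b2)) = 0 by case: (br_planes b b1 b2 ad3).
have q1 b1 b2 : br (e1 b1) (e1 b2) = 0  := br_same_plane b1 b2 ad.
have q2 b1 b2 : br (e2 b1) (e2 b2) = 0 := br_same_plane b1 b2 ad2.
have q3 b1 b2 : br (e3 b1) (e3 b2) = 0 := br_same_plane b1 b2 ad3.
have p32 b1 b2 : co3 b (br (e3 b1) (e2 b2)) = 0 by rewrite (brC ad) cN p23 oppr0.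
have p13 b1 b2 : co3 b (br (e1 b1) (e3 b2)) = 0 by rewrite (brC ad) cN p31 oppr0.
have p21 b1 b2 : co3 b (br (e2 b1) (e1 b2)) = - co3 b (br (e1 b2) (e2 b1)).
  by rewrite (brC ad) cN.
have hd := ad_dual ad.
have -> : br u v = br (
    (co1 false u *: e1 false + co1 true u *: e1 true) +
    (co2 false u *: e2 false + co2 true u *: e2 true) +
    (co3 false u *: e3 false + co3 true u *: e3 true)) (
    (co1 false v *: e1 false + co1 true v *: e1 true) +
    (co2 false v *: e2 false + co2 true v *: e2 true) +
    (co3 false v *: e3 false + co3 true v *: e3 true)).
  by congr br; apply: df_expand hd _.
rewrite !(brDl ad) !(brDr ad) !(brZl ad) !(brZr ad) !q1 !q2 !q3 !cD !cZ !c0.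
rewrite !p23 !p31 !p32 !p13 !p21 /sumb; ring.
Qed.

Lemma co3_struct b b1 b2 : co3 b (br (e1 b1) (e2 b2)) =
  bsign R b * struct_coef br co3 e1 e2 (~~ b) b1 b2.
Proof. by rewrite /struct_coef negbK; case: b => /=; ring. Qed.

End Planes.

Lemma forward_one br D C S m e1 e2 e3 co1 co2 co3 (l1 l2 l3 : bool -> R) (k : R) :
  adapted (V := V) br D C S m e1 e2 e3 co1 co2 co3 l1 l2 l3 ->
  (forall b1 b2 b3, struct_coef br co1 e2 e3 b1 b2 b3 = 0 /\
    struct_coef br co2 e3 e1 b1 b2 b3 = 0) -> k != 0 ->
  (forall b1 b2 b3, struct_coef br co3 e1 e2 b3 b1 b2 = 0 \/
    struct_coef br co3 e1 e2 b3 b1 b2 = phase_re 1 0 b1 b2 b3 * k) ->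
  listed br.
Proof.
move=> ad z k0 h; have ad2 := adapted_rot ad; have ad3 := adapted_rot ad2.
(* For phase 1 the coefficient c_M vanishes when M contains an odd number of y's. *)
have odd b1 b2 : struct_coef br co3 e1 e2 (~~ (b1 (+) b2)) b1 b2 = 0.
  by have := h b1 b2 (~~ (b1 (+) b2)); case: b1; case: b2 => /= -[->|->]; ring.
pose s := struct_coef br co3 e1 e2.
apply: (@planar_listed br e1 e2 e3 co1 co2 co3 k (s false false false)
  (- s true false true) (- s true true false) (s false true true)) => //.
- exact: ad_dual ad.
- move=> b u v; rewrite (br_co3 ad2) /sumb !(co3_struct br) !(z _ _ _).1; ring.
- move=> b u v; rewrite (br_co3 ad3) /sumb !(co3_struct br) !(z _ _ _).2; ring.
- move=> u v; rewrite (br_co3 ad) /sumb !(co3_struct br) /=.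
  by rewrite (odd false true) (odd true false) /s; ring.
- move=> u v; rewrite (br_co3 ad) /sumb !(co3_struct br) /=.
  by rewrite (odd false false) (odd true true) /s; ring.
- by case: (h false false false) => e; [left|right]; rewrite /s e //=; ring.
- by case: (h false true true) => e; [left|right]; rewrite /s e //=; ring.
- by case: (h true false true) => e; [left|right]; rewrite /s e //=; ring.
- by case: (h true true false) => e; [left|right]; rewrite /s e //=; ring.
Qed.

Lemma forward_many br D C S m e1 e2 e3 co1 co2 co3 (l1 l2 l3 : bool -> R)
    (b1 b2 b3 : bool) (c1 c2 c3 : R) :
  adapted (V := V) br D C S m e1 e2 e3 co1 co2 co3 l1 l2 l3 ->
  c1 != 0 -> c2 != 0 ->
  support_at (b1, b2, b3) c1 (struct_coef br co1 e2 e3) ->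
  support_at (b2, b3, b1) c2 (struct_coef br co2 e3 e1) ->
  support_at (b3, b1, b2) c3 (struct_coef br co3 e1 e2) ->
  listed br.
Proof.
move=> ad n1 n2 g1 g2 g3; have ad2 := adapted_rot ad; have ad3 := adapted_rot ad2.
have hd := ad_dual ad.
have sn b (c : R) : c != 0 -> - bsign R b * c != 0.
  by case: b => c0; rewrite /bsign ?opprK ?mul1r // mulN1r oppr_eq0.
have B1 u v : co1 b1 (br u v) = 0 /\ co1 (~~ b1) (br u v) =
    - bsign R b1 * c1 * (co2 b2 u * co3 b3 v - co2 b2 v * co3 b3 u).
  split; rewrite (br_co3 ad2) /sumb !(co3_struct br) !g1.
    by case: (b1); case: (b2); case: (b3); rewrite /= /bsign; ring.
  by case: (b1); case: (b2); case: (b3); rewrite /= /bsign; ring.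
have B2 u v : co2 b2 (br u v) = 0 /\ co2 (~~ b2) (br u v) =
    - bsign R b2 * c2 * (co3 b3 u * co1 b1 v - co3 b3 v * co1 b1 u).
  split; rewrite (br_co3 ad3) /sumb !(co3_struct br) !g2.
    by case: (b1); case: (b2); case: (b3); rewrite /= /bsign; ring.
  by case: (b1); case: (b2); case: (b3); rewrite /= /bsign; ring.
have B3 u v : co3 b3 (br u v) = 0 /\ co3 (~~ b3) (br u v) =
    - bsign R b3 * c3 * (co1 b1 u * co2 b2 v - co1 b1 v * co2 b2 u).
  split; rewrite (br_co3 ad) /sumb !(co3_struct br) !g3.
    by case: (b1); case: (b2); case: (b3); rewrite /= /bsign; ring.
  by case: (b1); case: (b2); case: (b3); rewrite /= /bsign; ring.
have [z3|n3] := eqVneq c3 0.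
  right; left; apply: (iso_two V6 hd B1 B2 B3 (sn _ _ n1) (sn _ _ n2)).
  by rewrite z3 mulr0.
by left; apply: (iso_free V6 hd B1 B2 B3 (sn _ _ n1) (sn _ _ n2) (sn _ _ n3)).
Qed.

Lemma support_at_scale M (c gamma : R) g : c != 0 ->
  support_at M gamma (fun b1 b2 b3 => c * g b1 b2 b3) -> support_at M (gamma / c) g.
Proof.
move=> c0 h b1 b2 b3; apply: (mulfI c0); rewrite h; case: ifP; rewrite ?mulr0 //.
by rewrite mulrCA divff ?mulr1.
Qed.

(** For T < 6 at least one A_k is positive. Two positive ones can be rotated into the first two
    places, a single one into the third. *)
Lemma forward_normalized br D m e1 e2 e3 co1 co2 co3 (l1 l2 l3 : bool -> R) :
  adapted (V := V) br D 1 0 m e1 e2 e3 co1 co2 co3 l1 l2 l3 -> m != 0 -> listed br.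
Proof.
move=> ad m0; have ad2 := adapted_rot ad; have ad3 := adapted_rot ad2.
have c0 : - m^-1 != 0 by rewrite oppr_eq0 invr_eq0.
have cz x : - m^-1 * x = 0 -> x = 0.
  by move=> /eqP; rewrite mulf_eq0 (negbTE c0) => /eqP.
have many f1 f2 f3 k1 k2 k3 (a1 a2 a3 : bool -> R) :
    adapted (V := V) br D 1 0 m f1 f2 f3 k1 k2 k3 a1 a2 a3 ->
    let s (a : bool -> R) := sumb (fun b => - m^-1 * a b) in
    let T := s a1 + s a2 + s a3 in
    T < 6 -> 0 < s a1 + 4 - T -> 0 < s a2 + 4 - T -> listed br.
  move=> a s T lt6 p1 p2; have sys := adapted_system a m0.
  have [b1 [b2 [b3 [c1 [c2 [c3 [n1 n2 [s1 s2 s3]]]]]]]] :=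
    torsion_classify_many sys lt6 p1 p2.
  by apply: (forward_many a _ _ (support_at_scale c0 s1) (support_at_scale c0 s2)
    (support_at_scale c0 s3)); rewrite mulf_neq0 ?invr_eq0.
have one f1 f2 f3 k1 k2 k3 (a1 a2 a3 : bool -> R) :
    adapted (V := V) br D 1 0 m f1 f2 f3 k1 k2 k3 a1 a2 a3 ->
    let s (a : bool -> R) := sumb (fun b => - m^-1 * a b) in
    let T := s a1 + s a2 + s a3 in
    T < 6 -> s a1 + 4 - T <= 0 -> s a2 + 4 - T <= 0 -> listed br.
  move=> a s T lt6 p1 p2; have sys := adapted_system a m0.
  have [z [k k0 h]] := torsion_classify_one sys lt6 p1 p2.
  apply: (forward_one a (k := k / - m^-1)).
  - by move=> b1 b2 b3; have [/cz -> /cz ->] := z b1 b2 b3.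
  - by rewrite mulf_neq0 // invr_eq0.
  - move=> b1 b2 b3; case: (h b1 b2 b3) => [/cz|e]; first by left.
    by right; apply: (mulfI c0); rewrite e mulrA mulrCA divff ?mulr1 // mulrC.
have sys := adapted_system ad m0.
set s := fun a : bool -> R => sumb (fun b => - m^-1 * a b).
have [lt6|ge6] := boolP (s l1 + s l2 + s l3 < 6); last first.
  have z1 := torsion_trivial sys ge6.
  have z2 := torsion_trivial (adapted_system ad2 m0) (_ : ~~ (_ < 6)).
  have z3 := torsion_trivial (adapted_system ad3 m0) (_ : ~~ (_ < 6)).
  apply: (forward_one ad _ (oner_neq0 R)).
    by move=> b1 b2 b3; split; [exact: cz (z1 b1 b2 b3)|apply: cz; apply: z2;
      rewrite addrC addrA].
  by move=> b1 b2 b3; left; apply: cz; apply: z3; rewrite -addrA addrC.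
have [p1|p1] := ltrP 0 (s l1 + 4 - (s l1 + s l2 + s l3));
  have [p2|p2] := ltrP 0 (s l2 + 4 - (s l1 + s l2 + s l3));
  have [p3|p3] := ltrP 0 (s l3 + 4 - (s l1 + s l2 + s l3)).
all: first [ by apply: (many _ _ _ _ _ _ _ _ _ ad); rewrite /= -/(s l1) -/(s l2) -/(s l3); lra
 | by apply: (many _ _ _ _ _ _ _ _ _ ad2); rewrite /= -/(s l1) -/(s l2) -/(s l3); lra
 | by apply: (many _ _ _ _ _ _ _ _ _ ad3); rewrite /= -/(s l1) -/(s l2) -/(s l3); lra
 | by apply: (one _ _ _ _ _ _ _ _ _ ad); rewrite /= -/(s l1) -/(s l2) -/(s l3); lra
 | by apply: (one _ _ _ _ _ _ _ _ _ ad2); rewrite /= -/(s l1) -/(s l2) -/(s l3); lra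
 | by apply: (one _ _ _ _ _ _ _ _ _ ad3); rewrite /= -/(s l1) -/(s l2) -/(s l3); lra ].
Qed.

End Forward.

Section SU3Frame.
Variables (R : realType) (V : vectType R) (f : 6.-tuple V).
Hypothesis f_basis : basis_of fullv f.

Definition frame_e1 (b : bool) : V := tnth f (idx (if b then 4 else 1)).
Definition frame_e2 (b : bool) : V :=
  if b then - tnth f (idx 3) else tnth f (idx 2).
Definition frame_e3 (b : bool) : V := tnth f (idx (if b then 6 else 5)).

Lemma sum_idx (W : nmodType) (F : 'I_6 -> W) :
  \sum_i F i = F (idx 1) + F (idx 2) + F (idx 3) + F (idx 4) + F (idx 5) + F (idx 6).
Proof.
rewrite !big_ord_recl big_ord0 addr0 !addrA.
by congr (F _ + F _ + F _ + F _ + F _ + F _); apply: val_inj; rewrite /= inordK.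
Qed.

Lemma coord_frame (i j : nat) : (i.-1 < 6)%N -> (j.-1 < 6)%N ->
  coord f (idx i) (tnth f (idx j)) = (i.-1 == j.-1)%:R.
Proof.
move=> hi hj; rewrite (tnth_nth 0) coord_free ?(basis_free f_basis) //.
by rewrite eq_sym -val_eqE /= !inordK.
Qed.

Lemma frame_dual : dual_frame frame_e1 frame_e2 frame_e3
  (frame_co1 f) (frame_co2 f) (frame_co3 f).
Proof.
split.
- move=> b; rewrite /frame_co1 /frame_co2 /frame_co3; split=> a u v;
    try exact: linearP.
  case: (b); last exact: linearP.
  by rewrite mulrN -opprD; congr (- _); exact: linearP.
- by move=> [] []; rewrite /frame_co1 /frame_e1 /frame_e2 /frame_e3 ?linearN /= ?coord_frame ?oppr0.
- by move=> [] []; rewrite /frame_co2 /frame_e1 /frame_e2 /frame_e3 ?linearN /= ?coord_frame ?opprK ?oppr0.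
- by move=> [] []; rewrite /frame_co3 /frame_e1 /frame_e2 /frame_e3 ?linearN /= ?coord_frame ?oppr0.
- move=> u; rewrite {1}(coord_basis f_basis (memvf u)).
  under eq_bigr do rewrite -tnth_nth.
  rewrite sum_idx /frame_co1 /frame_co2 /frame_co3 /frame_e1 /frame_e2 /frame_e3.
  rewrite scalerN scaleNr opprK -!addrA; congr (_ + _).
  by rewrite !addrA; congr (_ + _ + _); rewrite addrC addrA.
Qed.

Lemma frame_hermitian (h : V -> V -> R) (J : 'End(V)) :
  (forall x y, h x y = \sum_i coord f i x * coord f i y) ->
  frame_complex_structure f J ->
  hermitian_frame h J frame_e1 frame_e2 frame_e3
    (frame_co1 f) (frame_co2 f) (frame_co3 f).
Proof.
move=> hE [JJ J1 J2 J5]; split; first exact: frame_dual.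
  have JJE u : J (J u) = - u by have /lfunP/(_ u) := JJ; rewrite !lfunE /= lfunE.
  have J4 : J (tnth f (idx 4)) = - tnth f (idx 1) by rewrite -J1 JJE.
  have J3 : J (- tnth f (idx 3)) = - tnth f (idx 2) by rewrite -J2 JJE.
  have J6 : J (tnth f (idx 6)) = - tnth f (idx 5) by rewrite -J5 JJE.
  by case; split.
move=> u v; rewrite hE sum_idx /frame_co1 /frame_co2 /frame_co3; ring.
Qed.

End SU3Frame.

Section ForwardDirection.
Variables (R : realType) (V : vectType R).
Hypothesis V6 : \dim {:V} = 6%N.

(** If C S = 0, or T < 6 and so D is scalar on some plane, the phase is rotated away; at T = 6 the
    coefficients all vanish. *)
Lemma forward_adapted br D C S m e1 e2 e3 co1 co2 co3 (l1 l2 l3 : bool -> R) :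
  adapted (V := V) br D C S m e1 e2 e3 co1 co2 co3 l1 l2 l3 -> m != 0 -> listed br.
Proof.
move=> ad m0; have ad2 := adapted_rot ad; have ad3 := adapted_rot ad2.
have c0 : - m^-1 != 0 by rewrite oppr_eq0 invr_eq0.
have norm f1 f2 f3 k1 k2 k3 (a1 a2 a3 : bool -> R) :
    adapted (V := V) br D C S m f1 f2 f3 k1 k2 k3 a1 a2 a3 ->
    C * S = 0 \/ - m^-1 * a1 false = - m^-1 * a1 true -> listed br.
  move=> a h; have {}h : C * S = 0 \/ a1 false = a1 true.
    by case: h => [|/(mulfI c0)]; [left|right].
  have [f1' [k1' [a1' a']]] := adapted_normalize a h.
  exact: (forward_normalized V6 a' m0).
have [CS|CS] := eqVneq (C * S) 0; first by apply: norm ad _; left.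
have sys := adapted_system ad m0.
have [lt6|ge6] := boolP (sumb (fun b => - m^-1 * l1 b) + sumb (fun b => - m^-1 * l2 b)
    + sumb (fun b => - m^-1 * l3 b) < 6).
  case: (torsion_phase sys CS lt6) => h; [apply: norm ad _|apply: norm ad2 _|apply: norm ad3 _];
    by right.
have cz x : - m^-1 * x = 0 -> x = 0.
  by move=> /eqP; rewrite mulf_eq0 (negbTE c0) => /eqP.
have z1 := torsion_trivial sys ge6.
have z2 := torsion_trivial (adapted_system ad2 m0) (_ : ~~ (_ < 6)).
have z3 := torsion_trivial (adapted_system ad3 m0) (_ : ~~ (_ < 6)).
apply: (forward_one V6 ad _ (oner_neq0 R)).
  by move=> b1 b2 b3; split; [exact: cz (z1 b1 b2 b3)|apply: cz; apply: z2;
    rewrite addrC addrA].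
by move=> b1 b2 b3; left; apply: cz; apply: z3; rewrite -addrA addrC.
Qed.

Lemma conformally_parallel_listed br (S : su3_structure V) (D : 'End(V)) :
  is_lie_bracket br -> is_derivation br D -> lker D = 0%VS ->
  self_adjoint (su3_metric S) D ->
  ((D \o su3_J S) \o (D \o su3_J S) = (su3_J S \o D) \o (su3_J S \o D))%VF ->
  conformally_parallel br S D -> listed br.
Proof.
move=> hlie hder hker hself hcomm [m m0 ht].
have [f [fb So Sp Sm SJ]] := su3P S.
have hf := frame_hermitian fb Sm SJ.
have t := (torsion_eqsP br D So Sp Sm m).1 ht.
have JJ u : su3_J S (su3_J S u) = - u.
  by case: SJ => /lfunP/(_ u) + _ _ _; rewrite !lfunE /= lfunE.
have hC u v : su3_metric S u v = su3_metric S v u.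
  by rewrite !Sm; apply: eq_bigr => i _; rewrite mulrC.
have hJ u v : su3_metric S (su3_J S u) v = - su3_metric S u (su3_J S v).
  rewrite [in RHS]hC -!(hermitian_omega _ _ hf) /omega2; ring.
have Dc u : D (su3_J S (D (su3_J S u))) = su3_J S (D (su3_J S (D u))).
  by have /lfunP/(_ u) := hcomm; rewrite !comp_lfunE.
have [e1 [e2 [e3 [co1 [co2 [co3 [he [l1 [l2 [l3 hl]]]]]]]]]] :=
  unitary_diagonalization fb Sm JJ hJ hself Dc.
have [C [S' [CS vol]]] := vol_change hf he.
have D0 u : D u = 0 -> u = 0.
  by move=> Du; apply/eqP; rewrite -memv0 -hker memv_ker Du.
apply: (@forward_adapted br D C S' m e1 e2 e3 co1 co2 co3 l1 l2 l3) => //.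
case: (he) => hd _ _; split=> //.
- by move=> a u v; rewrite linearP.
- have z1 : 1 != 0 :> R by apply: oner_neq0.
  have nz (c : V -> R) e l : scalar c -> c e = 1 -> D e = l *: e -> l != 0.
    move=> /scalarE [_ _ _ c0] ce De; apply: contra_eq_neq ce => l0.
    by rewrite (D0 e) ?c0 ?De ?l0 ?scale0r // eq_sym.
  move=> b; have [h1 h2 h3] := hl b; have [d1 d2 d3] := df_lin hd b.
  have [v1 _ _] := df_dual1 hd b b; have [_ v2 _] := df_dual2 hd b b.
  have [_ _ v3] := df_dual3 hd b b; rewrite eqxx in v1 v2 v3.
  by split; [apply: nz d1 v1 h1|apply: nz d2 v2 h2|apply: nz d3 v3 h3].
- have <- : omega2 (frame_co1 f) (frame_co2 f) (frame_co3 f) = omega2 co1 co2 co3.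
    apply/funext => u; apply/funext => v.
    by rewrite (hermitian_omega _ _ hf) (hermitian_omega _ _ he).
  have <- : vol_re (frame_co1 f) (frame_co2 f) (frame_co3 f) = (fun u v w : V =>
      C * vol_re co1 co2 co3 u v w - S' * vol_im co1 co2 co3 u v w).
    by apply/funext => u; apply/funext => v; apply/funext => w; case: (vol u v w).
  have <- : vol_im (frame_co1 f) (frame_co2 f) (frame_co3 f) = (fun u v w : V =>
      S' * vol_re co1 co2 co3 u v w + C * vol_im co1 co2 co3 u v w).
    by apply/funext => u; apply/funext => v; apply/funext => w; case: (vol u v w).
  exact: t.
Qed.

End ForwardDirection.

(** * Construction of the solutions *)

Section Backward.
Variables (R : realType) (V : vectType R) (br : V -> V -> V).
Hypothesis V6 : \dim {:V} = 6%N.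

Lemma basis_of_dual (f : 6.-tuple V) (y : 'I_6 -> V -> R) :
  (forall i, scalar (y i)) -> (forall i j, y i (tnth f j) = (i == j)%:R) ->
  basis_of fullv f /\ forall i u, coord f i u = y i u.
Proof.
move=> ys yf.
have ysum (r : 'I_6 -> R) i : y i (\sum_j r j *: f`_j) = r i.
  have [yD yZ _ y0] := scalarE (ys i).
  rewrite (big_morph _ yD y0) (bigD1 i) //= big1 ?addr0 ?yZ -?tnth_nth ?yf ?eqxx ?mulr1 //.
  by move=> j ji; rewrite yZ -tnth_nth yf eq_sym (negbTE ji) mulr0.
have Xf : free f.
  apply/freeP => k k0 i; have := congr1 (y i) k0; have [_ _ _ ->] := scalarE (ys i).
  by rewrite ysum.
have fb : basis_of fullv f by rewrite basisEfree Xf subvf V6 size_tuple.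
split=> // i u; rewrite {2}(coord_basis fb (memvf u)).
by rewrite ysum.
Qed.

Lemma frame_of_iso (F : {linear V -> 'rV[R]_6}) (s : seq R) (p : seq nat) :
  bijective F -> size s = 6%N -> size p = 6%N -> all (fun x => x != 0) s ->
  uniq p -> all (fun k => (k < 6)%N) p ->
  exists f : 6.-tuple V, basis_of fullv f /\
    forall (i : 'I_6) u, coord f i u = s`_i * F u 0 (inord (nth 0%N p i)).
Proof.
move=> [G FK GK] s6 p6 s0 up pl.
pose f := [tuple G ((s`_i)^-1 *: delta_mx 0 (inord (nth 0%N p i))) | i < 6].
exists f; apply: basis_of_dual => [i|i j].
  by move=> a u v; rewrite linearP !mxE mulrDr mulrCA.
have sn : s`_j != 0 by apply: (allP s0); rewrite mem_nth ?s6.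
rewrite tnth_mktuple GK !mxE eqxx /= -val_eqE /= !inordK; last first.
- by apply: (allP pl); rewrite mem_nth ?p6.
- by apply: (allP pl); rewrite mem_nth ?p6.
rewrite nth_uniq ?p6 // val_eqE; case: eqP => [->|]; last by rewrite !mulr0.
by rewrite mulVKf.
Qed.

(** The maps D and J are built from prescribed coordinates. The hypothesis concerns any map with the
    coordinates of D, so that an application only has to verify identities in the bracket
    coefficients. *)
Lemma frame_solution (f : 6.-tuple V) (l1 l2 l3 : bool -> R) (m : R) :
  let co1 := frame_co1 f in let co2 := frame_co2 f in let co3 := frame_co3 f in
  basis_of fullv f -> (forall b, [/\ l1 b != 0, l2 b != 0 & l3 b != 0]) -> m != 0 ->
  (forall D : V -> V, (forall b u, [/\ co1 b (D u) = l1 b * co1 b u,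
      co2 b (D u) = l2 b * co2 b u & co3 b (D u) = l3 b * co3 b u]) ->
    (forall b u v, [/\ co1 b (br (D u) v) + co1 b (br u (D v)) = l1 b * co1 b (br u v),
      co2 b (br (D u) v) + co2 b (br u (D v)) = l2 b * co2 b (br u v)
      & co3 b (br (D u) v) + co3 b (br u (D v)) = l3 b * co3 b (br u v)]) /\
    torsion_eqs br D (omega2 co1 co2 co3) (vol_re co1 co2 co3) (vol_im co1 co2 co3) m) ->
  exists (S : su3_structure V) (D : 'End(V)),
     [/\ is_derivation br D,
         lker D = 0%VS,
         self_adjoint (su3_metric S) D,
         ((D \o su3_J S) \o (D \o su3_J S) =
          (su3_J S \o D) \o (su3_J S \o D))%VF
       & conformally_parallel br S D].
Proof.
move=> co1 co2 co3 fb lam m0 hD.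
have hd := frame_dual fb.
have cE1 b := scalarE (let: And3 h _ _ := df_lin hd b in h).
have cE2 b := scalarE (let: And3 _ h _ := df_lin hd b in h).
have cE3 b := scalarE (let: And3 _ _ h := df_lin hd b in h).
have ext u v : (forall b, [/\ co1 b u = co1 b v, co2 b u = co2 b v & co3 b u = co3 b v]) ->
    u = v.
  move=> h; rewrite (df_expand hd u) (df_expand hd v) -/co1 -/co2 -/co3.
  by case: (h false) (h true) => -> -> -> [-> -> ->].
pose e1 := frame_e1 f; pose e2 := frame_e2 f; pose e3 := frame_e3 f.
pose comb (c1 c2 c3 : bool -> V -> R) u :=
  (c1 false u *: e1 false + c1 true u *: e1 true) +
  (c2 false u *: e2 false + c2 true u *: e2 true) +
  (c3 false u *: e3 false + c3 true u *: e3 true).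
have combE (c1 c2 c3 : bool -> V -> R) : (forall b, [/\ scalar (c1 b), scalar (c2 b) & scalar (c3 b)]) ->
    exists A : 'End(V), forall b u, [/\ co1 b (A u) = c1 b u, co2 b (A u) = c2 b u
      & co3 b (A u) = c3 b u].
  move=> hc.
  have A_lin : linear (comb c1 c2 c3).
    move=> a u v; rewrite /comb; case: (hc false) (hc true) => -> -> -> [-> -> ->].
    rewrite !scalerDl !scalerDr !scalerA.
    rewrite -[RHS]addrACA; congr (_ + _); last by rewrite addrACA.
    by rewrite -[RHS]addrACA; congr (_ + _); rewrite addrACA.
  pose A : {linear V -> V} := HB.pack (comb c1 c2 c3)
    (GRing.isLinear.Build _ _ _ _ _ A_lin).
  exists (linfun A) => b u; rewrite lfunE /= /comb.
  have [D1 Z1 _ _] := cE1 b; have [D2 Z2 _ _] := cE2 b; have [D3 Z3 _ _] := cE3 b.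
  have d1 b' := df_dual1 hd b b'; have d2 b' := df_dual2 hd b b'.
  have d3 b' := df_dual3 hd b b'.
  rewrite /co1 /co2 /co3 !D1 !Z1 !D2 !Z2 !D3 !Z3.
  case: (d1 false) (d1 true) => -> -> -> [-> -> ->].
  case: (d2 false) (d2 true) => -> -> -> [-> -> ->].
  case: (d3 false) (d3 true) => -> -> -> [-> -> ->].
  by case: (b); split => /=; ring.
have [D DE] : exists D : 'End(V), forall b u, [/\ co1 b (D u) = l1 b * co1 b u,
      co2 b (D u) = l2 b * co2 b u & co3 b (D u) = l3 b * co3 b u].
  apply: (combE (fun b u => l1 b * co1 b u) (fun b u => l2 b * co2 b u)
    (fun b u => l3 b * co3 b u)) => b.
  by have [h1 h2 h3] := df_lin hd b; split; apply: scalar_scale.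
pose j (c : bool -> V -> R) b u := (if b then 1 else -1) * c (~~ b) u.
have [J JE] : exists J : 'End(V), forall b u, [/\ co1 b (J u) = j co1 b u,
      co2 b (J u) = j co2 b u & co3 b (J u) = j co3 b u].
  apply: combE => b.
  by have [h1 h2 h3] := df_lin hd (~~ b); split; apply: scalar_scale.
have [hder ht] := hD D DE.
pose h x y := \sum_i coord f i x * coord f i y.
pose psr x := complex.Re (frame_volume f x).
pose psi x := complex.Im (frame_volume f x).
have J1 u b : co1 b (J u) = j co1 b u by case: (JE b u).
have J2 u b : co2 b (J u) = j co2 b u by case: (JE b u).
have J3 u b : co3 b (J u) = j co3 b u by case: (JE b u).
have D1 u b : co1 b (D u) = l1 b * co1 b u by case: (DE b u).
have D2 u b : co2 b (D u) = l2 b * co2 b u by case: (DE b u).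
have D3 u b : co3 b (D u) = l3 b * co3 b u by case: (DE b u).
have d11 b b' : co1 b (e1 b') = (b == b')%:R by case: (df_dual1 hd b b').
have d12 b b' : co1 b (e2 b') = 0 by case: (df_dual1 hd b b').
have d13 b b' : co1 b (e3 b') = 0 by case: (df_dual1 hd b b').
have d21 b b' : co2 b (e1 b') = 0 by case: (df_dual2 hd b b').
have d22 b b' : co2 b (e2 b') = (b == b')%:R by case: (df_dual2 hd b b').
have d23 b b' : co2 b (e3 b') = 0 by case: (df_dual2 hd b b').
have d31 b b' : co3 b (e1 b') = 0 by case: (df_dual3 hd b b').
have d32 b b' : co3 b (e2 b') = 0 by case: (df_dual3 hd b b').
have d33 b b' : co3 b (e3 b') = (b == b')%:R by case: (df_dual3 hd b b').
have hJ : frame_complex_structure f J.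
  split.
  - apply/lfunP => u; rewrite comp_lfunE opp_lfunE id_lfunE; apply: ext => b.
    have N1 : co1 b (- u) = - co1 b u by have [_ _ N _] := cE1 b; exact: N.
    have N2 : co2 b (- u) = - co2 b u by have [_ _ N _] := cE2 b; exact: N.
    have N3 : co3 b (- u) = - co3 b u by have [_ _ N _] := cE3 b; exact: N.
    rewrite N1 N2 N3 J1 J2 J3 /j J1 J2 J3 /j.
    by case: (b) => /=; split; ring.
  - change (J (e1 false) = e1 true); apply: ext => b.
    by rewrite J1 J2 J3 /j !(d11, d21, d31); case: (b); split => /=; ring.
  - change (J (e2 false) = e2 true); apply: ext => b.
    by rewrite J1 J2 J3 /j !(d12, d22, d32); case: (b); split => /=; ring.
  - change (J (e3 false) = e3 true); apply: ext => b.
    by rewrite J1 J2 J3 /j !(d13, d23, d33); case: (b); split => /=; ring.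
have SP : exists g : 6.-tuple V,
    [/\ basis_of fullv g, frame_omega f = frame_omega g, cform psr psi = frame_volume g,
      forall x y, h x y = \sum_i coord g i x * coord g i y & frame_complex_structure g J].
  exists f; split=> //; apply/funext => x; rewrite /cform /psr /psi.
  by case: (frame_volume f x).
have hE x y : h x y = \sum_i coord f i x * coord f i y by [].
have [_ _ hh] := frame_hermitian fb hE hJ.
have Epsi : cform psr psi = frame_volume f.
  by apply/funext => x; rewrite /cform /psr /psi; case: (frame_volume f x).
pose S := @SU3Structure R V (frame_omega f) psr psi h J SP.
exists S, D; split.
- move=> x y; apply: ext => b; have [h1 h2 h3] := hder b x y.
  have [A1 _ _ _] := cE1 b; have [A2 _ _ _] := cE2 b; have [A3 _ _ _] := cE3 b.
  by rewrite D1 D2 D3 -h1 -h2 -h3; split; [exact/esym/A1|exact/esym/A2|exact/esym/A3].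
- apply/eqP/lker0P => u v e; apply: ext => b; have [n1 n2 n3] := lam b.
  by split; [apply: (mulfI n1)|apply: (mulfI n2)|apply: (mulfI n3)];
    rewrite -?D1 -?D2 -?D3 e.
- move=> x y; rewrite /= !hh -/co1 -/co2 -/co3 !D1 !D2 !D3; ring.
(* On each plane both sides are minus the product of the two eigenvalues of D. *)
- apply/lfunP => u; rewrite !comp_lfunE /=; apply: ext => b.
  do 4 rewrite ?(D1, J1, D2, J2, D3, J3) /j.
  by case: (b) => /=; split; ring.
exists m => //.
by apply/(torsion_eqsP br D (S := S) (f := f)).
Qed.

End Backward.

Section TorsionIdentities.
Variables (R : comPzRingType) (V : Type) (br : V -> V -> V) (D : V -> V).
Variables (co1 co2 co3 : bool -> V -> R).

(* Here h_j is half the coefficient of the j-th bracket term; the weights solve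
   the linear system which the torsion equations impose on D. *)
Lemma torsion_eqs_one (l1 l2 l3 : bool -> R) (h0 h1 h2 h3 : R) :
  let w b1 b2 u v := co1 b1 u * co2 b2 v - co1 b1 v * co2 b2 u in
  (forall b u v, co1 b (br u v) = 0) -> (forall b u v, co2 b (br u v) = 0) ->
  (forall u v, co3 true (br u v) =
    2 * (h0 * w false false u v - h3 * w true true u v)) ->
  (forall u v, co3 false (br u v) =
    2 * (h1 * w false true u v + h2 * w true false u v)) ->
  (forall b u, co1 b (D u) = l1 b * co1 b u) ->
  (forall b u, co2 b (D u) = l2 b * co2 b u) ->
  (forall b u, co3 b (D u) = l3 b * co3 b u) ->
  l1 false = 1 - h0 - h1 -> l1 true = 1 - h2 - h3 ->
  l2 false = 1 - h0 - h2 -> l2 true = 1 - h1 - h3 ->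
  l3 false = 1 + h1 + h2 -> l3 true = 1 + h0 + h3 ->
  torsion_eqs br D (omega2 co1 co2 co3) (vol_re co1 co2 co3) (vol_im co1 co2 co3) (-1).
Proof.
move=> w br1 br2 br3t br3f D1 D2 D3 a1 b1 a2 b2 a3 b3; split.
- move=> u v y z; rewrite /diff3 /vol_re /alt3 !br1 !br2 !br3t !br3f /w; ring.
- move=> u v y; rewrite /omega2 /vol_re /alt3 !br1 !br2 !br3t !br3f /w !D1 !D2 !D3.
  rewrite a1 b1 a2 b2 a3 b3; ring.
- move=> u v y z t; rewrite /wedge_sq /omega2 !br1 !br2 !br3t !br3f /w; ring.
- move=> u v y z; rewrite /diff3 /wedge_sq /omega2 /vol_im /alt3 !br1 !br2 !br3t !br3f /w.
  rewrite !D1 !D2 !D3 a1 b1 a2 b2 a3 b3; ring.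
Qed.

(** D has weight 3 h on the generators and 6 h on their brackets; writing m = -1 as - 5 h makes all
    equations homogeneous in h. *)
Lemma torsion_eqs_free (h : R) :
  (forall u v, co1 false (br u v) = 0) -> (forall u v, co2 false (br u v) = 0) ->
  (forall u v, co3 false (br u v) = 0) -> 
  (forall u v, co1 true (br u v) = 2 * h * (co2 false u * co3 false v - co2 false v * co3 false u)) ->
  (forall u v, co2 true (br u v) = 2 * h * (co3 false u * co1 false v - co3 false v * co1 false u)) ->
  (forall u v, co3 true (br u v) = 2 * h * (co1 false u * co2 false v - co1 false v * co2 false u)) ->
  (forall b u, co1 b (D u) = (if b then 6 * h else 3 * h) * co1 b u) ->
  (forall b u, co2 b (D u) = (if b then 6 * h else 3 * h) * co2 b u) ->
  (forall b u, co3 b (D u) = (if b then 6 * h else 3 * h) * co3 b u) ->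
  5 * h = 1 ->
  torsion_eqs br D (omega2 co1 co2 co3) (vol_re co1 co2 co3) (vol_im co1 co2 co3) (-1).
Proof.
move=> br1 br2 br3 br1t br2t br3t D1 D2 D3 h5; rewrite -[X in torsion_eqs _ _ _ _ _ (- X)]h5.
split.
- move=> u v y z; rewrite /diff3 /vol_re /alt3 !br1 !br2 !br3 !br1t !br2t !br3t; ring.
- move=> u v y; rewrite /omega2 /vol_re /alt3 !br1 !br2 !br3 !br1t !br2t !br3t !D1 !D2 !D3; ring.
- move=> u v y z t; rewrite /wedge_sq /omega2 !br1 !br2 !br3 !br1t !br2t !br3t; ring.
- move=> u v y z; rewrite /diff3 /wedge_sq /omega2 /vol_im /alt3 !br1 !br2 !br3 !br1t !br2t !br3t.
  rewrite !D1 !D2 !D3; ring.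
Qed.

End TorsionIdentities.

Section BackwardCases.
Variables (R : realType) (V : vectType R) (br : V -> V -> V).
Hypothesis V6 : \dim {:V} = 6%N.

Definition has_solution : Prop := exists (S : su3_structure V) (D : 'End(V)),
     [/\ is_derivation br D,
         lker D = 0%VS,
         self_adjoint (su3_metric S) D,
         ((D \o su3_J S) \o (D \o su3_J S) =
          (su3_J S \o D) \o (su3_J S \o D))%VF
       & conformally_parallel br S D].

(* The rescaled coordinates s_i x_(p_i) of R^6, indexed as the covectors of an
   adapted frame f^1, .., f^6. *)
Definition row_co (s : seq R) (p : seq nat) k (r : 'rV[R]_6) : R :=
  s`_k * r 0 (inord (nth 0%N p k)).
Definition row_co1 s p (b : bool) := row_co s p (if b then 3 else 0).
Definition row_co2 s p (b : bool) r :=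
  if b then - row_co s p 2 r else row_co s p 1 r.
Definition row_co3 s p (b : bool) := row_co s p (if b then 5 else 4).

Lemma frame_rows (b : 6.-tuple (form R 'rV[R]_6 2)) s p :
  lie_isomorphic br (tuple_bracket b) -> size s = 6%N -> size p = 6%N ->
  all (fun x => x != 0) s -> uniq p -> all (fun k => (k < 6)%N) p ->
  exists (f : 6.-tuple V) (F : V -> 'rV[R]_6), [/\ basis_of fullv f,
    forall c u, frame_co1 f c u = row_co1 s p c (F u),
    forall c u, frame_co2 f c u = row_co2 s p c (F u),
    forall c u, frame_co3 f c u = row_co3 s p c (F u)
    & forall u v, F (br u v) = tuple_bracket b (F u) (F v)].
Proof.
move=> [F bF Fbr] s6 p6 s0 up pl.
have [f [fb fE]] := frame_of_iso V6 bF s6 p6 s0 up pl.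
by exists f, F; split=> // -[] u;
  rewrite /frame_co1 /frame_co2 /frame_co3 /row_co1 /row_co2 /row_co3 /row_co fE idxK.
Qed.

(** The condition on each h_j is the derivation rule for its bracket term, with the weights of
    [torsion_eqs_one]. Non-negative h_j with sum below 1 keep all these weights positive, so D is
    non-singular. *)
Lemma backward_one b s p (h0 h1 h2 h3 : R) :
  lie_isomorphic br (tuple_bracket b) -> size s = 6%N -> size p = 6%N ->
  all (fun x => x != 0) s -> uniq p -> all (fun k => (k < 6)%N) p ->
  let co1 := row_co1 s p in let co2 := row_co2 s p in let co3 := row_co3 s p in
  let tb := tuple_bracket b in
  let w b1 b2 x y := co1 b1 x * co2 b2 y - co1 b1 y * co2 b2 x in
  (forall c x y, co1 c (tb x y) = 0) -> (forall c x y, co2 c (tb x y) = 0) ->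
  (forall x y, co3 true (tb x y) =
    2 * (h0 * w false false x y - h3 * w true true x y)) ->
  (forall x y, co3 false (tb x y) =
    2 * (h1 * w false true x y + h2 * w true false x y)) ->
  (forall h, h \in [:: h0; h1; h2; h3] ->
    0 <= h /\ h * (1 - (h0 + h1 + h2 + h3) - 2 * h) = 0) ->
  h0 + h1 + h2 + h3 < 1 -> has_solution.
Proof.
move=> iso s6 p6 s0 up pl co1 co2 co3 tb w br1 br2 br3t br3f hh hlt.
have [f [F [fb E1 E2 E3 Fbr]]] := frame_rows iso s6 p6 s0 up pl.
have [|p0 c0] := hh h0; first by rewrite !inE eqxx.
have [|p1 c1] := hh h1; first by rewrite !inE eqxx !orbT.
have [|p2 c2] := hh h2; first by rewrite !inE eqxx !orbT.
have [|p3 c3] := hh h3; first by rewrite !inE eqxx !orbT.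
pose l1 (c : bool) := if c then 1 - h2 - h3 else 1 - h0 - h1.
pose l2 (c : bool) := if c then 1 - h1 - h3 else 1 - h0 - h2.
pose l3 (c : bool) := if c then 1 + h0 + h3 else 1 + h1 + h2.
apply: (@frame_solution _ _ br f l1 l2 l3 (-1)) => //.
- by move=> c; rewrite /l1 /l2 /l3; case: c; split; apply: lt0r_neq0; lra.
- by rewrite oppr_eq0 oner_eq0.
move=> D hD.
have D1 c u : frame_co1 f c (D u) = l1 c * frame_co1 f c u by case: (hD c u).
have D2 c u : frame_co2 f c (D u) = l2 c * frame_co2 f c u by case: (hD c u).
have D3 c u : frame_co3 f c (D u) = l3 c * frame_co3 f c u by case: (hD c u).
have B1 c u v : frame_co1 f c (br u v) = 0 by rewrite E1 Fbr; apply: br1.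
have B2 c u v : frame_co2 f c (br u v) = 0 by rewrite E2 Fbr; apply: br2.
pose wf b1 b2 u v := frame_co1 f b1 u * frame_co2 f b2 v
  - frame_co1 f b1 v * frame_co2 f b2 u.
have B3t u v : frame_co3 f true (br u v) =
    2 * (h0 * wf false false u v - h3 * wf true true u v).
  by rewrite E3 Fbr /wf !E1 !E2; apply: br3t.
have B3f u v : frame_co3 f false (br u v) =
    2 * (h1 * wf false true u v + h2 * wf true false u v).
  by rewrite E3 Fbr /wf !E1 !E2; apply: br3f.
split; last exact: (torsion_eqs_one B1 B2 B3t B3f D1 D2 D3).
move=> c u v; rewrite !B1 !B2 !mulr0 !addr0; split=> //.
case: c; rewrite ?B3t ?B3f /wf !D1 !D2 /l1 /l2 /l3.
  have := congr1 ( *%R (2 * wf false false u v)) c0.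
  by have := congr1 ( *%R (2 * wf true true u v)) c3; rewrite /wf; lra.
have := congr1 ( *%R (2 * wf false true u v)) c1.
by have := congr1 ( *%R (2 * wf true false u v)) c2; rewrite /wf; lra.
Qed.

Lemma backward_free : isomorphic_to br 0 0 0 (e2_ 1 2) (e2_ 1 3) (e2_ 2 3) ->
  has_solution.
Proof.
move=> iso; pose h : R := 5^-1.
have h0 : h != 0 by rewrite invr_eq0 pnatr_eq0.
(* The generators become x_1, x_2, x_3 and their brackets y_1, y_2, y_3. The factor - 2 h
   compensates the sign in e^i([x, y]) = - b_i(x, y); on f^3 the sign of f^2 - i f^3 puts e^13 into
   cyclic order. *)
have [|||f [F [fb E1 E2 E3 Fbr]]] := frame_rows
  (s := [:: 1; 1; - (2 * h); - (2 * h); 1; - (2 * h)]) (p := [:: 0; 1; 4; 5; 2; 3]%N)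
  iso erefl erefl _ _ _ => //=.
  by rewrite oner_neq0 !oppr_eq0 !mulf_neq0 ?pnatr_eq0.
pose l (c : bool) := if c then 6 * h else 3 * h.
apply: (@frame_solution _ _ br f l l l (-1)) => //.
- by move=> [] ; rewrite /l !mulf_neq0 ?pnatr_eq0.
- by rewrite oppr_eq0 oner_eq0.
move=> D hD.
have D1 c u : frame_co1 f c (D u) = l c * frame_co1 f c u by case: (hD c u).
have D2 c u : frame_co2 f c (D u) = l c * frame_co2 f c u by case: (hD c u).
have D3 c u : frame_co3 f c (D u) = l c * frame_co3 f c u by case: (hD c u).
have B1f u v : frame_co1 f false (br u v) = 0.
  by rewrite E1 Fbr /row_co1 /row_co /= mxE (tnth_nth 0) inordK //= ?fctE ?oppr0 ?mulr0.
have B2f u v : frame_co2 f false (br u v) = 0.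
  by rewrite E2 Fbr /row_co2 /row_co /= mxE (tnth_nth 0) inordK //= ?fctE ?oppr0 ?mulr0.
have B3f u v : frame_co3 f false (br u v) = 0.
  by rewrite E3 Fbr /row_co3 /row_co /= mxE (tnth_nth 0) inordK //= ?fctE ?oppr0 ?mulr0.
have B1t u v : frame_co1 f true (br u v) = 2 * h *
   (frame_co2 f false u * frame_co3 f false v - frame_co2 f false v * frame_co3 f false u).
  rewrite !E1 !E2 !E3 Fbr /row_co1 /row_co2 /row_co3 /row_co /= mxE (tnth_nth 0) inordK //=.
  by rewrite e2_E /idx /=; ring.
have B2t u v : frame_co2 f true (br u v) = 2 * h *
   (frame_co3 f false u * frame_co1 f false v - frame_co3 f false v * frame_co1 f false u).
  rewrite !E1 !E2 !E3 Fbr /row_co1 /row_co2 /row_co3 /row_co /= mxE (tnth_nth 0) inordK //=.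
  by rewrite e2_E /idx /=; ring.
have B3t u v : frame_co3 f true (br u v) = 2 * h *
   (frame_co1 f false u * frame_co2 f false v - frame_co1 f false v * frame_co2 f false u).
  rewrite !E1 !E2 !E3 Fbr /row_co1 /row_co2 /row_co3 /row_co /= mxE (tnth_nth 0) inordK //=.
  by rewrite e2_E /idx /=; ring.
split; last first.
  by apply: (torsion_eqs_free B1f B2f B3f B1t B2t B3t D1 D2 D3); rewrite mulfV ?pnatr_eq0.
by move=> [] u v; rewrite ?B1f ?B2f ?B3f ?B1t ?B2t ?B3t ?D1 ?D2 ?D3 /l; split; ring.
Qed.

Lemma form0E k (x : 'I_k -> 'rV[R]_6) : (0 : form R 'rV[R]_6 k) x = 0.
Proof. by []. Qed.

Lemma formDE k (a b : form R 'rV[R]_6 k) x : (a + b) x = a x + b x.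
Proof. by []. Qed.

Ltac rows_tac := move=> x y; rewrite /row_co1 /row_co2 /row_co3 /row_co /= mxE
  (tnth_nth 0) inordK //= ?form0E ?formDE ?e2_E /idx /=.

(** If n of the h_j are non-zero, the derivation rule makes each of them 1 / (n + 2); in the order
    of the cases n = 2, 3, 2, 4, 1, 0. The covectors dual to brackets are scaled by - 2 h_j, and the
    third factor is negative because the second plane uses - f^3. *)
Lemma backward_rest :
  isomorphic_to br 0 0 0 0 (e2_ 1 2) (e2_ 1 3)
   \/ isomorphic_to br 0 0 0 0 (e2_ 1 2) (e2_ 1 4 + e2_ 2 3)
   \/ isomorphic_to br 0 0 0 0 0 (e2_ 1 2 + e2_ 3 4)
   \/ isomorphic_to br 0 0 0 0 (e2_ 1 3 + e2_ 4 2) (e2_ 1 2 + e2_ 3 4)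
   \/ isomorphic_to br 0 0 0 0 0 (e2_ 1 2)
   \/ isomorphic_to br 0 0 0 0 0 0 -> has_solution.
Proof.
have nz k : - (2 / k.+1%:R) != 0 :> R.
  by rewrite oppr_eq0 mulf_neq0 ?invr_eq0 ?pnatr_eq0.
have n1 := oner_neq0 R.
have nN1 : - 1 != 0 :> R by rewrite oppr_eq0.
case=> [iso|[iso|[iso|[iso|[iso|iso]]]]].
- apply: (backward_one (s := [:: 1; 1; -1; 1; - (2 / 4); - (2 / 4)])
    (p := [:: 0; 1; 2; 3; 5; 4]%N) (h0 := 4^-1) (h1 := 4^-1) (h2 := 0) (h3 := 0) iso) => //.
  + by rewrite /= ?n1 ?nN1 !nz.
  + by case; rows_tac; field.
  + by case; rows_tac; field.
  + by rows_tac; field.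
  + by rows_tac; field.
  + by move=> h; rewrite !inE => /or4P[] /eqP ->; split; lra.
  + by lra.
- apply: (backward_one (s := [:: 1; 1; -1; -1; - (2 / 5); - (2 / 5)])
    (p := [:: 0; 1; 3; 2; 5; 4]%N) (h0 := 5^-1) (h1 := 5^-1) (h2 := 5^-1) (h3 := 0) iso) => //.
  + by rewrite /= ?n1 ?nN1 !nz.
  + by case; rows_tac; field.
  + by case; rows_tac; field.
  + by rows_tac; field.
  + by rows_tac; field.
  + by move=> h; rewrite !inE => /or4P[] /eqP ->; split; lra.
  + by lra.
- apply: (backward_one (s := [:: 1; 1; -1; 1; 1; - (2 / 4)])
    (p := [:: 0; 1; 2; 3; 4; 5]%N) (h0 := 4^-1) (h1 := 0) (h2 := 0) (h3 := 4^-1) iso) => //.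
  + by rewrite /= ?n1 ?nN1 !nz.
  + by case; rows_tac; field.
  + by case; rows_tac; field.
  + by rows_tac; field.
  + by rows_tac; field.
  + by move=> h; rewrite !inE => /or4P[] /eqP ->; split; lra.
  + by lra.
- apply: (backward_one (s := [:: 1; 1; -1; 1; - (2 / 6); - (2 / 6)])
    (p := [:: 0; 1; 2; 3; 4; 5]%N) (h0 := 6^-1) (h1 := 6^-1) (h2 := 6^-1) (h3 := 6^-1) iso) => //.
  + by rewrite /= ?n1 ?nN1 !nz.
  + by case; rows_tac; field.
  + by case; rows_tac; field.
  + by rows_tac; field.
  + by rows_tac; field.
  + by move=> h; rewrite !inE => /or4P[] /eqP ->; split; lra.
  + by lra.
- apply: (backward_one (s := [:: 1; 1; -1; 1; 1; - (2 / 3)])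
    (p := [:: 0; 1; 3; 2; 4; 5]%N) (h0 := 3^-1) (h1 := 0) (h2 := 0) (h3 := 0) iso) => //.
  + by rewrite /= ?n1 ?nN1 !nz.
  + by case; rows_tac; field.
  + by case; rows_tac; field.
  + by rows_tac; field.
  + by rows_tac; field.
  + by move=> h; rewrite !inE => /or4P[] /eqP ->; split; lra.
  + by lra.
- apply: (backward_one (s := [:: 1; 1; -1; 1; 1; 1])
    (p := [:: 0; 1; 2; 3; 4; 5]%N) (h0 := 0) (h1 := 0) (h2 := 0) (h3 := 0) iso) => //.
  + by rewrite /= ?n1 ?nN1 ?nz.
  + by case; rows_tac; field.
  + by case; rows_tac; field.
  + by rows_tac; field.
  + by rows_tac; field.
  + by move=> h; rewrite !inE => /or4P[] /eqP ->; split; lra.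
  + by lra.
Qed.

End BackwardCases.

Theorem theorem4p3 (R : realType) (n : vectType R) (br : n -> n -> n)
    (n_dim : \dim {:n} = 6%N) (n_lie : is_lie_bracket br)
    (n_nilpotent : nilpotent_lie br) :
  (exists (S : su3_structure n) (D : 'End(n)),
     [/\ is_derivation br D,
         lker D = 0%VS,
         self_adjoint (su3_metric S) D,
         ((D \o su3_J S) \o (D \o su3_J S) =
          (su3_J S \o D) \o (su3_J S \o D))%VF
       & conformally_parallel br S D])
  <->
  (isomorphic_to br 0 0 0 (e2_ 1 2) (e2_ 1 3) (e2_ 2 3)
   \/ isomorphic_to br 0 0 0 0 (e2_ 1 2) (e2_ 1 3)
   \/ isomorphic_to br 0 0 0 0 (e2_ 1 2) (e2_ 1 4 + e2_ 2 3)
   \/ isomorphic_to br 0 0 0 0 0 (e2_ 1 2 + e2_ 3 4)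
   \/ isomorphic_to br 0 0 0 0 (e2_ 1 3 + e2_ 4 2) (e2_ 1 2 + e2_ 3 4)
   \/ isomorphic_to br 0 0 0 0 0 (e2_ 1 2)
   \/ isomorphic_to br 0 0 0 0 0 0).
Proof.
split=> [[S [D [hder hker hself hcomm hcp]]]|].
  exact: (conformally_parallel_listed n_dim n_lie hder hker hself hcomm hcp).
by case=> [iso|iso]; [exact: (backward_free n_dim iso)|exact: (backward_rest n_dim iso)].
Qed.
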